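(* For fixed $q\in\mathbb{C}\setminus\{0,-1,-2,\ldots\}$, the generalized polygamma function $\psi(z,q)$ is an entire function of $z$ (in particular the limiting values defining it at $z\in\{0,1,2,\ldots\}$ exist). Moreover $\psi(0,q)=\psi(q)$, where $\psi(q)=\Gamma'(q)/\Gamma(q)$ is the digamma function.
   Context: For $q\in\mathbb{C}\setminus\{0,-1,-2,\ldots\}$, $\zeta(s,q)$ is the Hurwitz zeta function, $\zeta(s,q)=\sum_{n=0}^\infty (n+q)^{-s}$ for $\mathrm{Re}\,s>1$ (principal branch of the powers), continued meromorphically in $s$ to $\mathbb{C}$ (its only singularity is a simple pole at $s=1$ with residue $1$). $\gamma$ is Euler's constant. The generalized polygamma function is defined by $\psi(z,q):=e^{-\gamma z}\frac{\partial}{\partial z}\left[e^{\gamma z}\frac{\zeta(z+1,q)}{\Gamma(-z)}\right]$ for $z\in\mathbb{C}\setminus\{0,1,2,\ldots\}$, and at $z\in\{0,1,2,\ldots\}$ by the corresponding limiting value. *)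

(* Defs.v *)
From Stdlib Require Import Reals Factorial ClassicalEpsilon.
From Coquelicot Require Import Coquelicot.
Open Scope C_scope.

Definition holomorphic_at (f : C -> C) (z : C) : Prop :=
  ex_derive (K := C_AbsRing) (V := C_NormedModule) f z.

Definition entire (f : C -> C) : Prop := forall z : C, holomorphic_at f z.

Definition has_C_limit (f : C -> C) (z l : C) : Prop :=
  filterlim f (@locally' C_UniformSpace z) (@locally C_UniformSpace l).

(* Componentwise limit, as in [C_lim]; meaningful for convergent sequences only. *)
Definition C_Lim_seq (u : nat -> C) : C :=
  (real (Lim_seq (fun n => Re (u n))), real (Lim_seq (fun n => Im (u n)))).

Definition Cexp (z : C) : C := RtoC (exp (Re z)) * (cos (Im z), sin (Im z)).

(* Principal argument, with values in (-PI, PI] for z <> 0. *)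
Definition Carg (z : C) : R :=
  if Rle_dec 0 (Im z) then acos (Re z / Cmod z) else Ropp (acos (Re z / Cmod z)).

Definition Clog (z : C) : C := (ln (Cmod z), Carg z).

(* Principal branch of w ^ s, for w <> 0. *)
Definition Cpower (w s : C) : C := Cexp (s * Clog w).

Definition nonpos_int (q : C) : Prop := exists n : nat, q = - RtoC (INR n).

Definition euler_gamma : R :=
  real (Lim_seq (fun n => sum_n (fun k => / INR (S k)) n - ln (INR (S n)))%R).

Fixpoint rising (z : C) (n : nat) : C :=
  match n with
  | O => 1
  | S m => rising z m * (z + RtoC (INR m))
  end.

(* Gauss's limit  n! n^z / (z (z+1) ... (z+n)),  valid for every z in C outside
   {0, -1, -2, ...}. *)
Definition CGamma (z : C) : C :=
  C_Lim_seq (fun n =>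
    RtoC (INR (fact n)) * Cpower (RtoC (INR n)) z / rising z (S n)).

Definition digamma (q : C) : C := C_derive CGamma q / CGamma q.

Definition is_hurwitz_zeta (q : C) (Z : C -> C) : Prop :=
  (forall s : C, (1 < Re s)%R ->
     is_series (K := C_AbsRing) (V := C_NormedModule)
       (fun n : nat => Cpower (RtoC (INR n) + q) (- s)) (Z s)) /\
  (forall s : C, s <> RtoC 1 -> holomorphic_at Z s) /\
  has_C_limit (fun s => (s - 1) * Z s) 1 1.

(* [is_hurwitz_zeta q] determines its function uniquely on C \ {1}, by the identity
   theorem; the value at the pole s = 1 is arbitrary. *)
Definition hurwitz_zeta (s q : C) : C :=
  epsilon (inhabits (fun _ : C => RtoC 0)) (is_hurwitz_zeta q) s.

Definition polygamma_bracket (q w : C) : C :=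
  Cexp (RtoC euler_gamma * w) * (hurwitz_zeta (w + 1) q / CGamma (- w)).

(* [C_derive] is a total operator, and equals the complex derivative wherever the
   function is complex-differentiable. *)
Definition gen_polygamma_formula (z q : C) : C :=
  Cexp (- RtoC euler_gamma * z) * C_derive (polygamma_bracket q) z.

Definition nonneg_int (z : C) : Prop := exists n : nat, z = RtoC (INR n).

Definition gen_polygamma (z q : C) : C :=
  if excluded_middle_informative (nonneg_int z)
  then C_lim (fun w => gen_polygamma_formula w q) z
  else gen_polygamma_formula z q.

(* Main.v *)
Require Import Defs.
From Stdlib Require Import Reals.
From Coquelicot Require Import Coquelicot.
From Stdlib Require Import Lra Lia Factorial ClassicalEpsilon.
Open Scope C_scope.

(** Put [g s = (s - 1) zeta (s, q)] and [D w = 1 / Gamma (1 + w)]. Since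
    [1 / Gamma (- w) = - w D (- w)], the bracket in the definition of the polygamma function
    equals [B w = - e^(gamma w) g (w + 1) D (- w)] for [w <> 0]: the simple zero of
    [1 / Gamma (- w)] at the origin cancels the pole of zeta. The functions [g] and [D] are
    entire, hence so is [B], and [psi (z, q) = e^(- gamma z) B' z] everywhere, with limits
    where the definition asks for them. As the derivative of an entire function is entire
    ([entire_derive]), so is [psi].

    At the origin [g 1 = D 0 = 1] and [D' 0 = gamma], so that
    [psi (0, q) = - (gamma + g' 1 - gamma) = - g' 1]. Finally [- g' 1] is digamma, because
    both are the limit of [ln n - sum_(k <= n) 1 / (q + k)]: for digamma by differentiating
    logarithmically the product for [D] ([digamma_lim]), for zeta by comparing each term
    with an integral and differentiating at [s = 1] ([is_Cderive_zeta_reg_1]).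

    The Hurwitz zeta function is an arbitrary choice among the functions that satisfy its
    specification, about which one knows complex differentiability and no more. So the
    classical theory of entire functions is developed from Goursat's theorem ([Goursat],
    [entire_primitive]). Cauchy's formula follows from the observation that the slope
    [(f w - f z) / (w - z)] of an entire function with entire derivative is itself entire
    ([entire_slope]), and yields [entire_derive], Riemann's removable singularities
    ([entire_removable]) and Weierstrass' theorem on series ([Weierstrass_series]). The value
    [g' 1] is read off from the half-plane [Re s > 1], where the chosen function is given by
    its series ([is_Cderive_agree_right]).

    It remains to see that the specification can be satisfied ([hurwitz_zeta_spec]). For
    [Re q >= 1], expand [(x + 1)^(1 - s)] in powers of [x] at [x = q + n] up to order [K]
    and sum over [n]. The left hand sides telescope against the first terms, and the others
    are multiples of [zeta (s + i, q)] for [i < K], up to a remainder that converges for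
    [Re s > 1 - K]. This expresses [g s] by the values [g (s + i)] with [1 <= i < K], hence
    extends [g] one vertical strip after the other ([zeta_reg_step]). Other parameters [q]
    are reached by splitting off finitely many terms ([regularized_zeta_shift]). *)

(** * Complex derivatives and limits in epsilon-delta form *)

Definition is_Cderive (f : C -> C) (z l : C) : Prop :=
  is_derive (K := C_AbsRing) (V := C_NormedModule) f z l.
Notation Ccontinuous := (continuous (T := C_UniformSpace) (U := C_UniformSpace)).

Lemma locally_Cmod (z : C) (P : C -> Prop) :
  locally (T := C_UniformSpace) z P <->
  exists d : R, (0 < d)%R /\ forall w : C, (Cmod (w - z) < d)%R -> P w.
Proof.
split.
- intros H.
  destruct (locally_norm_le_locally (V := C_NormedModule) z P H) as [d Hd].
  exists d; split; [apply cond_pos | exact Hd].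
- intros [d [Hd H]].
  apply (locally_le_locally_norm (V := C_NormedModule) z P).
  exists (mkposreal d Hd); exact H.
Qed.

Lemma locally_AbsRing_Cmod (z : C) (P : C -> Prop) :
  locally (T := AbsRing_UniformSpace C_AbsRing) z P <->
  exists d : R, (0 < d)%R /\ forall w : C, (Cmod (w - z) < d)%R -> P w.
Proof. rewrite <- locally_Cmod; symmetry; apply locally_C. Qed.

Lemma is_Cderive_eps (f : C -> C) (z l : C) :
  is_Cderive f z l <->
  forall eps : R, (0 < eps)%R -> exists d : R, (0 < d)%R /\
    forall w : C, (Cmod (w - z) < d)%R ->
      (Cmod (f w - f z - (w - z) * l) <= eps * Cmod (w - z))%R.
Proof.
split.
- intros [_ H] eps Heps.
  specialize (H z (fun P HP => HP) (mkposreal eps Heps)).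
  apply locally_AbsRing_Cmod in H; exact H.
- intros H; split.
  + apply is_linear_scal_l.
  + intros x Hx.
    apply (is_filter_lim_locally_unique (V := AbsRing_NormedModule C_AbsRing)) in Hx; subst x.
    intros [eps Heps]; apply locally_AbsRing_Cmod; exact (H eps Heps).
Qed.

(** [C] carries two uniform structures, one of a product and one of a valued ring, with the
    same neighbourhoods; product and chain rules are available for the second one only. *)
Lemma is_Cderive_AbsRing (f : C -> C) (z l : C) :
  is_Cderive f z l <->
  is_derive (K := C_AbsRing) (V := AbsRing_NormedModule C_AbsRing) f z l.
Proof.
split; intros [_ H].
- split; [apply is_linear_scal_l | exact H].
- split; [apply is_linear_scal_l | exact H].
Qed.

Lemma Ccontinuous_eps (f : C -> C) (z : C) :
  Ccontinuous f z <->
  forall eps : R, (0 < eps)%R -> exists d : R, (0 < d)%R /\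
    forall w : C, (Cmod (w - z) < d)%R -> (Cmod (f w - f z) < eps)%R.
Proof.
split.
- intros H eps Heps.
  assert (HP : locally (T := C_UniformSpace) (f z) (fun y => (Cmod (y - f z) < eps)%R))
    by (apply locally_Cmod; now exists eps).
  specialize (H _ HP); unfold filtermap in H.
  now apply locally_Cmod in H.
- intros H P HP.
  apply locally_Cmod in HP; destruct HP as [e [He HP]].
  destruct (H e He) as [d [Hd Hw]].
  apply locally_Cmod; exists d; split; auto.
Qed.

Lemma has_C_limit_eps (f : C -> C) (z l : C) :
  has_C_limit f z l <->
  forall eps : R, (0 < eps)%R -> exists d : R, (0 < d)%R /\
    forall w : C, w <> z -> (Cmod (w - z) < d)%R -> (Cmod (f w - l) < eps)%R.
Proof.
unfold has_C_limit; split.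
- intros H eps Heps.
  assert (HP : locally (T := C_UniformSpace) l (fun y => (Cmod (y - l) < eps)%R))
    by (apply locally_Cmod; now exists eps).
  specialize (H _ HP); unfold filtermap, locally', within in H.
  apply locally_Cmod in H; destruct H as [d [Hd H]].
  exists d; split; auto.
- intros H P HP.
  apply locally_Cmod in HP; destruct HP as [e [He HP]].
  destruct (H e He) as [d [Hd Hw]].
  unfold filtermap, locally', within.
  apply locally_Cmod; exists d; split; auto.
Qed.

Lemma is_Cderive_continuous (f : C -> C) (z l : C) : is_Cderive f z l -> Ccontinuous f z.
Proof.
intros H P HP; apply locally_C.
apply (ex_derive_continuous (K := C_AbsRing) (V := C_NormedModule) f z); auto; now exists l.
Qed.

Lemma is_Cderive_plus (f g : C -> C) (z a b : C) :
  is_Cderive f z a -> is_Cderive g z b -> is_Cderive (fun w => f w + g w) z (a + b).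
Proof. exact (is_derive_plus (K := C_AbsRing) (V := C_NormedModule) f g z a b). Qed.

Lemma is_Cderive_minus (f g : C -> C) (z a b : C) :
  is_Cderive f z a -> is_Cderive g z b -> is_Cderive (fun w => f w - g w) z (a - b).
Proof. exact (is_derive_minus (K := C_AbsRing) (V := C_NormedModule) f g z a b). Qed.

Lemma is_Cderive_opp (f : C -> C) (z a : C) :
  is_Cderive f z a -> is_Cderive (fun w => - f w) z (- a).
Proof. exact (is_derive_opp (K := C_AbsRing) (V := C_NormedModule) f z a). Qed.

Lemma is_Cderive_const (c z : C) : is_Cderive (fun _ => c) z 0.
Proof. exact (is_derive_const (K := C_AbsRing) (V := C_NormedModule) c z). Qed.

Lemma is_Cderive_id (z : C) : is_Cderive (fun w => w) z 1.
Proof. apply is_Cderive_AbsRing, (is_derive_id (K := C_AbsRing)). Qed.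

Lemma is_Cderive_mult (f g : C -> C) (z a b : C) :
  is_Cderive f z a -> is_Cderive g z b ->
  is_Cderive (fun w => f w * g w) z (a * g z + f z * b).
Proof.
intros Hf Hg; apply is_Cderive_AbsRing in Hf; apply is_Cderive_AbsRing in Hg.
apply is_Cderive_AbsRing.
exact (is_derive_mult (K := C_AbsRing) f g z a b Hf Hg Cmult_comm).
Qed.

Lemma is_Cderive_comp (f g : C -> C) (z a b : C) :
  is_Cderive f (g z) a -> is_Cderive g z b ->
  is_Cderive (fun w => f (g w)) z (b * a).
Proof.
intros Hf Hg; apply is_Cderive_AbsRing in Hg.
exact (is_derive_comp (K := C_AbsRing) (V := C_NormedModule) f g z a b Hf Hg).
Qed.

Lemma is_Cderive_eq (f : C -> C) (z a b : C) : is_Cderive f z a -> a = b -> is_Cderive f z b.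
Proof. now intros H <-. Qed.

Lemma is_Cderive_ext (f g : C -> C) (z a : C) :
  (forall w, f w = g w) -> is_Cderive f z a -> is_Cderive g z a.
Proof. exact (is_derive_ext (K := C_AbsRing) (V := C_NormedModule) f g z a). Qed.

Lemma is_Cderive_ext_near (f g : C -> C) (z a : C) (r : R) :
  (0 < r)%R -> (forall w, (Cmod (w - z) < r)%R -> f w = g w) ->
  is_Cderive f z a -> is_Cderive g z a.
Proof.
intros Hr H; apply is_derive_ext_loc, locally_AbsRing_Cmod; now exists r.
Qed.

Lemma is_Cderive_inj (f : C -> C) (z a b : C) : is_Cderive f z a -> is_Cderive f z b -> a = b.
Proof.
intros Ha Hb; rewrite <- (is_C_derive_unique f z a Ha); now apply is_C_derive_unique.
Qed.

Lemma is_Cderive_inv_id (z : C) : z <> 0 -> is_Cderive Cinv z (- (/ z * / z)).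
Proof.
intros Hz; apply is_Cderive_eps; intros eps Heps.
assert (Hm : (0 < Cmod z)%R) by (now apply Cmod_gt_0).
set (m := Cmod z) in *.
exists (Rmin (m / 2) (eps * m * m * m / 2))%R; split.
{ apply Rmin_pos; [lra | ]. assert (0 < eps * m * m * m)%R by (repeat apply Rmult_lt_0_compat; lra). lra. }
intros w Hw.
assert (H1 : (Cmod (w - z) < m / 2)%R) by (eapply Rlt_le_trans; [exact Hw | apply Rmin_l]).
assert (H2 : (Cmod (w - z) <= eps * m * m * m / 2)%R)
  by (left; eapply Rlt_le_trans; [exact Hw | apply Rmin_r]).
assert (H3 : (m / 2 <= Cmod w)%R).
{ assert (m <= Cmod w + Cmod (w - z))%R; [|lra].
  unfold m; replace z with (w - (w - z)) at 1 by ring.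
  eapply Rle_trans; [apply Cmod_triangle | rewrite Cmod_opp; lra]. }
assert (Hw0 : w <> 0) by (apply Cmod_gt_0; lra).
replace (/ w - / z - (w - z) * - (/ z * / z)) with ((w - z) * (w - z) * (/ w * / z * / z))
  by (field; auto).
rewrite !Cmod_mult, !Cmod_inv by auto; fold m.
assert (H4 : (/ Cmod w <= / (m / 2))%R) by (apply Rinv_le_contravar; lra).
assert (Hd := Cmod_ge_0 (w - z)).
assert (Hmi : (0 < / m)%R) by (now apply Rinv_0_lt_compat).
rewrite Rmult_assoc, Rmult_comm.
apply Rmult_le_compat_r; [exact Hd|].
apply Rle_trans with (Cmod (w - z) * (/ (m / 2) * / m * / m))%R.
{ apply Rmult_le_compat_l; [exact Hd|].
  apply Rmult_le_compat_r; [lra|]. apply Rmult_le_compat_r; lra. }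
apply Rle_trans with (eps * m * m * m / 2 * (/ (m / 2) * / m * / m))%R.
{ apply Rmult_le_compat_r; [|exact H2].
  assert (0 < / (m / 2))%R by (apply Rinv_0_lt_compat; lra).
  repeat apply Rmult_le_pos; lra. }
right; field; lra.
Qed.

Lemma is_Cderive_inv (f : C -> C) (z a : C) :
  f z <> 0 -> is_Cderive f z a -> is_Cderive (fun w => / f w) z (- (a * (/ f z * / f z))).
Proof.
intros Hz Hf; eapply is_Cderive_eq.
- apply (is_Cderive_comp Cinv f z); [now apply is_Cderive_inv_id | exact Hf].
- ring.
Qed.

Lemma is_Cderive_scal (f : C -> C) (c z a : C) :
  is_Cderive f z a -> is_Cderive (fun w => c * f w) z (c * a).
Proof.
intros Hf.
refine (is_Cderive_eq _ _ _ _ (is_Cderive_mult (fun _ => c) f z 0 a _ Hf) _).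
- apply is_Cderive_const.
- ring.
Qed.

(** * Sequences and series of complex numbers *)

Definition is_Clim_seq (u : nat -> C) (l : C) : Prop :=
  is_lim_seq (fun n => Cmod (u n - l)) 0%R.

Definition Cseries (a : nat -> C) (l : C) : Prop :=
  is_series (K := C_AbsRing) (V := C_NormedModule) a l.

Definition Csum (a : nat -> C) (n : nat) : C := sum_n (G := C_AbelianMonoid) a n.

Lemma Csum_O (a : nat -> C) : Csum a O = a O.
Proof. exact (sum_O a). Qed.

Lemma Csum_S (a : nat -> C) (n : nat) : Csum a (S n) = Csum a n + a (S n).
Proof. exact (sum_Sn a n). Qed.

Lemma is_Clim_seq_eps (u : nat -> C) (l : C) :
  is_Clim_seq u l <->
  forall eps : R, (0 < eps)%R -> exists N, forall n, (N <= n)%nat -> (Cmod (u n - l) < eps)%R.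
Proof.
unfold is_Clim_seq; rewrite <- is_lim_seq_spec; split.
- intros H eps Heps; destruct (H (mkposreal eps Heps)) as [N HN].
  exists N; intros n Hn; specialize (HN n Hn); simpl in HN.
  rewrite Rminus_0_r, Rabs_pos_eq in HN; auto using Cmod_ge_0.
- intros H [eps Heps]; destruct (H eps Heps) as [N HN].
  exists N; intros n Hn; simpl.
  rewrite Rminus_0_r, Rabs_pos_eq; auto using Cmod_ge_0.
Qed.

Lemma is_Clim_seq_filterlim (u : nat -> C) (l : C) :
  is_Clim_seq u l <-> filterlim u eventually (locally (T := C_UniformSpace) l).
Proof.
rewrite is_Clim_seq_eps.
rewrite (filterlim_locally_ball_norm (K := C_AbsRing) (U := C_NormedModule)).
split.
- intros H [eps Heps]; exact (H eps Heps).
- intros H eps Heps; exact (H (mkposreal eps Heps)).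
Qed.

Lemma Cseries_lim (a : nat -> C) (l : C) : Cseries a l <-> is_Clim_seq (Csum a) l.
Proof. symmetry; apply is_Clim_seq_filterlim. Qed.

Lemma is_Clim_seq_unique (u : nat -> C) (l m : C) : is_Clim_seq u l -> is_Clim_seq u m -> l = m.
Proof.
intros Hl Hm; apply is_Clim_seq_filterlim in Hl; apply is_Clim_seq_filterlim in Hm.
exact (filterlim_locally_unique (V := C_NormedModule) u l m Hl Hm).
Qed.

Lemma is_Clim_seq_ext_loc (u v : nat -> C) (l : C) :
  eventually (fun n => u n = v n) -> is_Clim_seq u l -> is_Clim_seq v l.
Proof.
intros [N H]; apply is_lim_seq_ext_loc; exists N; intros n Hn; now rewrite H.
Qed.

Lemma is_Clim_seq_ext (u v : nat -> C) (l : C) :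
  (forall n, u n = v n) -> is_Clim_seq u l -> is_Clim_seq v l.
Proof. intros H; apply is_lim_seq_ext; intros n; now rewrite H. Qed.

Lemma is_Clim_seq_le (u : nat -> C) (l : C) (b : nat -> R) :
  eventually (fun n => (Cmod (u n - l) <= b n)%R) -> is_lim_seq b 0%R -> is_Clim_seq u l.
Proof.
intros [N H] Hb.
apply is_lim_seq_le_le_loc with (fun _ => 0%R) b; [| apply is_lim_seq_const | exact Hb].
exists N; intros n Hn; split; [apply Cmod_ge_0 | auto].
Qed.

Lemma is_Clim_seq_const (c : C) : is_Clim_seq (fun _ => c) c.
Proof.
apply is_Clim_seq_le with (fun _ => 0%R); [| apply is_lim_seq_const].
exists 0%nat; intros n _. replace (c - c) with (RtoC 0) by ring. rewrite Cmod_0; lra.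
Qed.

Lemma is_Clim_seq_plus (u v : nat -> C) (l m : C) :
  is_Clim_seq u l -> is_Clim_seq v m -> is_Clim_seq (fun n => u n + v n) (l + m).
Proof.
intros Hu Hv.
apply is_Clim_seq_le with (fun n => (Cmod (u n - l) + Cmod (v n - m))%R).
- exists 0%nat; intros n _.
  replace (u n + v n - (l + m)) with ((u n - l) + (v n - m)) by ring; apply Cmod_triangle.
- replace (Finite 0) with (Finite (0 + 0)) by (f_equal; ring); now apply is_lim_seq_plus'.
Qed.

Lemma is_Clim_seq_mult (u v : nat -> C) (l m : C) :
  is_Clim_seq u l -> is_Clim_seq v m -> is_Clim_seq (fun n => u n * v n) (l * m).
Proof.
intros Hu Hv.
apply is_Clim_seq_le with
  (fun n => (Cmod (u n - l) * Cmod (v n - m) + Cmod l * Cmod (v n - m) + Cmod (u n - l) * Cmod m)%R).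
- exists 0%nat; intros n _.
  replace (u n * v n - l * m)
    with ((u n - l) * (v n - m) + l * (v n - m) + (u n - l) * m) by ring.
  rewrite <- !Cmod_mult.
  eapply Rle_trans; [apply Cmod_triangle | apply Rplus_le_compat_r, Cmod_triangle].
- replace (Finite 0) with (Finite (0 * 0 + Cmod l * 0 + 0 * Cmod m)) by (f_equal; ring).
  apply is_lim_seq_plus'; [apply is_lim_seq_plus'|].
  + now apply is_lim_seq_mult'.
  + apply is_lim_seq_mult'; [apply is_lim_seq_const | exact Hv].
  + apply is_lim_seq_mult'; [exact Hu | apply is_lim_seq_const].
Qed.

Lemma is_Clim_seq_opp (u : nat -> C) (l : C) :
  is_Clim_seq u l -> is_Clim_seq (fun n => - u n) (- l).
Proof.
apply is_lim_seq_ext; intros n.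
replace (- u n - - l) with (- (u n - l)) by ring; now rewrite Cmod_opp.
Qed.

Lemma is_Clim_seq_minus (u v : nat -> C) (l m : C) :
  is_Clim_seq u l -> is_Clim_seq v m -> is_Clim_seq (fun n => u n - v n) (l - m).
Proof. intros Hu Hv; apply is_Clim_seq_plus; [| apply is_Clim_seq_opp]; auto. Qed.

Lemma is_Clim_seq_continuous (f : C -> C) (u : nat -> C) (l : C) :
  Ccontinuous f l -> is_Clim_seq u l -> is_Clim_seq (fun n => f (u n)) (f l).
Proof.
intros Hf Hu; apply is_Clim_seq_filterlim in Hu; apply is_Clim_seq_filterlim.
eapply filterlim_comp; [exact Hu | exact Hf].
Qed.

Lemma is_Clim_seq_incr_n (u : nat -> C) (N : nat) (l : C) :
  is_Clim_seq u l <-> is_Clim_seq (fun n => u (n + N)%nat) l.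
Proof. apply (is_lim_seq_incr_n (fun n => Cmod (u n - l))). Qed.

Lemma is_Clim_seq_RtoC (u : nat -> R) (l : R) :
  is_lim_seq u l -> is_Clim_seq (fun n => RtoC (u n)) l.
Proof.
intros H.
apply is_lim_seq_ext with (fun n => Rabs (u n - l)).
- intros n; now rewrite <- RtoC_minus, Cmod_R.
- replace (Finite 0) with (Rbar_abs (Finite (l - l))) by (simpl; f_equal; rewrite Rminus_diag; apply Rabs_R0).
  apply is_lim_seq_abs, is_lim_seq_minus'; [exact H | apply is_lim_seq_const].
Qed.

Lemma C_Lim_seq_unique (u : nat -> C) (l : C) : is_Clim_seq u l -> C_Lim_seq u = l.
Proof.
intros H; unfold C_Lim_seq.
assert (Hc : forall p : C -> R, (forall z, Rabs (p z) <= Cmod z)%R ->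
  (forall z w : C, p (z - w)%C = p z - p w)%R -> Lim_seq (fun n => p (u n)) = p l).
{ intros p Hp1 Hp2; apply is_lim_seq_unique.
  apply is_lim_seq_le_le with (fun n => (p l - Cmod (u n - l))%R) (fun n => (p l + Cmod (u n - l))%R).
  - intros n; specialize (Hp1 (u n - l)); rewrite Hp2 in Hp1.
    apply Rabs_le_between in Hp1; lra.
  - replace (Finite (p l)) with (Finite (p l - 0)) by (f_equal; ring).
    apply is_lim_seq_minus'; [apply is_lim_seq_const | exact H].
  - replace (Finite (p l)) with (Finite (p l + 0)) by (f_equal; ring).
    apply is_lim_seq_plus'; [apply is_lim_seq_const | exact H]. }
rewrite (Hc Re), (Hc Im).
- now destruct l.
- intros z; eapply Rle_trans; [apply Rmax_r | apply Rmax_Cmod].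
- intros z w; reflexivity.
- intros z; eapply Rle_trans; [apply Rmax_l | apply Rmax_Cmod].
- intros z w; reflexivity.
Qed.

Lemma Cmod_Csum_le (a : nat -> C) (b : nat -> R) (n : nat) :
  (forall k, (Cmod (a k) <= b k)%R) -> (Cmod (Csum a n) <= sum_n b n)%R.
Proof.
intros H; induction n as [|n IH].
- rewrite Csum_O, sum_O; apply H.
- rewrite Csum_S, sum_Sn; eapply Rle_trans; [apply Cmod_triangle | apply Rplus_le_compat; auto].
Qed.

Lemma sum_n_le_Series (b : nat -> R) (n : nat) :
  (forall k, (0 <= b k)%R) -> ex_series b -> (sum_n b n <= Series b)%R.
Proof.
intros H Hb.
assert (H1 := Series_correct b Hb).
apply (is_lim_seq_incr_compare (sum_n b) (Series b) H1).
intros k; rewrite sum_Sn; unfold plus; simpl; specialize (H (S k)); lra.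
Qed.

(** Closed balls are closed, which passes uniform bounds on partial sums to the limit. *)
Lemma Cmod_lim_le (u : nat -> C) (l c : C) (b : R) :
  is_Clim_seq u l -> (forall n, (Cmod (u n - c) <= b)%R) -> (Cmod (l - c) <= b)%R.
Proof.
intros Hl H; apply le_epsilon; intros eps Heps.
apply is_Clim_seq_eps with (eps := eps) in Hl; auto; destruct Hl as [N HN].
specialize (HN N (Nat.le_refl N)); specialize (H N).
replace (l - c) with ((u N - c) - (u N - l)) by ring.
eapply Rle_trans; [apply Cmod_triangle | rewrite Cmod_opp; lra].
Qed.

Lemma Cseries_le (a : nat -> C) (b : nat -> R) :
  (forall k, (Cmod (a k) <= b k)%R) -> ex_series b ->
  exists l, Cseries a l /\ (Cmod l <= Series b)%R.
Proof.
intros H Hb.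
destruct (ex_series_le (K := C_AbsRing) (V := C_CompleteNormedModule) a b H Hb) as [l Hl].
exists l; split; [exact Hl|].
apply Cseries_lim in Hl.
replace l with (l - 0) by ring; eapply Cmod_lim_le; [exact Hl|].
intros n; replace (Csum a n - 0) with (Csum a n) by ring.
eapply Rle_trans; [apply Cmod_Csum_le, H | apply sum_n_le_Series; auto].
intros k; eapply Rle_trans; [apply Cmod_ge_0 | apply H].
Qed.

Lemma Cseries_telescope (u : nat -> C) (l : C) :
  Cseries (fun n => u (S n) - u n) l <-> is_Clim_seq u (u O + l).
Proof.
rewrite Cseries_lim, (is_Clim_seq_incr_n u 1).
assert (E : forall n, Csum (fun k => u (S k) - u k) n = u (S n) - u O).
{ induction n as [|n IH]; [now rewrite Csum_O|].
  rewrite Csum_S, IH; ring. }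
unfold is_Clim_seq; split; apply is_lim_seq_ext; intros n; rewrite E;
  rewrite Nat.add_1_r; f_equal; ring.
Qed.

(** The bound on the distance to the limit is what locates the limit point of the bisection
    in Goursat's theorem. *)
Lemma Clim_seq_of_increments (u : nat -> C) (b : nat -> R) :
  (forall n, (Cmod (u (S n) - u n) <= b n)%R) -> ex_series b ->
  exists l, is_Clim_seq u l /\ forall n, (Cmod (l - u n) <= Series (fun k => b (n + k)%nat))%R.
Proof.
intros H Hb.
destruct (Cseries_le _ b H Hb) as [l [Hl _]].
apply Cseries_telescope in Hl; exists (u O + l); split; [exact Hl|].
intros n.
destruct (Cseries_le (fun k => u (n + S k)%nat - u (n + k)%nat) (fun k => b (n + k)%nat))
  as [m [Hm1 Hm2]].
- intros k; rewrite Nat.add_succ_r; apply H.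
- now apply ex_series_incr_n.
- apply (Cseries_telescope (fun k => u (n + k)%nat)) in Hm1.
  rewrite Nat.add_0_r in Hm1.
  apply (is_Clim_seq_incr_n _ n) in Hl.
  replace (u O + l - u n) with m; [exact Hm2|].
  rewrite <- (is_Clim_seq_unique (fun k => u (k + n)%nat) (u n + m) (u O + l)); auto.
  + ring.
  + revert Hm1; apply is_Clim_seq_ext; intros k; now rewrite Nat.add_comm.
Qed.

Lemma Cseries_unique (a : nat -> C) (l m : C) : Cseries a l -> Cseries a m -> l = m.
Proof. rewrite !Cseries_lim; apply is_Clim_seq_unique. Qed.

(** * Paths and their integrals *)

Definition is_Rderive (g : R -> C) (t : R) (l : C) : Prop :=
  is_derive (K := R_AbsRing) (V := C_R_NormedModule) g t l.

Notation Rcontinuous := (continuous (T := R_UniformSpace) (U := C_UniformSpace)).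

Definition is_CInt (g : R -> C) (a b : R) (l : C) : Prop :=
  is_RInt (V := C_R_NormedModule) g a b l.

Definition CInt (g : R -> C) (a b : R) : C := RInt (V := C_R_CompleteNormedModule) g a b.

Lemma norm_C_R (z : C) : norm (V := C_R_NormedModule) z = Cmod z.
Proof.
change (sqrt (Rabs (fst z) ^ 2 + Rabs (snd z) ^ 2) = Cmod z).
unfold Cmod; now rewrite !pow2_abs.
Qed.

Lemma is_Rderive_eps (g : R -> C) (t : R) (l : C) :
  is_Rderive g t l <->
  forall eps : R, (0 < eps)%R -> exists d : R, (0 < d)%R /\
    forall s : R, (Rabs (s - t) < d)%R ->
      (Cmod (g s - g t - (s - t)%R * l) <= eps * Rabs (s - t))%R.
Proof.
split.
- intros [_ H] eps Heps.
  specialize (H t (fun P HP => HP) (mkposreal eps Heps)).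
  destruct H as [d H]; exists d; split; [apply cond_pos|].
  intros s Hs; specialize (H s Hs); rewrite norm_C_R in H.
  rewrite <- scal_R_Cmult; exact H.
- intros H; split; [apply is_linear_scal_l|].
  intros x Hx.
  apply (is_filter_lim_locally_unique (V := AbsRing_NormedModule R_AbsRing)) in Hx; subst x.
  intros [eps Heps]; destruct (H eps Heps) as [d [Hd H']].
  exists (mkposreal d Hd); intros s Hs; rewrite norm_C_R.
  specialize (H' s Hs); rewrite <- scal_R_Cmult in H'; exact H'.
Qed.

Lemma is_Rderive_continuous (g : R -> C) (t : R) (l : C) : is_Rderive g t l -> Rcontinuous g t.
Proof.
intros H; apply (ex_derive_continuous (K := R_AbsRing) (V := C_R_NormedModule) g t); now exists l.
Qed.

Lemma is_Rderive_affine (a b : C) (t : R) : is_Rderive (fun s => a + s * b) t b.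
Proof.
apply is_Rderive_eps; intros eps Heps; exists 1%R; split; [lra|]; intros s _.
replace (a + s * b - (a + t * b) - (s - t)%R * b) with (RtoC 0).
- rewrite Cmod_0; apply Rmult_le_pos; [lra | apply Rabs_pos].
- rewrite RtoC_minus; ring.
Qed.

Lemma is_Rderive_comp (F : C -> C) (g : R -> C) (t : R) (l m : C) :
  is_Cderive F (g t) l -> is_Rderive g t m -> is_Rderive (fun s => F (g s)) t (m * l).
Proof.
intros HF Hg; apply is_Rderive_eps; intros eps Heps.
assert (HF' := proj1 (is_Cderive_eps _ _ _) HF).
assert (Hg' := proj1 (is_Rderive_eps _ _ _) Hg).
assert (Hl := Cmod_ge_0 l); assert (Hm := Cmod_ge_0 m).
set (e1 := (eps / (2 * (Cmod m + 1)))%R).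
assert (He1 : (0 < e1)%R) by (apply Rdiv_lt_0_compat; lra).
set (e2 := (eps / (2 * (Cmod l + 1)))%R).
assert (He2 : (0 < e2)%R) by (apply Rdiv_lt_0_compat; lra).
destruct (HF' e1 He1) as [d1 [Hd1 H1]].
destruct (Hg' 1%R Rlt_0_1) as [d2 [Hd2 H2]].
destruct (Hg' e2 He2) as [d3 [Hd3 H3]].
exists (Rmin (Rmin d2 d3) (d1 / (Cmod m + 1))); split.
{ repeat apply Rmin_pos; auto; apply Rdiv_lt_0_compat; lra. }
intros s Hs.
assert (Hs2 : (Rabs (s - t) < d2)%R)
  by (eapply Rlt_le_trans; [exact Hs|]; eapply Rle_trans; [apply Rmin_l | apply Rmin_l]).
assert (Hs3 : (Rabs (s - t) < d3)%R)
  by (eapply Rlt_le_trans; [exact Hs|]; eapply Rle_trans; [apply Rmin_l | apply Rmin_r]).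
assert (Hs1 : (Rabs (s - t) < d1 / (Cmod m + 1))%R)
  by (eapply Rlt_le_trans; [exact Hs | apply Rmin_r]).
specialize (H2 s Hs2); specialize (H3 s Hs3).
assert (Hb : (Cmod (g s - g t) <= (Cmod m + 1) * Rabs (s - t))%R).
{ replace (g s - g t) with ((g s - g t - (s - t)%R * m) + (s - t)%R * m) by ring.
  eapply Rle_trans; [apply Cmod_triangle|].
  rewrite (Cmod_mult (s - t)%R), Cmod_R; lra. }
assert (Hd : (Cmod (g s - g t) < d1)%R).
{ eapply Rle_lt_trans; [exact Hb|].
  apply Rlt_le_trans with ((Cmod m + 1) * (d1 / (Cmod m + 1)))%R.
  - apply Rmult_lt_compat_l; lra.
  - right; field; lra. }
specialize (H1 (g s) Hd).
replace (F (g s) - F (g t) - (s - t)%R * (m * l))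
  with ((F (g s) - F (g t) - (g s - g t) * l) + (g s - g t - (s - t)%R * m) * l) by ring.
eapply Rle_trans; [apply Cmod_triangle|]; rewrite Cmod_mult.
apply Rle_trans with (e1 * ((Cmod m + 1) * Rabs (s - t)) + (e2 * Rabs (s - t)) * Cmod l)%R.
- apply Rplus_le_compat.
  + eapply Rle_trans; [exact H1 | apply Rmult_le_compat_l; lra].
  + apply Rmult_le_compat_r; auto.
- assert (E1 : (e1 * ((Cmod m + 1) * Rabs (s - t)) = eps / 2 * Rabs (s - t))%R)
    by (unfold e1; field; lra).
  assert (E2 : (e2 * (Cmod l + 1) = eps / 2)%R) by (unfold e2; field; lra).
  rewrite E1.
  assert (Ha := Rabs_pos (s - t)).
  assert (e2 * Rabs (s - t) * Cmod l <= eps / 2 * Rabs (s - t))%R; [|lra].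
  rewrite <- E2.
  replace (e2 * Rabs (s - t) * Cmod l)%R with (e2 * Cmod l * Rabs (s - t))%R by ring.
  apply Rmult_le_compat_r; auto; apply Rmult_le_compat_l; lra.
Qed.

Lemma is_CInt_continuous (g : R -> C) (a b : R) :
  (forall t, Rcontinuous g t) -> is_CInt g a b (CInt g a b).
Proof.
intros H; apply (RInt_correct (V := C_R_CompleteNormedModule)).
apply (ex_RInt_continuous (V := C_R_CompleteNormedModule)); intros z _; apply H.
Qed.

Lemma is_CInt_unique (g : R -> C) (a b : R) (l : C) : is_CInt g a b l -> CInt g a b = l.
Proof. exact (is_RInt_unique (V := C_R_CompleteNormedModule) g a b l). Qed.

Lemma is_CInt_inj (g : R -> C) (a b : R) (l m : C) : is_CInt g a b l -> is_CInt g a b m -> l = m.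
Proof. intros H1 H2; rewrite <- (is_CInt_unique _ _ _ _ H1); now apply is_CInt_unique. Qed.

Lemma is_CInt_ext (f g : R -> C) (a b : R) (l : C) :
  (forall t, f t = g t) -> is_CInt f a b l -> is_CInt g a b l.
Proof. intros H; apply (is_RInt_ext (V := C_R_NormedModule)); auto. Qed.

Lemma is_CInt_minus (f g : R -> C) (a b : R) (l m : C) :
  is_CInt f a b l -> is_CInt g a b m -> is_CInt (fun t => f t - g t) a b (l - m).
Proof. exact (is_RInt_minus (V := C_R_NormedModule) f g a b l m). Qed.

Lemma is_CInt_scal (c : C) (g : R -> C) (a b : R) (l : C) :
  is_CInt g a b l -> is_CInt (fun t => c * g t) a b (c * l).
Proof.
intros H.
assert (H1 := is_RInt_fct_extend_fst (U := R_NormedModule) (V := R_NormedModule) g a b l H).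
assert (H2 := is_RInt_fct_extend_snd (U := R_NormedModule) (V := R_NormedModule) g a b l H).
apply (is_RInt_fct_extend_pair (U := R_NormedModule) (V := R_NormedModule)).
- apply (is_RInt_minus (V := R_NormedModule));
    apply (is_RInt_scal (V := R_NormedModule)); assumption.
- apply (is_RInt_plus (V := R_NormedModule));
    apply (is_RInt_scal (V := R_NormedModule)); assumption.
Qed.

Lemma is_CInt_norm_le (g : R -> C) (a b : R) (l : C) (M : R) :
  (a <= b)%R -> (forall t, (a <= t <= b)%R -> (Cmod (g t) <= M)%R) ->
  is_CInt g a b l -> (Cmod l <= (b - a) * M)%R.
Proof.
intros Hab H Hl; rewrite <- norm_C_R.
apply (norm_RInt_le_const (V := C_R_NormedModule) g a b l M Hab); auto.
intros t Ht; rewrite norm_C_R; auto.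
Qed.

Lemma is_CInt_derive (F f : C -> C) (g dg : R -> C) (a b : R) :
  (forall t, is_Cderive F (g t) (f (g t))) -> (forall t, is_Rderive g t (dg t)) ->
  (forall t, Rcontinuous (fun t => dg t * f (g t)) t) ->
  is_CInt (fun t => dg t * f (g t)) a b (F (g b) - F (g a)).
Proof.
intros HF Hg Hc.
apply (is_RInt_derive (V := C_R_CompleteNormedModule) (fun t => F (g t))).
- intros t _; now apply is_Rderive_comp.
- intros t _; apply Hc.
Qed.

(** * Integrals along segments and triangles *)

Lemma continuous_Cmult {T : UniformSpace} (f g : T -> C) (t : T) :
  continuous (U := C_UniformSpace) f t -> continuous (U := C_UniformSpace) g t ->
  continuous (U := C_UniformSpace) (fun s => f s * g s) t.
Proof.
intros Hf Hg.
assert (E : forall h : T -> C, continuous (U := C_UniformSpace) h t <->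
  continuous (U := AbsRing_UniformSpace C_AbsRing) h t).
{ intros h; split; intros H P HP; apply H; [now apply (proj2 (locally_C _ _)) | now apply (proj1 (locally_C _ _))]. }
apply E; apply E in Hf; apply E in Hg.
exact (continuous_mult (K := C_AbsRing) f g t Hf Hg).
Qed.

Lemma continuous_const_C {T : UniformSpace} (c : C) (t : T) :
  continuous (U := C_UniformSpace) (fun _ => c) t.
Proof. apply continuous_const. Qed.

Definition seg (f : C -> C) (a b : C) : C :=
  CInt (fun t => (b - a) * f (a + t * (b - a))) 0 1.

Lemma Rcontinuous_seg (f : C -> C) (a b : C) (t : R) :
  (forall z, Ccontinuous f z) -> Rcontinuous (fun t => (b - a) * f (a + t * (b - a))) t.
Proof.
intros Hf; apply (continuous_Cmult (T := R_UniformSpace)); [apply continuous_const_C|].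
apply (continuous_comp (U := R_UniformSpace) (V := C_UniformSpace) (W := C_UniformSpace)).
- apply (is_Rderive_continuous _ _ (b - a)), is_Rderive_affine.
- apply Hf.
Qed.

Lemma is_CInt_seg (f : C -> C) (a b : C) :
  (forall z, Ccontinuous f z) ->
  is_CInt (fun t => (b - a) * f (a + t * (b - a))) 0 1 (seg f a b).
Proof. intros Hf; apply is_CInt_continuous; intros t; now apply Rcontinuous_seg. Qed.

(** Reversal and bisection of segments are both affine changes of parameter. *)
Lemma seg_reparam (f : C -> C) (a b : C) (s t : R) :
  (forall z, Ccontinuous f z) ->
  seg f (a + s * (b - a)) (a + t * (b - a)) =
  CInt (fun t => (b - a) * f (a + t * (b - a))) s t.
Proof.
intros Hf; apply is_CInt_unique.
apply is_CInt_ext with (fun y : R => (t - s)%R * ((b - a) * f (a + ((t - s) * y + s)%R * (b - a)))).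
- intros y; rewrite RtoC_plus, RtoC_mult, !RtoC_minus.
  replace (a + t * (b - a) - (a + s * (b - a))) with ((t - s) * (b - a)) by ring.
  replace (a + ((t - s) * y + s) * (b - a))
    with (a + s * (b - a) + y * ((t - s) * (b - a))) by ring.
  ring.
- apply is_RInt_ext with
    (fun y => scal (V := C_R_ModuleSpace) (t - s)%R
       ((fun t => (b - a) * f (a + t * (b - a))) ((t - s) * y + s)%R)).
  { intros y _; now rewrite scal_R_Cmult. }
  apply (is_RInt_comp_lin (V := C_R_NormedModule)
    (fun t => (b - a) * f (a + t * (b - a))) (t - s) s 0 1).
  replace ((t - s) * 0 + s)%R with s by ring.
  replace ((t - s) * 1 + s)%R with t by ring.
  apply is_CInt_continuous; intros u; now apply Rcontinuous_seg.
Qed.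

Lemma seg_swap (f : C -> C) (a b : C) : (forall z, Ccontinuous f z) -> seg f b a = - seg f a b.
Proof.
intros Hf.
replace (seg f b a) with (seg f (a + 1%R * (b - a)) (a + 0%R * (b - a))) by (f_equal; ring).
rewrite seg_reparam by exact Hf; apply is_CInt_unique.
apply (is_RInt_swap (V := C_R_NormedModule)); now apply is_CInt_seg.
Qed.

Definition midpoint (a b : C) : C := (a + b) / 2.

Lemma C2_neq_0 : RtoC 2 <> 0.
Proof. intros H; apply RtoC_inj in H; lra. Qed.

Lemma seg_midpoint (f : C -> C) (a b : C) :
  (forall z, Ccontinuous f z) -> seg f a b = seg f a (midpoint a b) + seg f (midpoint a b) b.
Proof.
intros Hf.
assert (E2 : RtoC (/ 2) = / 2) by (apply RtoC_inv; lra).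
replace (seg f a (midpoint a b)) with (seg f (a + 0%R * (b - a)) (a + (/ 2)%R * (b - a))).
2:{ f_equal; [ring|]. unfold midpoint; rewrite E2; field; apply C2_neq_0. }
replace (seg f (midpoint a b) b) with (seg f (a + (/ 2)%R * (b - a)) (a + 1%R * (b - a))).
2:{ f_equal; [|ring]. unfold midpoint; rewrite E2; field; apply C2_neq_0. }
rewrite !seg_reparam by exact Hf.
symmetry; apply (RInt_Chasles (V := C_R_CompleteNormedModule));
  eexists; apply is_CInt_continuous; intros t; now apply Rcontinuous_seg.
Qed.

Lemma seg_norm_le (f : C -> C) (a b : C) (M : R) :
  (forall z, Ccontinuous f z) ->
  (forall t, (0 <= t <= 1)%R -> (Cmod (f (a + t * (b - a))%C) <= M)%R) ->
  (Cmod (seg f a b) <= Cmod (b - a) * M)%R.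
Proof.
intros Hf H.
replace (Cmod (b - a) * M)%R with ((1 - 0) * (Cmod (b - a) * M))%R by ring.
apply (is_CInt_norm_le (fun t => (b - a) * f (a + t * (b - a)))); [lra | | now apply is_CInt_seg].
intros t Ht; rewrite Cmod_mult; apply Rmult_le_compat_l; [apply Cmod_ge_0 | auto].
Qed.

Lemma seg_derive (F f : C -> C) (a b : C) :
  (forall z, is_Cderive F z (f z)) -> (forall z, Ccontinuous f z) -> seg f a b = F b - F a.
Proof.
intros HF Hf; apply is_CInt_unique.
replace (F b - F a) with (F (a + 1%R * (b - a)) - F (a + 0%R * (b - a))) by (f_equal; [|f_equal]; f_equal; ring).
apply (is_CInt_derive F f (fun t => a + t * (b - a)) (fun _ => b - a)); auto.
- intros t; apply is_Rderive_affine.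
- intros t; now apply Rcontinuous_seg.
Qed.

Lemma seg_minus (f g : C -> C) (a b : C) :
  (forall z, Ccontinuous f z) -> (forall z, Ccontinuous g z) ->
  seg (fun z => f z - g z) a b = seg f a b - seg g a b.
Proof.
intros Hf Hg; apply is_CInt_unique.
apply is_CInt_ext with (fun t : R => (b - a) * f (a + t * (b - a)) - (b - a) * g (a + t * (b - a))).
- intros t; ring.
- apply is_CInt_minus; now apply is_CInt_seg.
Qed.

Definition triangle_int (f : C -> C) (a b c : C) : C := seg f a b + seg f b c + seg f c a.

(** The sides of the middle triangle are run through in both directions and cancel. *)
Lemma triangle_split (f : C -> C) (a b c : C) : (forall z, Ccontinuous f z) ->
  let m1 := midpoint a b in let m2 := midpoint b c in let m3 := midpoint c a in
  triangle_int f a b c =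
  triangle_int f a m1 m3 + triangle_int f m1 b m2 + triangle_int f m3 m2 c + triangle_int f m1 m2 m3.
Proof.
intros Hf m1 m2 m3; unfold triangle_int.
rewrite (seg_midpoint f a b), (seg_midpoint f b c), (seg_midpoint f c a) by exact Hf.
fold m1 m2 m3.
rewrite (seg_swap f m1 m3), (seg_swap f m2 m1), (seg_swap f m3 m2) by exact Hf.
ring.
Qed.

(** Affine functions have explicit primitives. *)
Lemma triangle_affine (p u l a b c : C) : triangle_int (fun z => u + (z - p) * l) a b c = 0.
Proof.
assert (Hd : forall z, is_Cderive (fun z => u * z + (z - p) * (z - p) * (l / 2)) z
  (u + (z - p) * l)).
{ intros z.
  assert (H1 : is_Cderive (fun w => w - p) z (1 - 0))
    by (apply is_Cderive_minus; [apply is_Cderive_id | apply is_Cderive_const]).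
  eapply is_Cderive_eq.
  - apply is_Cderive_plus.
    + apply is_Cderive_scal, is_Cderive_id.
    + apply (is_Cderive_mult (fun z => (z - p) * (z - p)) (fun _ => l / 2)).
      * apply is_Cderive_mult; exact H1.
      * apply is_Cderive_const.
  - simpl; field; apply C2_neq_0. }
assert (Hc : forall z, Ccontinuous (fun z => u + (z - p) * l) z).
{ intros z; apply (is_Cderive_continuous _ z l), is_Cderive_eps; intros eps Heps.
  exists 1%R; split; [lra|]; intros w _.
  replace (u + (w - p) * l - (u + (z - p) * l) - (w - z) * l) with (RtoC 0) by ring.
  rewrite Cmod_0; apply Rmult_le_pos; [lra | apply Cmod_ge_0]. }
unfold triangle_int; rewrite !(seg_derive _ _ _ _ Hd Hc); ring.
Qed.

Definition perimeter (a b c : C) : R := (Cmod (b - a) + Cmod (c - b) + Cmod (a - c))%R.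

Lemma Cmod_half (z : C) : Cmod (z / 2) = (Cmod z / 2)%R.
Proof.
rewrite Cmod_div by apply C2_neq_0; rewrite Cmod_R, Rabs_pos_eq; lra.
Qed.

Lemma Cmod_minus_sym (a b : C) : Cmod (a - b) = Cmod (b - a).
Proof. rewrite <- Cmod_opp; f_equal; ring. Qed.

Lemma Cmod_minus_triangle (a b c : C) : (Cmod (a - c) <= Cmod (a - b) + Cmod (b - c))%R.
Proof. replace (a - c) with ((a - b) + (b - c)) by ring; apply Cmod_triangle. Qed.

(** By [triangle_split] the four quarters cannot all contribute less than a fourth. *)
Lemma triangle_quarter (f : C -> C) (a b c : C) : (forall z, Ccontinuous f z) ->
  exists a' b' c', (Cmod (triangle_int f a b c) <= 4 * Cmod (triangle_int f a' b' c'))%R /\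
    (perimeter a' b' c' = perimeter a b c / 2)%R /\ (Cmod (a' - a) <= perimeter a b c)%R.
Proof.
intros Hf.
assert (E := triangle_split f a b c Hf); cbv zeta in E.
set (m1 := midpoint a b) in *; set (m2 := midpoint b c) in *; set (m3 := midpoint c a) in *.
assert (Hm : forall u v w : C, u - v = w / 2 -> Cmod (u - v) = (Cmod w / 2)%R)
  by (intros u v w ->; apply Cmod_half).
assert (H2 := C2_neq_0).
assert (Ha := Cmod_ge_0 (b - a)); assert (Hb := Cmod_ge_0 (c - b)); assert (Hc := Cmod_ge_0 (a - c)).
assert (P1 : perimeter a m1 m3 = (perimeter a b c / 2)%R).
{ unfold perimeter.
  rewrite (Hm m1 a (b - a)), (Hm m3 m1 (c - b)), (Hm a m3 (a - c));
    [field | | |]; unfold m1, m2, m3, midpoint; field; auto. }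
assert (P2 : perimeter m1 b m2 = (perimeter a b c / 2)%R).
{ unfold perimeter.
  rewrite (Hm b m1 (b - a)), (Hm m2 b (c - b)), (Hm m1 m2 (a - c));
    [field | | |]; unfold m1, m2, m3, midpoint; field; auto. }
assert (P3 : perimeter m3 m2 c = (perimeter a b c / 2)%R).
{ unfold perimeter.
  rewrite (Hm m2 m3 (b - a)), (Hm c m2 (c - b)), (Hm m3 c (a - c));
    [field | | |]; unfold m1, m2, m3, midpoint; field; auto. }
assert (P4 : perimeter m1 m2 m3 = (perimeter a b c / 2)%R).
{ unfold perimeter.
  rewrite (Cmod_minus_sym m2 m1), (Cmod_minus_sym m3 m2), (Cmod_minus_sym m1 m3).
  rewrite (Hm m1 m2 (a - c)), (Hm m2 m3 (b - a)), (Hm m3 m1 (c - b));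
    [field | | |]; unfold m1, m2, m3, midpoint; field; auto. }
assert (D1 : (Cmod (m1 - a) <= perimeter a b c)%R).
{ rewrite (Hm m1 a (b - a)) by (unfold m1, midpoint; field; auto). unfold perimeter; lra. }
assert (D3 : (Cmod (m3 - a) <= perimeter a b c)%R).
{ rewrite Cmod_minus_sym, (Hm a m3 (a - c)) by (unfold m3, midpoint; field; auto). unfold perimeter; lra. }
assert (T : (Cmod (triangle_int f a b c) <= Cmod (triangle_int f a m1 m3) + Cmod (triangle_int f m1 b m2)
  + Cmod (triangle_int f m3 m2 c) + Cmod (triangle_int f m1 m2 m3))%R).
{ rewrite E.
  eapply Rle_trans; [apply Cmod_triangle | apply Rplus_le_compat_r].
  eapply Rle_trans; [apply Cmod_triangle | apply Rplus_le_compat_r, Cmod_triangle]. }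
destruct (Rle_dec (Cmod (triangle_int f a b c)) (4 * Cmod (triangle_int f a m1 m3))) as [Q1|Q1].
{ exists a, m1, m3; repeat split; auto.
  replace (a - a) with (RtoC 0) by ring; rewrite Cmod_0; unfold perimeter; lra. }
destruct (Rle_dec (Cmod (triangle_int f a b c)) (4 * Cmod (triangle_int f m1 b m2))) as [Q2|Q2].
{ exists m1, b, m2; repeat split; auto. }
destruct (Rle_dec (Cmod (triangle_int f a b c)) (4 * Cmod (triangle_int f m3 m2 c))) as [Q3|Q3].
{ exists m3, m2, c; repeat split; auto. }
exists m1, m2, m3; repeat split; auto; lra.
Qed.

(** * Goursat's theorem and primitives *)

Lemma ex_series_geom_half (K : R) : ex_series (fun n => K * (/ 2) ^ n)%R.
Proof.
apply (ex_series_scal (V := R_NormedModule) K (fun n => (/ 2) ^ n)%R), ex_series_geom.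
rewrite Rabs_pos_eq; lra.
Qed.

Lemma Series_geom_half_tail (K : R) (n : nat) :
  Series (fun k => K * (/ 2) ^ (n + k))%R = (2 * K * (/ 2) ^ n)%R.
Proof.
rewrite (Series_ext _ (fun k => (K * (/ 2) ^ n) * (/ 2) ^ k)%R).
- rewrite Series_scal_l, Series_geom; [field | rewrite Rabs_pos_eq; lra].
- intros k; rewrite pow_add; ring.
Qed.

Lemma point_on_segment_dist (a b : C) (t : R) :
  (0 <= t <= 1)%R -> (Cmod (a + t * (b - a) - a) <= Cmod (b - a))%R.
Proof.
intros Ht; replace (a + t * (b - a) - a) with (t * (b - a)) by ring.
rewrite Cmod_mult, Cmod_R, Rabs_pos_eq by lra.
rewrite <- (Rmult_1_l (Cmod (b - a))) at 2; apply Rmult_le_compat_r; [apply Cmod_ge_0 | lra].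
Qed.

Lemma triangle_norm_le (f : C -> C) (a b c : C) (M : R) :
  (forall z, Ccontinuous f z) ->
  (forall w : C, (Cmod (w - a) <= perimeter a b c)%R -> (Cmod (f w) <= M)%R) ->
  (Cmod (triangle_int f a b c) <= perimeter a b c * M)%R.
Proof.
intros Hf H.
assert (Ha := Cmod_ge_0 (b - a)); assert (Hb := Cmod_ge_0 (c - b)); assert (Hc := Cmod_ge_0 (a - c)).
unfold triangle_int, perimeter; rewrite !Rmult_plus_distr_r.
eapply Rle_trans; [apply Cmod_triangle | apply Rplus_le_compat;
  [eapply Rle_trans; [apply Cmod_triangle | apply Rplus_le_compat]|]];
  apply seg_norm_le; auto; intros t Ht; apply H; unfold perimeter.
- eapply Rle_trans; [now apply point_on_segment_dist | lra].
- eapply Rle_trans; [apply (Cmod_minus_triangle _ b)|].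
  assert (H1 := point_on_segment_dist b c t Ht); lra.
- replace (c + t * (a - c) - a) with ((1 - t)%R * (c - a)) by (rewrite RtoC_minus; ring).
  rewrite Cmod_mult, Cmod_R, Rabs_pos_eq, (Cmod_minus_sym c a) by lra.
  apply Rle_trans with (1 * Cmod (a - c))%R; [apply Rmult_le_compat_r | ]; lra.
Qed.

(** Bisection yields nested triangles, of perimeter [p0 / 2^n], keeping at least the fraction
    [1 / 4^n] of the integral. They shrink to a point where the function is affine up to
    [o(w - p)], and affine functions integrate to 0, so that the [n]-th integral is
    [o(p0 / 2^n) * p0 / 2^n]. *)
Theorem Goursat (f : C -> C) (a b c : C) : entire f -> triangle_int f a b c = 0.
Proof.
intros Hf.
assert (Hc : forall z, Ccontinuous f z)
  by (intros z; destruct (Hf z) as [l Hl]; exact (is_Cderive_continuous f z l Hl)).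
assert (Hstep : forall t : C * C * C, exists t' : C * C * C,
  let '(a, b, c) := t in let '(a', b', c') := t' in
  (Cmod (triangle_int f a b c) <= 4 * Cmod (triangle_int f a' b' c'))%R /\
  (perimeter a' b' c' = perimeter a b c / 2)%R /\ (Cmod (a' - a) <= perimeter a b c)%R).
{ intros [[a0 b0] c0]; destruct (triangle_quarter f a0 b0 c0 Hc) as [a' [b' [c' H]]].
  now exists (a', b', c'). }
apply choice in Hstep; destruct Hstep as [next Hnext].
set (tr := fix tr n := match n with O => (a, b, c) | S m => next (tr m) end).
set (va := fun n => fst (fst (tr n))); set (vb := fun n => snd (fst (tr n)));
  set (vc := fun n => snd (tr n)).
set (p0 := perimeter a b c).
assert (Hn : forall n,
  (Cmod (triangle_int f (va n) (vb n) (vc n)) <= 4 * Cmod (triangle_int f (va (S n)) (vb (S n)) (vc (S n))))%R /\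
  (perimeter (va (S n)) (vb (S n)) (vc (S n)) = perimeter (va n) (vb n) (vc n) / 2)%R /\
  (Cmod (va (S n) - va n) <= perimeter (va n) (vb n) (vc n))%R).
{ intros n; specialize (Hnext (tr n)); unfold va, vb, vc; simpl.
  destruct (tr n) as [[a1 b1] c1]; destruct (next (a1, b1, c1)) as [[a2 b2] c2]; exact Hnext. }
assert (Hper : forall n, perimeter (va n) (vb n) (vc n) = (p0 * (/ 2) ^ n)%R).
{ induction n as [|n IH]; [unfold p0, va, vb, vc; simpl; ring|].
  rewrite (proj1 (proj2 (Hn n))), IH; simpl; field. }
assert (Hint : forall n, (Cmod (triangle_int f a b c) <= 4 ^ n * Cmod (triangle_int f (va n) (vb n) (vc n)))%R).
{ induction n as [|n IH]; [simpl; unfold va, vb, vc; simpl; lra|].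
  eapply Rle_trans; [exact IH|].
  simpl; rewrite (Rmult_comm 4), Rmult_assoc; apply Rmult_le_compat_l; [apply pow_le; lra|].
  apply Hn. }
destruct (Clim_seq_of_increments va (fun n => p0 * (/ 2) ^ n)%R) as [p [_ Hp]].
{ intros n; rewrite <- Hper; apply Hn. }
{ apply ex_series_geom_half. }
assert (Hp0 : (0 <= p0)%R).
{ unfold p0, perimeter; repeat apply Rplus_le_le_0_compat; apply Cmod_ge_0. }
destruct (Hf p) as [l Hl].
assert (Hl' := proj1 (is_Cderive_eps f p l) Hl).
apply Cmod_eq_0, Rle_antisym; [|apply Cmod_ge_0].
apply le_epsilon; intros eps Heps; rewrite Rplus_0_l.
(* The remainder of the first order expansion at [p] is at most [e * 3 p0 / 2^n] on the
   [n]-th triangle, whose perimeter is [p0 / 2^n]. *)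
set (e := (eps / (3 * p0 * p0 + 1))%R).
assert (Hq : (0 <= p0 * p0)%R) by (apply Rmult_le_pos; auto).
assert (He : (0 < e)%R) by (apply Rdiv_lt_0_compat; lra).
destruct (Hl' e He) as [d [Hd Hr]].
assert (Hsmall : exists n, (3 * p0 * (/ 2) ^ n < d)%R).
{ destruct (pow_lt_1_zero (/ 2) ltac:(rewrite Rabs_pos_eq; lra) (d / (3 * p0 + 1))
    ltac:(apply Rdiv_lt_0_compat; lra)) as [N HN].
  exists N; specialize (HN N (Nat.le_refl N)).
  assert (Hpw : (0 < (/ 2) ^ N)%R) by (apply pow_lt; lra).
  rewrite Rabs_pos_eq in HN by lra.
  apply Rle_lt_trans with ((3 * p0 + 1) * (/ 2) ^ N)%R.
  - apply Rmult_le_compat_r; lra.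
  - apply Rlt_le_trans with ((3 * p0 + 1) * (d / (3 * p0 + 1)))%R.
    + apply Rmult_lt_compat_l; lra.
    + right; field; lra. }
destruct Hsmall as [n Hsm].
set (q := (p0 * (/ 2) ^ n)%R).
assert (Hq0 : (0 <= q)%R) by (apply Rmult_le_pos; [auto | apply pow_le; lra]).
set (rem := fun w => f w - (f p + (w - p) * l)).
assert (Hca : forall z, Ccontinuous (fun w => f p + (w - p) * l) z).
{ intros z; apply (is_Cderive_continuous _ z l), is_Cderive_eps; intros eps' Heps'.
  exists 1%R; split; [lra|]; intros w _.
  replace (f p + (w - p) * l - (f p + (z - p) * l) - (w - z) * l) with (RtoC 0) by ring.
  rewrite Cmod_0; apply Rmult_le_pos; [lra | apply Cmod_ge_0]. }
assert (Hcr : forall z, Ccontinuous rem z)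
  by (intros z; apply (continuous_minus (K := C_AbsRing) (V := C_NormedModule)); auto).
assert (Etr : triangle_int f (va n) (vb n) (vc n) = triangle_int rem (va n) (vb n) (vc n)).
{ assert (H0 := triangle_affine p (f p) l (va n) (vb n) (vc n)).
  replace (triangle_int rem (va n) (vb n) (vc n))
    with (triangle_int f (va n) (vb n) (vc n) - triangle_int (fun w => f p + (w - p) * l) (va n) (vb n) (vc n)).
  - rewrite H0; ring.
  - unfold triangle_int, rem; rewrite !seg_minus by auto; ring. }
assert (Hb : (Cmod (triangle_int f (va n) (vb n) (vc n)) <= q * (e * (3 * q)))%R).
{ rewrite Etr; unfold q at 1; rewrite <- Hper; apply triangle_norm_le; auto.
  intros w Hw; rewrite Hper in Hw; fold q in Hw.
  assert (Hwp : (Cmod (w - p) <= 3 * q)%R).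
  { eapply Rle_trans; [apply (Cmod_minus_triangle w (va n) p)|].
    specialize (Hp n); rewrite Series_geom_half_tail, Cmod_minus_sym in Hp.
    unfold q in *; lra. }
  unfold rem; replace (f w - (f p + (w - p) * l)) with (f w - f p - (w - p) * l) by ring.
  eapply Rle_trans; [apply Hr; unfold q in Hwp; lra|].
  apply Rmult_le_compat_l; lra. }
eapply Rle_trans; [apply (Hint n)|].
apply Rle_trans with (4 ^ n * (q * (e * (3 * q))))%R.
{ apply Rmult_le_compat_l; [apply pow_le; lra | exact Hb]. }
replace (4 ^ n * (q * (e * (3 * q))))%R with (e * (3 * p0 * p0) * (4 * (/ 2 * / 2)) ^ n)%R
  by (unfold q; rewrite !Rpow_mult_distr; ring).
replace (4 * (/ 2 * / 2))%R with 1%R by field; rewrite pow1, Rmult_1_r.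
apply Rle_trans with (e * (3 * p0 * p0 + 1))%R; [apply Rmult_le_compat_l; lra|].
right; unfold e; field; lra.
Qed.

(** The integral from the origin: by Goursat its increments are integrals over short
    segments. *)
Theorem entire_primitive (f : C -> C) : entire f -> exists F, forall z, is_Cderive F z (f z).
Proof.
intros Hf.
assert (Hc : forall z, Ccontinuous f z)
  by (intros z; destruct (Hf z) as [l Hl]; exact (is_Cderive_continuous f z l Hl)).
exists (seg f 0); intros z; apply is_Cderive_eps; intros eps Heps.
destruct (proj1 (Ccontinuous_eps f z) (Hc z) eps Heps) as [d [Hd H]].
exists d; split; auto; intros w Hw.
assert (E : seg f 0 w - seg f 0 z - (w - z) * f z = seg (fun u => f u - f z) z w).
{ rewrite seg_minus by (auto; intros u; apply continuous_const_C).
  assert (HG := Goursat f 0 z w Hf); unfold triangle_int in HG; rewrite (seg_swap f 0 w) in HG by auto.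
  replace (seg f 0 w) with (seg f 0 z + seg f z w) by
    (apply Ceq_minus; transitivity (seg f 0 z + seg f z w + - seg f 0 w); [ring | exact HG]).
  replace (seg (fun _ => f z) z w) with ((w - z) * f z); [ring|].
  assert (Hd' : forall u, is_Cderive (fun v => f z * v) u (f z)).
  { intros u; eapply is_Cderive_eq; [apply is_Cderive_scal, is_Cderive_id | ring]. }
  rewrite (seg_derive _ (fun _ => f z) z w Hd'); [ring | intros u; apply continuous_const_C]. }
rewrite E, Rmult_comm; apply seg_norm_le.
- intros u; apply (continuous_minus (K := C_AbsRing) (V := C_NormedModule)); auto.
  apply continuous_const_C.
- intros t Ht; left; apply H.
  eapply Rle_lt_trans; [now apply point_on_segment_dist | exact Hw].
Qed.

(** * The complex exponential *)

Lemma Cmod_le_Re_Im (z : C) : (Cmod z <= Rabs (Re z) + Rabs (Im z))%R.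
Proof.
replace z with (RtoC (Re z) + Ci * RtoC (Im z)) at 1.
- eapply Rle_trans; [apply Cmod_triangle|].
  rewrite Cmod_mult, Cmod_Ci, !Cmod_R; lra.
- destruct z as [x y]; unfold Ci, RtoC, Cplus, Cmult; simpl; f_equal; ring.
Qed.

Lemma Re_minus (a b : C) : Re (a - b) = (Re a - Re b)%R.
Proof. unfold Re; simpl; ring. Qed.

Lemma Re_gt_of_near (w z : C) : (Re z - Cmod (w - z) <= Re w)%R.
Proof.
assert (H := re_le_Cmod (w - z)); rewrite Re_minus in H; apply Rabs_le_between in H; lra.
Qed.

Lemma Im_le_Cmod (z : C) : (Rabs (Im z) <= Cmod z)%R.
Proof. eapply Rle_trans; [apply Rmax_r | apply Rmax_Cmod]. Qed.

Lemma Cexp_plus (z w : C) : Cexp (z + w) = Cexp z * Cexp w.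
Proof.
unfold Cexp; destruct z as [x y], w as [u v]; unfold Re, Im; simpl.
rewrite exp_plus, cos_plus, sin_plus; unfold RtoC, Cmult; simpl; f_equal; ring.
Qed.

Lemma Cexp_0 : Cexp 0 = 1.
Proof. unfold Cexp; simpl; rewrite exp_0, cos_0, sin_0; unfold RtoC, Cmult; simpl; f_equal; ring. Qed.

Lemma Cmod_Cexp (z : C) : Cmod (Cexp z) = exp (Re z).
Proof.
unfold Cexp; rewrite Cmod_mult, Cmod_R, Rabs_pos_eq by (left; apply exp_pos).
replace (Cmod (cos (Im z), sin (Im z))) with 1%R; [ring|].
symmetry; transitivity (sqrt 1); [unfold Cmod; simpl; f_equal | apply sqrt_1].
generalize (sin2_cos2 (Im z)); unfold Rsqr; lra.
Qed.

Lemma Cexp_neq_0 (z : C) : Cexp z <> 0.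
Proof. apply Cmod_gt_0; rewrite Cmod_Cexp; apply exp_pos. Qed.

Lemma Cexp_opp (z : C) : Cexp (- z) = / Cexp z.
Proof.
assert (H : Cexp z * Cexp (- z) = 1)
  by (rewrite <- Cexp_plus; replace (z + - z) with (RtoC 0) by ring; apply Cexp_0).
replace (Cexp (- z)) with (/ Cexp z * (Cexp z * Cexp (- z))) by (field; apply Cexp_neq_0).
rewrite H; ring.
Qed.

Lemma exp_second_order (x : R) : (Rabs x <= / 2)%R -> (Rabs (exp x - 1 - x) <= 2 * (x * x))%R.
Proof.
intros Hx; apply Rabs_le_between in Hx.
assert (H1 := exp_ineq1_le x); assert (H2 := exp_ineq1_le (- x)).
rewrite Rabs_pos_eq by lra.
assert (Hp := exp_pos x).
rewrite exp_Ropp in H2.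
assert (H3 : ((1 - x) * exp x <= 1)%R).
{ replace 1%R with (/ exp x * exp x)%R at 2 by (field; lra).
  apply Rmult_le_compat_r; lra. }
assert (0 <= x * x)%R by apply Rle_0_sqr.
assert (E : ((1 - x) * (exp x - 1 - x - 2 * (x * x)) <= 0)%R).
{ replace ((1 - x) * (exp x - 1 - x - 2 * (x * x)))%R
    with ((1 - x) * exp x - 1 - (x * x) * (1 - 2 * x))%R by ring.
  assert (0 <= (x * x) * (1 - 2 * x))%R by (apply Rmult_le_pos; lra). lra. }
apply Rnot_lt_le; intros Hlt.
assert (0 < (1 - x) * (exp x - 1 - x - 2 * (x * x)))%R by (apply Rmult_lt_0_compat; lra).
lra.
Qed.

Lemma sin_second_order (y : R) : (Rabs y <= 1)%R -> (Rabs (sin y - y) <= y * y)%R.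
Proof.
assert (Hpos : forall y, (0 <= y <= 1)%R -> (Rabs (sin y - y) <= y * y)%R).
{ clear y; intros y Hy.
  destruct (pre_sin_bound y 0) as [H1 H2]; try lra.
  unfold sin_approx, sin_term in H1, H2; simpl in H1, H2.
  assert (Hs : (0 <= y * y <= 1)%R) by (split; nra).
  assert (Hc : (0 <= y * (y * y) <= y * y)%R) by (split; nra).
  assert (Hq : (0 <= (y * (y * y)) * (y * y) <= y * (y * y))%R) by (split; nra).
  apply Rabs_le; split; nra. }
intros Hy; destruct (Rle_dec 0 y) as [H|H].
- apply Hpos; rewrite Rabs_pos_eq in Hy; lra.
- replace (sin y - y)%R with (- (sin (- y) - (- y)))%R by (rewrite sin_neg; ring).
  rewrite Rabs_Ropp; replace (y * y)%R with (- y * - y)%R by ring.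
  rewrite Rabs_left in Hy by lra; apply Hpos; lra.
Qed.

Lemma cos_second_order (y : R) : (Rabs y <= 1)%R -> (Rabs (cos y - 1) <= y * y / 2)%R.
Proof.
intros Hy; apply Rabs_le_between in Hy.
destruct (pre_cos_bound y 0) as [H1 _]; try lra.
unfold cos_approx, cos_term in H1; simpl in H1.
apply Rabs_le; split; [lra | generalize (COS_bound y)].
assert (0 <= y * y)%R by apply Rle_0_sqr; lra.
Qed.

(** A quadratic remainder gives the derivative of the exponential, and also the convergence
    of the Gamma product, whose factors are [1 + O(1 / n^2)]. *)
Lemma Cexp_second_order (h : C) :
  (Cmod h <= / 2)%R -> (Cmod (Cexp h - 1 - h) <= 6 * (Cmod h * Cmod h))%R.
Proof.
intros Hh.
assert (Hx := Rle_trans _ _ _ (re_le_Cmod h) Hh); assert (Hy := Rle_trans _ _ _ (Im_le_Cmod h) Hh).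
assert (Hm : (Cmod h * Cmod h = Re h * Re h + Im h * Im h)%R).
{ generalize (Cmod2_alt h); simpl; lra. }
rewrite Hm; destruct h as [x y]; unfold Re, Im in *; simpl in *.
assert (Bx := exp_second_order x Hx).
assert (By := sin_second_order y ltac:(lra)); assert (Bc := cos_second_order y ltac:(lra)).
eapply Rle_trans; [apply Cmod_le_Re_Im|]; unfold Cexp, Re, Im; simpl.
assert (Hxx : (0 <= x * x)%R) by apply Rle_0_sqr; assert (Hyy : (0 <= y * y)%R) by apply Rle_0_sqr.
assert (R1 : (Rabs (exp x * cos y - 0 * sin y + - (1) + - x) <= 2 * (x * x) + y * y)%R).
{ replace (exp x * cos y - 0 * sin y + - (1) + - x)%R
    with ((exp x - 1 - x) * cos y + (1 + x) * (cos y - 1))%R by ring.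
  eapply Rle_trans; [apply Rabs_triang|]; rewrite !Rabs_mult.
  assert (Rabs (cos y) <= 1)%R by (apply Rabs_le; generalize (COS_bound y); lra).
  assert (Rabs (1 + x) <= 2)%R by (apply Rabs_le_between in Hx; apply Rabs_le; lra).
  assert (Hp1 := Rabs_pos (exp x - 1 - x)); assert (Hp2 := Rabs_pos (cos y - 1)).
  apply Rplus_le_compat; nra. }
assert (R2 : (Rabs (exp x * sin y + 0 * cos y + - 0 + - y) <= 3 * (x * x) + 3 * (y * y))%R).
{ replace (exp x * sin y + 0 * cos y + - 0 + - y)%R
    with ((exp x - 1 - x) * sin y + x * sin y + (sin y - y))%R by ring.
  eapply Rle_trans; [apply Rabs_triang|].
  eapply Rle_trans; [apply Rplus_le_compat_r, Rabs_triang|]; rewrite !Rabs_mult.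
  assert (Hs : (Rabs (sin y) <= 2 * Rabs y)%R).
  { replace (sin y) with ((sin y - y) + y)%R by ring.
    eapply Rle_trans; [apply Rabs_triang|].
    assert (y * y = Rabs y * Rabs y)%R by (rewrite <- Rabs_mult, Rabs_pos_eq; auto).
    assert (Hp := Rabs_pos y); nra. }
  assert (Hs1 : (Rabs (sin y) <= 1)%R) by (apply Rabs_le; generalize (SIN_bound y); lra).
  assert (Ha := Rabs_pos x); assert (Hb := Rabs_pos y); assert (Hc := Rabs_pos (sin y)).
  assert (Ex : (x * x = Rabs x * Rabs x)%R) by (rewrite <- Rabs_mult, Rabs_pos_eq; auto).
  assert (Ey : (y * y = Rabs y * Rabs y)%R) by (rewrite <- Rabs_mult, Rabs_pos_eq; auto).
  assert (T1 : (Rabs (exp x - 1 - x) * Rabs (sin y) <= x * x * 2)%R).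
  { assert (Rabs (exp x - 1 - x) <= 2 * (x * x))%R by auto.
    apply Rle_trans with (2 * (x * x) * (2 * Rabs y))%R.
    - apply Rmult_le_compat; auto; apply Rabs_pos.
    - nra. }
  assert (T2 : (Rabs x * Rabs (sin y) <= x * x + y * y)%R).
  { rewrite Ex, Ey; assert (0 <= (Rabs x - Rabs y) * (Rabs x - Rabs y))%R by apply Rle_0_sqr; nra. }
  nra. }
lra.
Qed.

Lemma is_Cderive_Cexp (z : C) : is_Cderive Cexp z (Cexp z).
Proof.
apply is_Cderive_eps; intros eps Heps.
assert (Hz : (0 < Cmod (Cexp z))%R) by (rewrite Cmod_Cexp; apply exp_pos).
exists (Rmin (/ 2) (eps / (6 * Cmod (Cexp z)))); split.
{ apply Rmin_pos; [lra | apply Rdiv_lt_0_compat; lra]. }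
intros w Hw.
assert (H1 : (Cmod (w - z) <= / 2)%R) by (left; eapply Rlt_le_trans; [exact Hw | apply Rmin_l]).
assert (H2 : (Cmod (w - z) <= eps / (6 * Cmod (Cexp z)))%R)
  by (left; eapply Rlt_le_trans; [exact Hw | apply Rmin_r]).
replace (Cexp w - Cexp z - (w - z) * Cexp z) with (Cexp z * (Cexp (w - z) - 1 - (w - z))).
2:{ replace (Cexp w) with (Cexp (z + (w - z))) by (f_equal; ring); rewrite Cexp_plus; ring. }
rewrite Cmod_mult.
eapply Rle_trans; [apply Rmult_le_compat_l; [lra | now apply Cexp_second_order]|].
rewrite <- !Rmult_assoc; apply Rmult_le_compat_r; [apply Cmod_ge_0|].
apply Rle_trans with (Cmod (Cexp z) * 6 * (eps / (6 * Cmod (Cexp z))))%R.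
- apply Rmult_le_compat_l; lra.
- right; field; lra.
Qed.

(** * Slopes of entire functions *)

Definition slope (f f' : C -> C) (z w : C) : C :=
  if Ceq_dec w z then f' z else (f w - f z) / (w - z).

Lemma entire_continuous (f : C -> C) : entire f -> forall z, Ccontinuous f z.
Proof. intros Hf z; destruct (Hf z) as [l Hl]; exact (is_Cderive_continuous f z l Hl). Qed.

Lemma Ccontinuous_minus (f g : C -> C) (z : C) :
  Ccontinuous f z -> Ccontinuous g z -> Ccontinuous (fun w => f w - g w) z.
Proof. exact (continuous_minus (K := C_AbsRing) (V := C_NormedModule) f g z). Qed.

(** A second order Taylor expansion by integrating the first order expansion of [f'] along a
    segment. *)
Lemma Cderive_second_order (f f' : C -> C) (z c : C) :
  (forall w, is_Cderive f w (f' w)) -> (forall w, Ccontinuous f' w) -> is_Cderive f' z c ->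
  forall eps : R, (0 < eps)%R -> exists d : R, (0 < d)%R /\
    forall w : C, (Cmod (w - z) < d)%R ->
      (Cmod (f w - f z - (w - z) * f' z - (w - z) * (w - z) * (c / 2))
        <= Cmod (w - z) * (eps * Cmod (w - z)))%R.
Proof.
intros Hf Hc Hz eps Heps.
destruct (proj1 (is_Cderive_eps f' z c) Hz eps Heps) as [d [Hd H]].
exists d; split; auto; intros w Hw.
assert (Hid : forall u, is_Cderive (fun v => v - z) u (1 - 0))
  by (intros u; apply is_Cderive_minus; [apply is_Cderive_id | apply is_Cderive_const]).
assert (Hg : forall u, is_Cderive
  (fun v => f v - ((v - z) * f' z + (v - z) * (v - z) * (c / 2))) u
  (f' u - (f' z + (u - z) * c))).
{ intros u; apply is_Cderive_minus; [apply Hf|].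
  eapply is_Cderive_eq.
  - apply is_Cderive_plus.
    + apply (is_Cderive_mult (fun v => v - z) (fun _ => f' z)); [apply Hid | apply is_Cderive_const].
    + apply (is_Cderive_mult (fun v => (v - z) * (v - z)) (fun _ => c / 2));
        [| apply is_Cderive_const].
      apply is_Cderive_mult; apply Hid.
  - simpl; field; apply C2_neq_0. }
assert (Hcont : forall u, Ccontinuous (fun u => f' u - (f' z + (u - z) * c)) u).
{ intros u; apply Ccontinuous_minus; auto.
  apply (is_Cderive_continuous _ u (0 + ((1 - 0) * c + (u - z) * 0))).
  apply is_Cderive_plus; [apply is_Cderive_const|].
  apply (is_Cderive_mult (fun v => v - z) (fun _ => c)); [apply Hid | apply is_Cderive_const]. }
assert (E := seg_derive _ _ z w Hg Hcont).
replace (f w - f z - (w - z) * f' z - (w - z) * (w - z) * (c / 2))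
  with (seg (fun u => f' u - (f' z + (u - z) * c)) z w) by (rewrite E; ring).
apply seg_norm_le; auto; intros t Ht.
assert (Hd1 := point_on_segment_dist z w t Ht).
replace (f' (z + t * (w - z)) - (f' z + (z + t * (w - z) - z) * c))
  with (f' (z + t * (w - z)) - f' z - (z + t * (w - z) - z) * c) by ring.
eapply Rle_trans; [apply H; lra|]; apply Rmult_le_compat_l; lra.
Qed.

(** The base point is the only delicate one. The second order expansion of [f] there is a
    first order expansion of the slope, with derivative half the second derivative of [f]. *)
Lemma entire_slope (f f' : C -> C) (z : C) :
  (forall w, is_Cderive f w (f' w)) -> entire f' -> entire (slope f f' z).
Proof.
intros Hf Hf' w.
destruct (Ceq_dec w z) as [->|Hwz].
- destruct (Hf' z) as [c Hc].
  exists (c / 2); apply (proj2 (is_Cderive_eps _ z (c / 2))); intros eps Heps.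
  destruct (Cderive_second_order f f' z c Hf (entire_continuous f' Hf') Hc eps Heps) as [d [Hd H]].
  exists d; split; auto; intros w Hw; unfold slope.
  destruct (Ceq_dec z z) as [_|]; [|congruence].
  destruct (Ceq_dec w z) as [->|Hwz].
  + replace (f' z - f' z - (z - z) * (c / 2)) with (RtoC 0) by ring.
    rewrite Cmod_0; apply Rmult_le_pos; [lra | apply Cmod_ge_0].
  + assert (Hm : (0 < Cmod (w - z))%R) by (apply Cmod_gt_0; now apply Cminus_eq_contra).
    apply Rmult_le_reg_l with (Cmod (w - z)); auto.
    rewrite <- Cmod_mult.
    replace ((w - z) * ((f w - f z) / (w - z) - f' z - (w - z) * (c / 2)))
      with (f w - f z - (w - z) * f' z - (w - z) * (w - z) * (c / 2)).
    * apply H; auto.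
    * field; now apply Cminus_eq_contra.
- assert (Hd : (0 < Cmod (w - z))%R) by (apply Cmod_gt_0; now apply Cminus_eq_contra).
  eexists; refine (is_Cderive_ext_near (fun v => (f v - f z) * / (v - z)) _ w _ (Cmod (w - z)) Hd _ _).
  + intros v Hv; unfold slope; destruct (Ceq_dec v z) as [->|]; [|reflexivity].
    rewrite Cmod_minus_sym in Hv; lra.
  + apply is_Cderive_mult.
    * apply is_Cderive_minus; [apply Hf | apply is_Cderive_const].
    * apply (is_Cderive_inv (fun v => v - z)); [now apply Cminus_eq_contra|].
      apply is_Cderive_minus; [apply is_Cderive_id | apply is_Cderive_const].
Qed.

(** * Circles and Cauchy transforms *)

Definition circle (a : C) (r : R) (t : R) : C := a + r * Cexp (Ci * t).
Definition circle' (r : R) (t : R) : C := r * (Ci * Cexp (Ci * t)).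

Lemma is_Rderive_Cexp_Ci (t : R) : is_Rderive (fun s => Cexp (Ci * s)) t (Ci * Cexp (Ci * t)).
Proof.
apply (is_Rderive_comp Cexp (fun s => Ci * s)); [apply is_Cderive_Cexp|].
apply (is_derive_ext (V := C_R_NormedModule) (fun s : R => 0 + s * Ci)).
- intros s; change (0 + RtoC s * Ci = Ci * RtoC s); ring.
- apply is_Rderive_affine.
Qed.

Lemma is_Rderive_circle (a : C) (r : R) (t : R) : is_Rderive (circle a r) t (circle' r t).
Proof.
unfold circle, circle'.
replace (r * (Ci * Cexp (Ci * t))) with ((Ci * Cexp (Ci * t)) * r) by ring.
apply (is_Rderive_comp (fun z => a + r * z) (fun s => Cexp (Ci * s))); [|apply is_Rderive_Cexp_Ci].
eapply is_Cderive_eq.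
- apply is_Cderive_plus; [apply is_Cderive_const | apply is_Cderive_scal, is_Cderive_id].
- ring.
Qed.

Lemma Rcontinuous_circle (a : C) (r : R) (t : R) : Rcontinuous (circle a r) t.
Proof. apply (is_Rderive_continuous _ _ (circle' r t)), is_Rderive_circle. Qed.

Lemma Rcontinuous_circle' (r : R) (t : R) : Rcontinuous (circle' r) t.
Proof.
unfold circle'; apply (continuous_Cmult (T := R_UniformSpace)); [apply continuous_const_C|].
apply (continuous_Cmult (T := R_UniformSpace)); [apply continuous_const_C|].
apply (is_Rderive_continuous _ _ (Ci * Cexp (Ci * t))), is_Rderive_Cexp_Ci.
Qed.

Lemma Cmod_Cexp_Ci (t : R) : Cmod (Cexp (Ci * t)) = 1%R.
Proof. rewrite Cmod_Cexp; unfold Ci, Re; simpl; rewrite <- exp_0; f_equal; ring. Qed.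

Lemma Cmod_circle_minus (a : C) (r t : R) : (0 <= r)%R -> Cmod (circle a r t - a) = r.
Proof.
intros Hr; unfold circle; replace (a + r * Cexp (Ci * t) - a) with (r * Cexp (Ci * t)) by ring.
rewrite Cmod_mult, Cmod_R, Cmod_Cexp_Ci, Rabs_pos_eq by auto; ring.
Qed.

Lemma Cmod_circle' (r t : R) : (0 <= r)%R -> Cmod (circle' r t) = r.
Proof.
intros Hr; unfold circle'; rewrite !Cmod_mult, Cmod_R, Cmod_Ci, Cmod_Cexp_Ci, Rabs_pos_eq by auto.
ring.
Qed.

Lemma circle_dist (a z : C) (r t : R) :
  (0 <= r)%R -> (r - Cmod (z - a) <= Cmod (circle a r t - z))%R.
Proof.
intros Hr; assert (H := Cmod_minus_triangle (circle a r t) z a).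
rewrite Cmod_circle_minus in H by auto; lra.
Qed.

Lemma circle_closed (a : C) (r : R) : circle a r (2 * PI) = circle a r 0.
Proof.
unfold circle; f_equal; f_equal; unfold Cexp, Ci, Re, Im; simpl.
replace (0 * (2 * PI) - 1 * 0)%R with 0%R by ring; replace (0 * 0 - 1 * 0)%R with 0%R by ring.
replace (0 * 0 + 1 * (2 * PI))%R with (2 * PI)%R by ring; replace (0 * 0 + 1 * 0)%R with 0%R by ring.
now rewrite cos_2PI, sin_2PI, cos_0, sin_0.
Qed.

(** The integral of a function with a primitive along a closed curve vanishes. The primitive
    is required near the circle only, as in the application to [1 / (v - w)^2]. *)
Lemma circle_integral_derive (F f : C -> C) (a : C) (r : R) :
  (forall t, is_Cderive F (circle a r t) (f (circle a r t))) ->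
  (forall t, Rcontinuous (fun t => f (circle a r t)) t) ->
  is_CInt (fun t => circle' r t * f (circle a r t)) 0 (2 * PI) 0.
Proof.
intros HF Hf.
replace (RtoC 0) with (F (circle a r (2 * PI)) - F (circle a r 0)).
- apply (is_CInt_derive F f (circle a r) (circle' r)); auto.
  + intros t; apply is_Rderive_circle.
  + intros t; apply (continuous_Cmult (T := R_UniformSpace)); [apply Rcontinuous_circle' | apply Hf].
- rewrite circle_closed; ring.
Qed.

(** With [u = 1 / (A - h)] and [v = 1 / A] one has [u - v = h u v], and the step of the
    induction is the product rule for [u^(k+1) = u u^k], with remainders. *)
Lemma Cinv_pow_second_order (rho : R) (k : nat) : (0 < rho)%R ->
  exists K, (0 <= K)%R /\ forall A h : C, (rho <= Cmod A)%R -> (Cmod h <= rho / 2)%R ->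
    (Cmod ((/ (A - h)) ^ k - (/ A) ^ k - h * (INR k * (/ A) ^ S k)) <= K * (Cmod h * Cmod h))%R.
Proof.
intros Hrho; induction k as [|k [K [HK IH]]].
- exists 0%R; split; [lra|]; intros A h _ _.
  replace ((/ (A - h)) ^ 0 - (/ A) ^ 0 - h * (INR 0 * (/ A) ^ 1)) with (RtoC 0) by (simpl; ring).
  rewrite Cmod_0; lra.
- exists (2 / rho * K + INR k * (/ rho) ^ S k * (2 / (rho * rho)) + (/ rho) ^ k * (2 / (rho * rho * rho)))%R.
  assert (Hi : (0 < / rho)%R) by (now apply Rinv_0_lt_compat).
  assert (Hp : forall n, (0 <= (/ rho) ^ n)%R) by (intros n; apply pow_le; lra).
  assert (H2r : (0 < 2 / rho)%R) by (apply Rdiv_lt_0_compat; lra).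
  assert (H2rr : (0 < 2 / (rho * rho))%R) by (apply Rdiv_lt_0_compat; nra).
  assert (H2rrr : (0 < 2 / (rho * rho * rho))%R)
    by (apply Rdiv_lt_0_compat; [lra | repeat apply Rmult_lt_0_compat; lra]).
  split.
  { repeat apply Rplus_le_le_0_compat; repeat apply Rmult_le_pos; auto using pos_INR; lra. }
  intros A h HA Hh.
  assert (HA0 : A <> 0) by (apply Cmod_gt_0; lra).
  assert (HAh : (rho / 2 <= Cmod (A - h))%R).
  { assert (H := Cmod_triangle (A - h) h); replace (A - h + h) with A in H by ring; lra. }
  assert (HAh0 : A - h <> 0) by (apply Cmod_gt_0; lra).
  specialize (IH A h HA Hh).
  set (u := / (A - h)) in *; set (v := / A) in *.
  assert (Hv : (Cmod v <= / rho)%R)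
    by (unfold v; rewrite Cmod_inv by auto; apply Rinv_le_contravar; lra).
  assert (Hu : (Cmod u <= 2 / rho)%R).
  { unfold u; rewrite Cmod_inv by auto.
    replace (2 / rho)%R with (/ (rho / 2))%R by (field; lra); apply Rinv_le_contravar; lra. }
  assert (Euv : u - v = h * (u * v)) by (unfold u, v; field; auto).
  assert (E2 : u - v - h * (v * v) = h * h * (u * v * v)) by (unfold u, v; field; auto).
  replace (u ^ S k - v ^ S k - h * (INR (S k) * v ^ S (S k)))
    with (u * (u ^ k - v ^ k - h * (INR k * v ^ S k))
      + INR k * v ^ S k * (h * (u - v)) + v ^ k * (u - v - h * (v * v))).
  2:{ rewrite S_INR, RtoC_plus; simpl; ring. }
  rewrite E2, Euv.
  assert (Hvk : forall n, (Cmod (v ^ n) <= (/ rho) ^ n)%R)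
    by (intros n; rewrite Cmod_pow; apply pow_incr; split; [apply Cmod_ge_0 | auto]).
  assert (Hcu := Cmod_ge_0 u); assert (Hcv := Cmod_ge_0 v); assert (Hch := Cmod_ge_0 h).
  eapply Rle_trans; [apply Cmod_triangle|]; rewrite !Rmult_plus_distr_r.
  apply Rplus_le_compat; [eapply Rle_trans; [apply Cmod_triangle|]; apply Rplus_le_compat|].
  + rewrite Cmod_mult, Rmult_assoc; apply Rmult_le_compat; auto using Cmod_ge_0.
  + rewrite !Cmod_mult, Cmod_R, Rabs_pos_eq by apply pos_INR.
    rewrite !Rmult_assoc; apply Rmult_le_compat_l; [apply pos_INR|].
    apply Rmult_le_compat; auto using Cmod_ge_0.
    { repeat apply Rmult_le_pos; auto. }
    replace (Cmod h * (Cmod h * (Cmod u * Cmod v)))%R with ((Cmod u * Cmod v) * (Cmod h * Cmod h))%R by ring.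
    apply Rmult_le_compat_r; [apply Rmult_le_pos; auto|].
    replace (2 / (rho * rho))%R with (2 / rho * / rho)%R by (field; lra).
    apply Rmult_le_compat; auto.
  + rewrite !Cmod_mult, !Rmult_assoc.
    apply Rmult_le_compat; auto using Cmod_ge_0.
    { repeat apply Rmult_le_pos; auto. }
    replace (Cmod h * (Cmod h * (Cmod u * (Cmod v * Cmod v))))%R
      with ((Cmod u * (Cmod v * Cmod v)) * (Cmod h * Cmod h))%R by ring.
    apply Rmult_le_compat_r; [apply Rmult_le_pos; auto|].
    replace (2 / (rho * (rho * rho)))%R with (2 / rho * (/ rho * / rho))%R by (field; lra).
    apply Rmult_le_compat; auto; [apply Rmult_le_pos; auto | apply Rmult_le_compat; auto].
Qed.

(** The integrand, in the parameter of the circle, of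
    [phi(zeta) / (zeta - z)^k d zeta]. *)
Definition cauchy_kernel (phi : R -> C) (a : C) (r : R) (k : nat) (z : C) (t : R) : C :=
  circle' r t * phi t * (/ (circle a r t - z)) ^ k.

Definition cauchy_transform (phi : R -> C) (a : C) (r : R) (k : nat) (z : C) : C :=
  CInt (cauchy_kernel phi a r k z) 0 (2 * PI).

Lemma Rcontinuous_inv_circle (a z : C) (r : R) (k : nat) (t : R) :
  (Cmod (z - a) < r)%R -> Rcontinuous (fun t => (/ (circle a r t - z)) ^ k) t.
Proof.
intros Hz; assert (Hr : (0 <= r)%R) by (generalize (Cmod_ge_0 (z - a)); lra).
induction k as [|k IH]; [apply continuous_const_C|].
apply (continuous_Cmult (T := R_UniformSpace)); [|exact IH].
apply (continuous_comp (U := R_UniformSpace) (V := C_UniformSpace) (W := C_UniformSpace)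
  (circle a r) (fun w => / (w - z))); [apply Rcontinuous_circle|].
eapply is_Cderive_continuous, (is_Cderive_inv (fun w => w - z)).
- apply Cmod_gt_0; generalize (circle_dist a z r t Hr); lra.
- apply is_Cderive_minus; [apply is_Cderive_id | apply is_Cderive_const].
Qed.

Lemma is_CInt_cauchy_transform (phi : R -> C) (a : C) (r : R) (k : nat) (z : C) :
  (forall t, Rcontinuous phi t) -> (Cmod (z - a) < r)%R ->
  is_CInt (cauchy_kernel phi a r k z) 0 (2 * PI) (cauchy_transform phi a r k z).
Proof.
intros Hphi Hz; apply is_CInt_continuous; intros t.
apply (continuous_Cmult (T := R_UniformSpace)); [|now apply Rcontinuous_inv_circle].
apply (continuous_Cmult (T := R_UniformSpace)); [apply Rcontinuous_circle' | apply Hphi].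
Qed.

(** The constant is uniform in the density [phi] and in the points [z] at distance at
    least [rho] from the circle: this gives both the derivative of the transform and
    Cauchy's estimate. *)
Lemma cauchy_transform_second_order (r rho : R) (k : nat) : (0 < rho)%R -> (rho <= r)%R ->
  exists K, (0 <= K)%R /\ forall (phi : R -> C) (a z h : C) (M : R),
    (forall t, Rcontinuous phi t) ->
  (forall t, (0 <= t <= 2 * PI)%R -> (Cmod (phi t) <= M)%R) ->
    (Cmod (z - a) <= r - rho)%R -> (Cmod h <= rho / 2)%R ->
    (Cmod (cauchy_transform phi a r k (z + h) - cauchy_transform phi a r k z
       - h * (INR k * cauchy_transform phi a r (S k) z)) <= K * M * (Cmod h * Cmod h))%R.
Proof.
intros Hrho Hr; destruct (Cinv_pow_second_order rho k Hrho) as [K [HK H]].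
assert (HPI := PI_RGT_0).
exists (2 * PI * r * K)%R; split; [apply Rmult_le_pos; [apply Rmult_le_pos|]; lra|].
intros phi a z h M Hphi HM Hz Hh.
assert (Hzh : (Cmod (z + h - a) < r)%R).
{ replace (z + h - a) with ((z - a) + h) by ring; eapply Rle_lt_trans; [apply Cmod_triangle | lra]. }
assert (HI : is_CInt (fun t => cauchy_kernel phi a r k (z + h) t - cauchy_kernel phi a r k z t
    - (h * INR k) * cauchy_kernel phi a r (S k) z t) 0 (2 * PI)
  (cauchy_transform phi a r k (z + h) - cauchy_transform phi a r k z
       - (h * INR k) * cauchy_transform phi a r (S k) z)).
{ apply is_CInt_minus; [apply is_CInt_minus | apply is_CInt_scal];
    apply is_CInt_cauchy_transform; auto; lra. }
rewrite Cmult_assoc.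
replace (2 * PI * r * K * M * (Cmod h * Cmod h))%R
  with ((2 * PI - 0) * (r * M * (K * (Cmod h * Cmod h))))%R by ring.
refine (is_CInt_norm_le _ _ _ _ _ _ _ HI); [lra|]; intros t Ht.
unfold cauchy_kernel.
replace (circle' r t * phi t * (/ (circle a r t - (z + h))) ^ k -
  circle' r t * phi t * (/ (circle a r t - z)) ^ k -
  h * INR k * (circle' r t * phi t * (/ (circle a r t - z)) ^ S k))
 with (circle' r t * phi t * ((/ ((circle a r t - z) - h)) ^ k - (/ (circle a r t - z)) ^ k
   - h * (INR k * (/ (circle a r t - z)) ^ S k))).
2:{ replace (circle a r t - (z + h)) with (circle a r t - z - h) by ring; ring. }
rewrite !Cmod_mult, Cmod_circle' by lra.
apply Rmult_le_compat; [apply Rmult_le_pos; [lra | apply Cmod_ge_0] | apply Cmod_ge_0 | |].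
- apply Rmult_le_compat_l; [lra | now apply HM].
- apply H; auto; eapply Rle_trans; [|apply circle_dist]; lra.
Qed.

Lemma is_Cderive_of_second_order (f : C -> C) (z l : C) (K d : R) :
  (0 < d)%R -> (0 <= K)%R ->
  (forall h, (Cmod h <= d)%R -> (Cmod (f (z + h) - f z - h * l)%C <= K * (Cmod h * Cmod h))%R) ->
  is_Cderive f z l.
Proof.
intros Hd HK H; apply is_Cderive_eps; intros eps Heps.
exists (Rmin d (eps / (K + 1))); split; [apply Rmin_pos; [auto | apply Rdiv_lt_0_compat; lra]|].
intros w Hw.
assert (H1 : (Cmod (w - z) <= d)%R) by (left; eapply Rlt_le_trans; [exact Hw | apply Rmin_l]).
assert (H2 : (Cmod (w - z) <= eps / (K + 1))%R)
  by (left; eapply Rlt_le_trans; [exact Hw | apply Rmin_r]).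
specialize (H (w - z) H1); replace (z + (w - z)) with w in H by ring.
eapply Rle_trans; [exact H|]; rewrite <- Rmult_assoc.
apply Rmult_le_compat_r; [apply Cmod_ge_0|].
apply Rle_trans with ((K + 1) * (eps / (K + 1)))%R; [|right; field; lra].
assert (Hc := Cmod_ge_0 (w - z)).
apply Rmult_le_compat; lra.
Qed.

Lemma is_Cderive_cauchy_transform (phi : R -> C) (a : C) (r : R) (k : nat) (z : C) (M : R) :
  (forall t, Rcontinuous phi t) ->
  (forall t, (0 <= t <= 2 * PI)%R -> (Cmod (phi t) <= M)%R) -> (Cmod (z - a) < r)%R ->
  is_Cderive (cauchy_transform phi a r k) z (INR k * cauchy_transform phi a r (S k) z).
Proof.
intros Hphi HM Hz; assert (Hza := Cmod_ge_0 (z - a)).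
destruct (cauchy_transform_second_order r (r - Cmod (z - a)) k) as [K [HK H]]; try lra.
assert (HM0 : (0 <= M)%R) by (eapply Rle_trans; [apply Cmod_ge_0 | apply (HM 0%R); generalize PI_RGT_0; lra]).
apply is_Cderive_of_second_order with (K * M)%R ((r - Cmod (z - a)) / 2)%R.
- lra.
- now apply Rmult_le_pos.
- intros h Hh; apply H; auto; lra.
Qed.

(** The value at the centre is immediate. The transform has derivative 0, because
    [1 / (zeta - z)^2] has a primitive near the circle, so it is constant in the disc. *)
Lemma cauchy_transform_one (a : C) (r : R) (z : C) :
  (Cmod (z - a) < r)%R -> cauchy_transform (fun _ => 1) a r 1 z = 2 * PI * Ci.
Proof.
intros Hz; assert (Hza := Cmod_ge_0 (z - a)).
assert (Hcst : forall t : R, Rcontinuous (fun _ => RtoC 1) t) by (intros t; apply continuous_const_C).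
assert (Hone : forall t : R, (0 <= t <= 2 * PI)%R -> (Cmod ((fun _ : R => RtoC 1) t) <= 1)%R)
  by (intros t _; rewrite Cmod_R, Rabs_pos_eq; lra).
assert (H0 : forall w, (Cmod (w - a) < r)%R -> cauchy_transform (fun _ => 1) a r 2 w = 0).
{ intros w Hw; apply is_CInt_unique.
  apply is_CInt_ext with (fun t => circle' r t * (fun v => / (v - w) * / (v - w)) (circle a r t)).
  { intros t; unfold cauchy_kernel; simpl; ring. }
  assert (Hcw := Cmod_ge_0 (w - a)).
  apply (circle_integral_derive (fun v => - / (v - w)) (fun v => / (v - w) * / (v - w)) a r).
  - intros t; eapply is_Cderive_eq.
    + apply is_Cderive_opp, (is_Cderive_inv (fun v => v - w)).
      * apply Cmod_gt_0; generalize (circle_dist a w r t); lra.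
      * apply is_Cderive_minus; [apply is_Cderive_id | apply is_Cderive_const].
    + simpl; ring.
  - intros t.
    apply (continuous_ext (T := R_UniformSpace) (U := C_UniformSpace)
      (fun t => (/ (circle a r t - w)) ^ 2)); [intros s; simpl; ring|].
    now apply Rcontinuous_inv_circle. }
assert (Ha : cauchy_transform (fun _ => 1) a r 1 a = 2 * PI * Ci).
{ apply is_CInt_unique.
  apply is_CInt_ext with (fun _ => Ci).
  { intros t; unfold cauchy_kernel, circle', circle; simpl.
    assert (Hr : RtoC r <> 0) by (intros E; apply RtoC_inj in E; lra).
    assert (He := Cexp_neq_0 (Ci * t)).
    replace (a + r * Cexp (Ci * t) - a) with (r * Cexp (Ci * t)) by ring; field; auto. }
  assert (Hk := is_RInt_const (V := C_R_NormedModule) 0 (2 * PI) Ci).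
  rewrite scal_R_Cmult in Hk.
  replace (2 * PI * Ci) with ((2 * PI - 0)%R * Ci); [exact Hk|].
  now rewrite RtoC_minus, RtoC_mult; ring. }
rewrite <- Ha.
set (g := fun s : R => cauchy_transform (fun _ => 1) a r 1 (a + s * (z - a))).
assert (E : g 0%R = g 1%R).
2:{ unfold g in E; replace (a + 0%R * (z - a)) with a in E by ring.
  replace (a + 1%R * (z - a)) with z in E by ring; now symmetry. }
apply (eq_is_derive (V := C_R_NormedModule) g 0 1); [|lra].
intros t Ht.
assert (Ht' := point_on_segment_dist a z t Ht).
change (is_Rderive g t 0).
replace (RtoC 0) with ((z - a) * (INR 1 * cauchy_transform (fun _ => 1) a r 2 (a + t * (z - a)))).
- apply (is_Rderive_comp (cauchy_transform (fun _ => 1) a r 1) (fun s => a + s * (z - a))).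
  + apply is_Cderive_cauchy_transform with 1%R; auto; lra.
  + apply is_Rderive_affine.
- rewrite H0 by lra; ring.
Qed.

(** * Cauchy's formula and its consequences *)

Lemma Rcontinuous_bounded (g : R -> C) (a b : R) :
  (a <= b)%R -> (forall t, Rcontinuous g t) ->
  exists M, forall t, (a <= t <= b)%R -> (Cmod (g t) <= M)%R.
Proof.
intros Hab Hg.
destruct (continuity_ab_maj (fun t => Cmod (g t)) a b Hab) as [m [Hm _]].
- intros t _; apply continuity_pt_filterlim.
  apply (continuous_comp (U := R_UniformSpace) (V := C_UniformSpace) (W := R_UniformSpace) g Cmod);
    [apply Hg | apply (filterlim_norm (V := C_NormedModule))].
- exists (Cmod (g m)); auto.
Qed.

Lemma two_PI_Ci_neq_0 : 2 * PI * Ci <> 0.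
Proof.
assert (H := PI_RGT_0).
apply Cmult_neq_0; [apply Cmult_neq_0; [apply C2_neq_0|] | apply Ci_nz].
intros E; apply RtoC_inj in E; lra.
Qed.

Lemma Rcontinuous_on_circle (f : C -> C) (a : C) (r : R) :
  entire f -> forall t, Rcontinuous (fun t => f (circle a r t)) t.
Proof.
intros Hf t.
apply (continuous_comp (U := R_UniformSpace) (V := C_UniformSpace) (W := C_UniformSpace)
  (circle a r) f); [apply Rcontinuous_circle | now apply entire_continuous].
Qed.

Lemma entire_of_derive (f f' : C -> C) : (forall w, is_Cderive f w (f' w)) -> entire f.
Proof. intros H w; exists (f' w); exact (H w). Qed.

(** The slope at [z] is entire, hence has a primitive and integrates to 0 along the circle;
    expanding the slope leaves [f z] times the transform of the constant 1. *)
Lemma cauchy_formula_C1 (f f' : C -> C) (a z : C) (r : R) :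
  (forall w, is_Cderive f w (f' w)) -> entire f' -> (Cmod (z - a) < r)%R ->
  cauchy_transform (fun t => f (circle a r t)) a r 1 z = 2 * PI * Ci * f z.
Proof.
intros Hf Hf' Hz.
assert (Hr : (0 <= r)%R) by (generalize (Cmod_ge_0 (z - a)); lra).
assert (Hs := entire_slope f f' z Hf Hf').
assert (Hfe := entire_of_derive f f' Hf).
destruct (entire_primitive _ Hs) as [K HK].
assert (H1 : is_CInt (fun t => circle' r t * slope f f' z (circle a r t)) 0 (2 * PI) 0).
{ apply (circle_integral_derive K (slope f f' z) a r); [intros t; apply HK | now apply Rcontinuous_on_circle]. }
assert (H2 : is_CInt (fun t => cauchy_kernel (fun t => f (circle a r t)) a r 1 z t
    - f z * cauchy_kernel (fun _ => 1) a r 1 z t) 0 (2 * PI)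
  (cauchy_transform (fun t => f (circle a r t)) a r 1 z
    - f z * cauchy_transform (fun _ => 1) a r 1 z)).
{ apply is_CInt_minus; [|apply is_CInt_scal]; apply is_CInt_cauchy_transform; auto.
  - now apply Rcontinuous_on_circle.
  - intros t; apply continuous_const_C. }
rewrite cauchy_transform_one in H2 by exact Hz.
apply (is_CInt_ext _ (fun t => circle' r t * slope f f' z (circle a r t))) in H2.
- apply Ceq_minus; rewrite <- (is_CInt_inj _ _ _ _ _ H2 H1); ring.
- intros t; unfold cauchy_kernel, slope.
  assert (Hd := circle_dist a z r t Hr).
  assert (Hne : circle a r t - z <> 0) by (apply Cmod_gt_0; lra).
  destruct (Ceq_dec (circle a r t) z) as [E|_].
  + rewrite E in Hne; exfalso; apply Hne; ring.
  + simpl; field; exact Hne.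
Qed.

(** A primitive of [f] has an entire derivative, so Cauchy's formula makes it a Cauchy
    transform, and these can be differentiated indefinitely. *)
Theorem entire_derive (f f' : C -> C) : (forall w, is_Cderive f w (f' w)) -> entire f'.
Proof.
intros Hf a.
assert (Hfe := entire_of_derive f f' Hf).
destruct (entire_primitive f Hfe) as [F HF].
assert (HFe := entire_of_derive F f HF).
set (phi := fun t => F (circle a 1 t)).
assert (Hphi : forall t, Rcontinuous phi t) by (now apply Rcontinuous_on_circle).
destruct (Rcontinuous_bounded phi 0 (2 * PI)) as [M HM]; auto.
{ generalize PI_RGT_0; lra. }
assert (HD : forall k z, (Cmod (z - a) < 1)%R ->
  is_Cderive (cauchy_transform phi a 1 k) z (INR k * cauchy_transform phi a 1 (S k) z))
  by (intros k z Hz; now apply is_Cderive_cauchy_transform with M).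
set (c := 2 * PI * Ci) in *; assert (Hc : c <> 0) by apply two_PI_Ci_neq_0.
assert (Hnear : forall z : C, (Cmod (z - a) < 1)%R -> forall w : C,
  (Cmod (w - z) < 1 - Cmod (z - a))%R -> (Cmod (w - a) < 1)%R).
{ intros z Hz w Hw; generalize (Cmod_minus_triangle w z a); lra. }
(* Up to factors, [F], [f] and [f'] are the transforms of orders 1, 2 and 3. *)
assert (E1 : forall z, (Cmod (z - a) < 1)%R -> F z = / c * cauchy_transform phi a 1 1 z).
{ intros z Hz; unfold phi; rewrite (cauchy_formula_C1 F f) by auto.
  fold c; field; exact Hc. }
assert (E2 : forall z, (Cmod (z - a) < 1)%R -> f z = / c * (INR 1 * cauchy_transform phi a 1 2 z)).
{ intros z Hz; apply (is_Cderive_inj F z); [apply HF|].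
  apply is_Cderive_ext_near with (fun w => / c * cauchy_transform phi a 1 1 w) (1 - Cmod (z - a))%R.
  - lra.
  - intros w Hw; symmetry; apply E1; now apply (Hnear z).
  - now apply is_Cderive_scal, HD. }
assert (E3 : forall z, (Cmod (z - a) < 1)%R ->
  f' z = / c * (INR 1 * (INR 2 * cauchy_transform phi a 1 3 z))).
{ intros z Hz; apply (is_Cderive_inj f z); [apply Hf|].
  apply is_Cderive_ext_near with (fun w => / c * (INR 1 * cauchy_transform phi a 1 2 w)) (1 - Cmod (z - a))%R.
  - lra.
  - intros w Hw; symmetry; apply E2; now apply (Hnear z).
  - now apply is_Cderive_scal, is_Cderive_scal, HD. }
assert (Ha : (Cmod (a - a) < 1)%R)
  by (replace (a - a) with (RtoC 0) by ring; rewrite Cmod_0; lra).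
eexists; refine (is_Cderive_ext_near (fun w => / c * (INR 1 * (INR 2 * cauchy_transform phi a 1 3 w)))
  f' a _ 1 Rlt_0_1 _ _).
- intros w Hw; symmetry; now apply E3.
- now apply is_Cderive_scal, is_Cderive_scal, is_Cderive_scal, HD.
Qed.

Lemma is_Cderive_C_derive (f : C -> C) (z : C) :
  holomorphic_at f z -> is_Cderive f z (C_derive f z).
Proof. exact (C_derive_correct f z z). Qed.

(** Riemann's theorem: [(z - p) g z] is entire, being differentiable at [p] by continuity of
    [g], and [g] is its slope at [p]. *)
Theorem entire_removable (g : C -> C) (p : C) :
  (forall z, z <> p -> holomorphic_at g z) -> Ccontinuous g p -> entire g.
Proof.
intros Hg Hp.
set (f := fun z => (z - p) * g z).
assert (Hfp : is_Cderive f p (g p)).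
{ apply is_Cderive_eps; intros eps Heps.
  destruct (proj1 (Ccontinuous_eps g p) Hp eps Heps) as [d [Hd H]].
  exists d; split; auto; intros w Hw; unfold f.
  replace ((w - p) * g w - (p - p) * g p - (w - p) * g p) with ((w - p) * (g w - g p)) by ring.
  rewrite Cmod_mult, Rmult_comm; apply Rmult_le_compat_r; [apply Cmod_ge_0 | left; auto]. }
assert (Hf : forall z, is_Cderive f z (C_derive f z)).
{ intros z; apply is_Cderive_C_derive; destruct (Ceq_dec z p) as [->|Hz]; [exists (g p); exact Hfp|].
  destruct (Hg z Hz) as [l Hl].
  eexists; apply (is_Cderive_mult (fun z => z - p) g); [|exact Hl].
  apply is_Cderive_minus; [apply is_Cderive_id | apply is_Cderive_const]. }
assert (Hs := entire_slope f (C_derive f) p Hf (entire_derive f _ Hf)).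
intros z; destruct (Hs z) as [l Hl]; exists l.
revert Hl; apply is_Cderive_ext; intros w; unfold slope, f.
destruct (Ceq_dec w p) as [->|Hw].
- now apply is_C_derive_unique.
- field; now apply Cminus_eq_contra.
Qed.

Lemma cauchy_formula (f : C -> C) (a z : C) (r : R) : entire f -> (Cmod (z - a) < r)%R ->
  cauchy_transform (fun t => f (circle a r t)) a r 1 z = 2 * PI * Ci * f z.
Proof.
intros Hf.
assert (Hf' : forall w, is_Cderive f w (C_derive f w)) by (intros w; now apply is_Cderive_C_derive).
apply (cauchy_formula_C1 f (C_derive f)); auto; now apply entire_derive with f.
Qed.

(** The constant depends on the radius only, so that the estimate can be summed over a
    series of functions. *)
Lemma cauchy_estimate (r : R) : (0 < r)%R -> exists K, (0 <= K)%R /\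
  forall (f f' : C -> C) (a : C) (M : R), (forall z, is_Cderive f z (f' z)) ->
    (forall w : C, (Cmod (w - a) <= r)%R -> (Cmod (f w) <= M)%R) ->
    (Cmod (f' a) <= K * M)%R /\
    forall h : C, (Cmod h <= r / 2)%R ->
      (Cmod (f (a + h) - f a - h * f' a)%C <= K * M * (Cmod h * Cmod h))%R.
Proof.
intros Hr; destruct (cauchy_transform_second_order r r 1 Hr (Rle_refl r)) as [K [HK H]].
exists (K + (K * r / 2 + 4 / r))%R.
assert (H4 : (0 <= K * r / 2)%R)
  by (unfold Rdiv; apply Rmult_le_pos; [apply Rmult_le_pos|]; lra).
assert (H5 : (0 < 4 / r)%R) by (apply Rdiv_lt_0_compat; lra).
split; [lra|]; intros f f' a M Hf HM.
assert (Hfe := entire_of_derive f f' Hf).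
assert (Ha : Cmod (a - a) = 0%R) by (replace (a - a) with (RtoC 0) by ring; apply Cmod_0).
assert (HM0 : (0 <= M)%R)
  by (eapply Rle_trans; [apply Cmod_ge_0 | apply (HM a); rewrite Ha; lra]).
set (phi := fun t => f (circle a r t)).
assert (Hphi : forall t, Rcontinuous phi t) by (now apply Rcontinuous_on_circle).
assert (HphiM : forall t, (0 <= t <= 2 * PI)%R -> (Cmod (phi t) <= M)%R).
{ intros t _; apply HM; rewrite Cmod_circle_minus; lra. }
set (c := 2 * PI * Ci) in *; assert (Hc : c <> 0) by apply two_PI_Ci_neq_0.
assert (Hc1 : (1 <= Cmod c)%R).
{ unfold c; rewrite !Cmod_mult, Cmod_Ci, !Cmod_R, !Rabs_pos_eq; generalize PI2_1 PI_RGT_0; lra. }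
assert (E : INR 1 * cauchy_transform phi a r 2 a = c * f' a).
{ apply (is_Cderive_inj (fun w => c * f w) a).
  - apply is_Cderive_ext_near with (cauchy_transform phi a r 1) r; auto.
    + intros w Hw; now apply cauchy_formula.
    + apply is_Cderive_cauchy_transform with M; auto; lra.
  - now apply is_Cderive_scal. }
assert (HQ : forall h : C, (Cmod h <= r / 2)%R ->
      (Cmod (f (a + h) - f a - h * f' a)%C <= K * M * (Cmod h * Cmod h))%R).
{ intros h Hh.
  specialize (H phi a a h M Hphi HphiM ltac:(lra) Hh); rewrite E in H.
  unfold phi in H; rewrite !cauchy_formula in H; auto; try lra.
  - fold c in H.
    replace (c * f (a + h) - c * f a - h * (c * f' a)) with (c * (f (a + h) - f a - h * f' a))
      in H by ring.
    rewrite Cmod_mult in H.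
    eapply Rle_trans; [|exact H].
    rewrite <- (Rmult_1_l (Cmod (_ - _))) at 1.
    apply Rmult_le_compat_r; [apply Cmod_ge_0 | exact Hc1].
  - replace (a + h - a) with h by ring; lra. }
split.
(* The bound on the derivative is read off from the expansion with increment [r / 2]. *)
- assert (Hh : Cmod (r / 2)%R = (r / 2)%R) by (rewrite Cmod_R, Rabs_pos_eq; lra).
  specialize (HQ (r / 2)%R ltac:(lra)); rewrite Hh in HQ.
  assert (Hb1 : (Cmod (f (a + (r / 2)%R)%C) <= M)%R).
  { apply HM; replace (a + (r / 2)%R - a) with (RtoC (r / 2)) by ring; lra. }
  assert (Hb2 : (Cmod (f a) <= M)%R) by (apply HM; lra).
  assert (Hb3 : (r / 2 * Cmod (f' a) <= 2 * M + K * M * (r / 2 * (r / 2)))%R).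
  { rewrite <- Hh at 1; rewrite <- Cmod_mult.
    replace ((r / 2)%R * f' a) with (f (a + (r / 2)%R) - f a
      - (f (a + (r / 2)%R) - f a - (r / 2)%R * f' a)) by ring.
    eapply Rle_trans; [apply Cmod_triangle|]; rewrite Cmod_opp.
    apply Rplus_le_compat; [|exact HQ].
    eapply Rle_trans; [apply Cmod_triangle|]; rewrite Cmod_opp; lra. }
  apply Rmult_le_reg_l with (r / 2)%R; [lra|].
  eapply Rle_trans; [exact Hb3|].
  replace (r / 2 * ((K + (K * r / 2 + 4 / r)) * M))%R
    with (2 * M + K * M * (r / 2 * (r / 2)) + r / 2 * K * M)%R by (field; lra).
  assert (0 <= r / 2 * K * M)%R by (repeat apply Rmult_le_pos; lra); lra.
- intros h Hh; eapply Rle_trans; [now apply HQ|].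
  apply Rmult_le_compat_r; [apply Rmult_le_pos; apply Cmod_ge_0|].
  apply Rmult_le_compat_r; lra.
Qed.

Lemma Cseries_scal (c : C) (a : nat -> C) (l : C) :
  Cseries a l -> Cseries (fun n => c * a n) (c * l).
Proof. exact (is_series_scal (K := C_AbsRing) (V := C_NormedModule) c a l). Qed.

Lemma Cseries_minus (a b : nat -> C) (l m : C) :
  Cseries a l -> Cseries b m -> Cseries (fun n => a n - b n) (l - m).
Proof. exact (is_series_minus (K := C_AbsRing) (V := C_NormedModule) a b l m). Qed.

Lemma Cseries_ext (a b : nat -> C) (l : C) : (forall n, a n = b n) -> Cseries a l -> Cseries b l.
Proof. exact (is_series_ext (K := C_AbsRing) (V := C_NormedModule) a b l). Qed.

(** Differentiation at the centre of a disc on which the series is dominated: the remainders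
    of the first order expansions are bounded by [K M_n |h|^2] and can be summed. *)
Theorem Weierstrass_series (f f' : nat -> C -> C) (F : C -> C) (a : C) (r : R) (M : nat -> R) :
  (0 < r)%R -> (forall n z, is_Cderive (f n) z (f' n z)) ->
  (forall n (w : C), (Cmod (w - a) <= r)%R -> (Cmod (f n w) <= M n)%R) -> ex_series M ->
  (forall w : C, (Cmod (w - a) <= r)%R -> Cseries (fun n => f n w) (F w)) ->
  exists l, is_Cderive F a l /\ Cseries (fun n => f' n a) l.
Proof.
intros Hr Hf HM HS HF.
destruct (cauchy_estimate r Hr) as [K [HK H]].
assert (HKM : ex_series (fun n => K * M n)%R)
  by (apply (ex_series_scal (V := R_NormedModule) K M HS)).
destruct (Cseries_le (fun n => f' n a) (fun n => K * M n)%R) as [l [Hl _]].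
{ intros n; exact (proj1 (H (f n) (f' n) a (M n) (Hf n) (HM n))). }
{ exact HKM. }
assert (Ha : Cmod (a - a) = 0%R) by (replace (a - a) with (RtoC 0) by ring; apply Cmod_0).
exists l; split; [|exact Hl].
assert (HS0 : (0 <= Series M)%R).
{ apply Rle_trans with (sum_n M 0).
  - rewrite sum_O; eapply Rle_trans; [apply Cmod_ge_0 | apply (HM O a); lra].
  - apply sum_n_le_Series; auto.
    intros k; eapply Rle_trans; [apply Cmod_ge_0 | apply (HM k a); lra]. }
apply is_Cderive_of_second_order with (K * Series M)%R (r / 2)%R; [lra | now apply Rmult_le_pos|].
intros h Hh.
assert (Hs : Cseries (fun n => f n (a + h) - f n a - h * f' n a) (F (a + h) - F a - h * l)).
{ apply Cseries_minus; [apply Cseries_minus | now apply Cseries_scal]; apply HF; [|lra].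
  replace (a + h - a) with h by ring; lra. }
destruct (Cseries_le (fun n => f n (a + h) - f n a - h * f' n a)
  (fun n => (Cmod h * Cmod h * K) * M n)%R) as [l' [Hl' Hb]].
- intros n; replace (Cmod h * Cmod h * K * M n)%R with (K * M n * (Cmod h * Cmod h))%R by ring.
  apply (proj2 (H (f n) (f' n) a (M n) (Hf n) (HM n))); exact Hh.
- apply (ex_series_scal (V := R_NormedModule) (Cmod h * Cmod h * K)%R M HS).
- rewrite (Cseries_unique _ _ _ Hs Hl').
  rewrite Series_scal_l in Hb; eapply Rle_trans; [exact Hb|]; right; ring.
Qed.

(** * The reciprocal of Gamma as an entire function *)

Lemma is_lim_seq_inv_INR_S : is_lim_seq (fun n => / INR (S n))%R 0%R.
Proof.
apply (is_lim_seq_incr_1 (fun n => / INR n)%R).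
apply (is_lim_seq_inv INR p_infty); [apply is_lim_seq_INR | discriminate].
Qed.

Lemma ex_series_inv_square : ex_series (fun n => / (INR (S n) * INR (S n)))%R.
Proof.
(* Comparison with the telescoping series of [2 / ((n+1)(n+2))]. *)
assert (Ht : ex_series (fun n => 2 * (/ INR (S n) - / INR (S (S n))))%R).
{ exists 2%R.
  set (b := fun n => (2 * (/ INR (S n) - / INR (S (S n))))%R).
  assert (E : forall n, (2 - 2 * / INR (S (S n)))%R = sum_n b n).
  { induction n as [|n IH]; [rewrite sum_O; unfold b; simpl; field|].
    rewrite sum_Sn, <- IH; unfold b, plus.
    change (2 - 2 * / INR (S (S (S n))) =
        (2 - 2 * / INR (S (S n))) + 2 * (/ INR (S (S n)) - / INR (S (S (S n)))))%R.
    ring. }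
  change (is_lim_seq (sum_n b) 2%R).
  apply (is_lim_seq_ext _ _ _ E).
  replace (Finite 2) with (Finite (2 - 2 * 0)) by (f_equal; ring).
  apply is_lim_seq_minus'; [apply is_lim_seq_const|].
  apply is_lim_seq_mult'; [apply is_lim_seq_const|].
  apply (is_lim_seq_incr_1 (fun n => / INR (S n))%R), is_lim_seq_inv_INR_S. }
apply (ex_series_le (K := R_AbsRing) (V := R_CompleteNormedModule)) with (2 := Ht).
intros n; change (Rabs (/ (INR (S n) * INR (S n))) <= 2 * (/ INR (S n) - / INR (S (S n))))%R.
assert (Hn : (1 <= INR (S n))%R) by (rewrite S_INR; generalize (pos_INR n); lra).
rewrite Rabs_pos_eq by (left; apply Rinv_0_lt_compat; nra).
rewrite (S_INR (S n)); set (x := INR (S n)) in *.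
replace (2 * (/ x - / (x + 1)))%R with (2 * / (x * (x + 1)))%R by (field; lra).
replace (2 * / (x * (x + 1)))%R with (/ (x * (x + 1) / 2))%R by (field; lra).
apply Rinv_le_contravar; nra.
Qed.

Lemma ln_le_sub_one (y : R) : (0 < y)%R -> (ln y <= y - 1)%R.
Proof.
intros Hy; rewrite <- (ln_exp (y - 1)); apply ln_le; [exact Hy|].
generalize (exp_ineq1_le (y - 1)); lra.
Qed.

Lemma ln_one_plus_bounds (u : R) : (0 < u)%R ->
  (0 <= ln (1 + u) <= u)%R /\ (Rabs (u - ln (1 + u)) <= u * u)%R.
Proof.
intros Hu.
assert (H1 := ln_le_sub_one (1 + u) ltac:(lra)).
assert (H2 : (u / (1 + u) <= ln (1 + u))%R).
{ replace (ln (1 + u)) with (- ln (/ (1 + u)))%R by (rewrite ln_Rinv by lra; ring).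
  assert (H3 := ln_le_sub_one (/ (1 + u)) ltac:(apply Rinv_0_lt_compat; lra)).
  replace (u / (1 + u))%R with (- (/ (1 + u) - 1))%R by (field; lra); lra. }
assert (H0 : (0 < u / (1 + u))%R) by (apply Rdiv_lt_0_compat; lra).
split; [lra|].
rewrite Rabs_pos_eq by lra.
apply Rle_trans with (u - u / (1 + u))%R; [lra|].
replace (u - u / (1 + u))%R with (u * u * / (1 + u))%R by (field; lra).
rewrite <- (Rmult_1_r (u * u)) at 2; apply Rmult_le_compat_l; [nra|].
rewrite <- Rinv_1; apply Rinv_le_contravar; lra.
Qed.

Definition gamma_factor (n : nat) (z : C) : C :=
  (1 + z * (/ INR (S n))%R) * Cexp (- (z * ln (1 + / INR (S n)))).

(** [(n + 1)^(- z)] times the product of the [1 + z / k] for [1 <= k <= n], which tends to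
    [1 / Gamma (1 + z)]. The power is distributed over the factors so as to make each of
    them [1 + O(1 / n^2)]. *)
Fixpoint gamma_prod (n : nat) (z : C) : C :=
  match n with O => 1 | S m => gamma_prod m z * gamma_factor m z end.

Lemma inv_INR_S_bounds (n : nat) : (0 < / INR (S n) <= 1)%R.
Proof.
assert (Hn : (1 <= INR (S n))%R) by (rewrite S_INR; generalize (pos_INR n); lra).
split; [apply Rinv_0_lt_compat; lra | rewrite <- Rinv_1; apply Rinv_le_contravar; lra].
Qed.

(** When [B / (n + 1)] is at most [1/2], expand the exponential to second order: the first
    order terms nearly cancel because [ln (1 + u) = u + O(u^2)]. Otherwise
    [1 <= 4 B^2 / (n + 1)^2] and any bound on the factor will do. *)
Lemma gamma_factor_bound (B : R) : (0 <= B)%R -> exists K, (0 <= K)%R /\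
  forall n (z : C), (Cmod z <= B)%R ->
    (Cmod (gamma_factor n z - 1) <= K * / (INR (S n) * INR (S n)))%R.
Proof.
intros HB.
set (K1 := (B + B * B + (1 + B) * (6 * (B * B)))%R).
set (K2 := (((1 + B) * exp B + 1) * (4 * (B * B)))%R).
assert (HBB : (0 <= B * B)%R) by (now apply Rmult_le_pos).
assert (HeB := exp_pos B).
assert (HK1 : (0 <= K1)%R).
{ unfold K1; repeat apply Rplus_le_le_0_compat; auto; apply Rmult_le_pos; lra. }
assert (HK2 : (0 <= K2)%R).
{ unfold K2; apply Rmult_le_pos; [|lra].
  apply Rplus_le_le_0_compat; [apply Rmult_le_pos|]; lra. }
exists (K1 + K2)%R; split; [lra|]; intros n z Hz.
assert (Hu := inv_INR_S_bounds n).
rewrite Rinv_mult; unfold gamma_factor; set (u := (/ INR (S n))%R) in *.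
destruct (ln_one_plus_bounds u (proj1 Hu)) as [HL1 HL2]; set (L := ln (1 + u)) in *.
assert (Hz0 := Cmod_ge_0 z).
assert (Huu : (0 <= u * u)%R) by (apply Rmult_le_pos; lra).
assert (HzL : (Cmod (- (z * L)) <= B * u)%R).
{ rewrite Cmod_opp, Cmod_mult, Cmod_R, Rabs_pos_eq by lra; apply Rmult_le_compat; lra. }
assert (Hzu : (Cmod (1 + z * u) <= 1 + B)%R).
{ eapply Rle_trans; [apply Cmod_triangle|].
  rewrite Cmod_1, Cmod_mult, Cmod_R, Rabs_pos_eq by lra.
  apply Rplus_le_compat_l; rewrite <- (Rmult_1_r B); apply Rmult_le_compat; lra. }
destruct (Rle_dec (B * u) (/ 2)) as [Hs|Hs].
- assert (Hr := Cexp_second_order (- (z * L)) ltac:(lra)).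
  set (rem := Cexp (- (z * L)) - 1 - - (z * L)) in *.
  replace ((1 + z * u) * Cexp (- (z * L)) - 1)
    with (z * (u - L) + - (z * u * (z * L)) + (1 + z * u) * rem) by (unfold rem; ring).
  apply Rle_trans with (K1 * (u * u))%R; [|apply Rmult_le_compat_r; lra].
  unfold K1; rewrite !Rmult_plus_distr_r with (r3 := (u * u)%R).
  eapply Rle_trans; [apply Cmod_triangle | apply Rplus_le_compat;
    [eapply Rle_trans; [apply Cmod_triangle | apply Rplus_le_compat]|]].
  + rewrite Cmod_mult, <- RtoC_minus, Cmod_R; apply Rmult_le_compat; auto using Rabs_pos.
  + rewrite Cmod_opp, !Cmod_mult, !Cmod_R, !Rabs_pos_eq by lra.
    replace (B * B * (u * u))%R with ((B * u) * (B * u))%R by ring.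
    apply Rmult_le_compat; try (apply Rmult_le_pos; lra); apply Rmult_le_compat; lra.
  + rewrite Cmod_mult, Rmult_assoc; apply Rmult_le_compat; auto using Cmod_ge_0.
    eapply Rle_trans; [exact Hr|]; rewrite Rmult_assoc; apply Rmult_le_compat_l; [lra|].
    replace (B * B * (u * u))%R with ((B * u) * (B * u))%R by ring.
    apply Rmult_le_compat; auto using Cmod_ge_0.
(* Here [2 B u > 1], which leaves finitely many factors. *)
- apply Rle_trans with (K2 * (u * u))%R; [|apply Rmult_le_compat_r; lra].
  apply Rle_trans with (((1 + B) * exp B + 1) * 1)%R.
  + rewrite Rmult_1_r.
    eapply Rle_trans; [apply Cmod_triangle|]; rewrite Cmod_opp, Cmod_1.
    apply Rplus_le_compat_r; rewrite Cmod_mult.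
    apply Rmult_le_compat; auto using Cmod_ge_0.
    rewrite Cmod_Cexp.
    assert (Hre : (Re (- (z * L)) <= B)%R).
    { eapply Rle_trans; [apply Rle_abs|]; eapply Rle_trans; [apply re_le_Cmod|].
      eapply Rle_trans; [exact HzL|].
      rewrite <- (Rmult_1_r B) at 2; apply Rmult_le_compat_l; lra. }
    destruct Hre as [Hre|Hre]; [left; now apply exp_increasing | rewrite Hre; lra].
  + unfold K2; rewrite Rmult_assoc; apply Rmult_le_compat_l.
    * apply Rplus_le_le_0_compat; [apply Rmult_le_pos|]; lra.
    * replace (4 * (B * B) * (u * u))%R with (4 * ((B * u) * (B * u)))%R by ring. nra.
Qed.

Lemma ex_series_scal_inv_square (K : R) : ex_series (fun n => K * / (INR (S n) * INR (S n)))%R.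
Proof. apply (ex_series_scal (V := R_NormedModule)), ex_series_inv_square. Qed.

Lemma scal_inv_square_ge_0 (K : R) (n : nat) :
  (0 <= K)%R -> (0 <= K * / (INR (S n) * INR (S n)))%R.
Proof.
intros HK; apply Rmult_le_pos; auto; rewrite Rinv_mult.
generalize (inv_INR_S_bounds n); intros; apply Rmult_le_pos; lra.
Qed.

(** Used for the partial products themselves and for their inverses, to keep the limit away
    from 0. *)
Lemma one_plus_prod_bound (a b : nat -> R) :
  (forall n, (0 <= b n)%R) -> ex_series b ->
  (forall n, (0 <= a n)%R) -> (forall n, (a (S n) <= a n * (1 + b n))%R) ->
  forall n, (a n <= a O * exp (Series b))%R.
Proof.
intros Hb Hs Ha H.
assert (H1 : forall n, (a (S n) <= a O * exp (sum_n b n))%R).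
{ induction n as [|n IH].
  - rewrite sum_O; eapply Rle_trans; [apply H|].
    apply Rmult_le_compat_l; [auto | apply exp_ineq1_le].
  - eapply Rle_trans; [apply H|]; rewrite sum_Sn; unfold plus; simpl.
    rewrite exp_plus, <- Rmult_assoc.
    apply Rmult_le_compat; auto; [|apply exp_ineq1_le].
    specialize (Hb (S n)); lra. }
assert (HS : forall n, (exp (sum_n b n) <= exp (Series b))%R).
{ intros n; destruct (sum_n_le_Series b n Hb Hs) as [Hl|He];
    [left; now apply exp_increasing | rewrite He; lra]. }
intros [|n].
- rewrite <- (Rmult_1_r (a O)) at 1; apply Rmult_le_compat_l; auto.
  rewrite <- exp_0; assert (H0 : (0 <= Series b)%R).
  { apply Rle_trans with (sum_n b 0); [rewrite sum_O; auto | now apply sum_n_le_Series]. }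
  destruct H0 as [Hl|He]; [left; now apply exp_increasing | rewrite <- He; lra].
- eapply Rle_trans; [apply H1 | apply Rmult_le_compat_l; auto].
Qed.

Lemma gamma_prod_increment (B : R) : (0 <= B)%R -> exists b : nat -> R, ex_series b /\
  forall n (z : C), (Cmod z <= B)%R -> (Cmod (gamma_prod (S n) z - gamma_prod n z) <= b n)%R.
Proof.
intros HB; destruct (gamma_factor_bound B HB) as [K [HK H]].
set (b := fun n => (K * / (INR (S n) * INR (S n)))%R).
assert (Hb : ex_series b) by apply ex_series_scal_inv_square.
assert (Hb0 : forall n, (0 <= b n)%R) by (intros n; now apply scal_inv_square_ge_0).
exists (fun n => exp (Series b) * b n)%R; split.
{ now apply (ex_series_scal (V := R_NormedModule)). }
intros n z Hz; simpl.
replace (gamma_prod n z * gamma_factor n z - gamma_prod n z)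
  with (gamma_prod n z * (gamma_factor n z - 1)) by ring.
rewrite Cmod_mult; apply Rmult_le_compat; auto using Cmod_ge_0.
rewrite <- (Rmult_1_l (exp _)); rewrite <- Cmod_1.
apply (one_plus_prod_bound (fun n => Cmod (gamma_prod n z)) b); auto using Cmod_ge_0.
intros m; simpl; rewrite Cmod_mult; apply Rmult_le_compat_l; [apply Cmod_ge_0|].
replace (gamma_factor m z) with (1 + (gamma_factor m z - 1)) by ring.
eapply Rle_trans; [apply Cmod_triangle|]; rewrite Cmod_1; apply Rplus_le_compat_l; now apply H.
Qed.

(** The entire function [1 / Gamma (1 + z)]. *)
Definition gamma_recip (z : C) : C := C_Lim_seq (fun n => gamma_prod n z).

Lemma gamma_prod_lim (z : C) : is_Clim_seq (fun n => gamma_prod n z) (gamma_recip z).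
Proof.
destruct (gamma_prod_increment (Cmod z) (Cmod_ge_0 z)) as [b [Hb H]].
destruct (Clim_seq_of_increments (fun n => gamma_prod n z) b) as [l [Hl _]]; auto.
{ intros n; apply H; lra. }
unfold gamma_recip; now rewrite (C_Lim_seq_unique _ l Hl).
Qed.

Lemma gamma_recip_0 : gamma_recip 0 = 1.
Proof.
apply C_Lim_seq_unique, is_Clim_seq_ext with (fun _ => RtoC 1); [|apply is_Clim_seq_const].
intros n; induction n as [|n IH]; [reflexivity|]; simpl; rewrite <- IH; unfold gamma_factor.
replace (- (0 * ln (1 + / INR (S n)))) with (RtoC 0) by ring; rewrite Cexp_0; ring.
Qed.

Lemma RtoC_INR_S_neq_0 (n : nat) : RtoC (INR (S n)) <> 0.
Proof. intros E; apply RtoC_inj in E; now apply (not_0_INR (S n)). Qed.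

Lemma gamma_factor_neq_0 (n : nat) (z : C) :
  z <> - RtoC (INR (S n)) -> gamma_factor n z <> 0.
Proof.
intros Hz; apply Cmult_neq_0; [|apply Cexp_neq_0].
assert (Hn := RtoC_INR_S_neq_0 n).
rewrite RtoC_inv by (apply not_0_INR; discriminate).
intros E; apply Hz.
replace z with ((1 + z * / INR (S n)) * INR (S n) - INR (S n)) by (field; exact Hn).
rewrite E; ring.
Qed.

Lemma gamma_prod_neq_0 (z : C) (n : nat) :
  (forall k, z <> - RtoC (INR (S k))) -> gamma_prod n z <> 0.
Proof.
intros Hz; induction n as [|n IH]; [apply C1_nz | apply Cmult_neq_0; auto using gamma_factor_neq_0].
Qed.

(** From some index on the factors are within [b n <= 1/2] of 1, so their inverses are at
    most [1 + 2 b n] and the inverses of the partial products stay bounded. *)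
Lemma gamma_recip_neq_0 (z : C) :
  (forall n, z <> - RtoC (INR (S n))) -> gamma_recip z <> 0.
Proof.
intros Hz.
assert (Hp := fun n => gamma_prod_neq_0 z n Hz).
destruct (gamma_factor_bound (Cmod z) (Cmod_ge_0 z)) as [K [HK H]].
set (b := fun n => (K * / (INR (S n) * INR (S n)))%R).
assert (Hb : ex_series b) by apply ex_series_scal_inv_square.
assert (Hb0 : forall n, (0 <= b n)%R) by (intros n; now apply scal_inv_square_ge_0).
assert (Hbl := ex_series_lim_0 b Hb).
apply is_lim_seq_spec in Hbl; destruct (Hbl (mkposreal (/ 2) ltac:(lra))) as [N HN]; simpl in HN.
assert (Hb2 : ex_series (fun n => 2 * b (N + n)%nat)%R).
{ apply (ex_series_scal (V := R_NormedModule) 2%R (fun n => b (N + n)%nat)).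
  now apply -> (ex_series_incr_n (V := R_NormedModule) b N). }
set (T := (/ Cmod (gamma_prod N z) * exp (Series (fun n => 2 * b (N + n)%nat)))%R).
assert (HT : (0 < T)%R).
{ apply Rmult_lt_0_compat; [apply Rinv_0_lt_compat, Cmod_gt_0, Hp | apply exp_pos]. }
assert (Hle : forall n, (/ Cmod (gamma_prod (N + n) z) <= T)%R).
{ intros n.
  replace (/ Cmod (gamma_prod (N + n) z))%R with ((fun n => / Cmod (gamma_prod (N + n) z))%R n)
    by reflexivity.
  eapply Rle_trans; [apply (one_plus_prod_bound (fun n => / Cmod (gamma_prod (N + n) z))%R
    (fun n => 2 * b (N + n)%nat)%R); auto|].
  - intros k; specialize (Hb0 (N + k)%nat); lra.
  - intros k; left; apply Rinv_0_lt_compat, Cmod_gt_0, Hp.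
  - intros k; rewrite Nat.add_succ_r; simpl; rewrite Cmod_mult, Rinv_mult.
    apply Rmult_le_compat_l; [left; apply Rinv_0_lt_compat, Cmod_gt_0, Hp|].
    assert (Hk := H (N + k)%nat z (Rle_refl _)); fold (b (N + k)%nat) in Hk.
    specialize (HN (N + k)%nat ltac:(lia)); rewrite Rminus_0_r, Rabs_pos_eq in HN by auto.
    specialize (Hb0 (N + k)%nat); set (x := b (N + k)%nat) in *.
    assert (Hq : (1 - x <= Cmod (gamma_factor (N + k) z))%R).
    { assert (Ht := Cmod_minus_triangle 1 (gamma_factor (N + k) z) 0).
      replace (1 - 0) with (RtoC 1) in Ht by ring.
      replace (gamma_factor (N + k) z - 0) with (gamma_factor (N + k) z) in Ht by ring.
      rewrite Cmod_1, Cmod_minus_sym in Ht; lra. }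
    apply Rle_trans with (/ (1 - x))%R; [apply Rinv_le_contravar; lra|].
    apply Rmult_le_reg_r with (1 - x)%R; [lra|]; rewrite Rinv_l by lra; nra.
  - unfold T; rewrite Nat.add_0_r; lra. }
intros E0.
assert (Hl := gamma_prod_lim z); rewrite E0 in Hl.
apply is_Clim_seq_eps with (eps := (/ T)%R) in Hl; [|now apply Rinv_0_lt_compat].
destruct Hl as [N' HN']; specialize (HN' (N + N')%nat ltac:(lia)); specialize (Hle N').
replace (gamma_prod (N + N') z - 0) with (gamma_prod (N + N') z) in HN' by ring.
assert (Hpp : (0 < Cmod (gamma_prod (N + N') z))%R) by (apply Cmod_gt_0, Hp).
apply Rinv_le_contravar in Hle; [|now apply Rinv_0_lt_compat].
rewrite Rinv_inv in Hle; lra.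
Qed.

Lemma gamma_recip_neg_INR (n : nat) : gamma_recip (- RtoC (INR (S n))) = 0.
Proof.
apply C_Lim_seq_unique, is_Clim_seq_ext_loc with (fun _ => RtoC 0); [|apply is_Clim_seq_const].
exists (S n); intros m Hm; induction Hm as [|m Hm IH].
- set (w := - RtoC (INR (S n))); change (RtoC 0 = gamma_prod n w * gamma_factor n w).
  unfold gamma_factor; rewrite RtoC_inv by (apply not_0_INR; discriminate).
  replace (1 + w * / INR (S n)) with (RtoC 0); [ring|].
  unfold w; field; apply RtoC_INR_S_neq_0.
- cbn [gamma_prod]; rewrite <- IH; ring.
Qed.

Lemma is_Cderive_affine (a b z : C) : is_Cderive (fun w => a + w * b) z b.
Proof.
apply is_Cderive_eps; intros eps Heps; exists 1%R; split; [lra|]; intros w _.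
replace (a + w * b - (a + z * b) - (w - z) * b) with (RtoC 0) by ring.
rewrite Cmod_0; apply Rmult_le_pos; [lra | apply Cmod_ge_0].
Qed.

Lemma is_Cderive_Cexp_lin (c z : C) : is_Cderive (fun w => Cexp (- (w * c))) z (- c * Cexp (- (z * c))).
Proof.
apply (is_Cderive_comp Cexp (fun w => - (w * c))); [apply is_Cderive_Cexp|].
apply (is_Cderive_ext (fun w => 0 + w * - c)); [intros w; ring | apply is_Cderive_affine].
Qed.

Definition gamma_factor' (n : nat) (z : C) : C :=
  (/ INR (S n))%R * Cexp (- (z * ln (1 + / INR (S n))))
  + (1 + z * (/ INR (S n))%R) * (- ln (1 + / INR (S n)) * Cexp (- (z * ln (1 + / INR (S n))))).

Lemma is_Cderive_gamma_factor (n : nat) (z : C) : is_Cderive (gamma_factor n) z (gamma_factor' n z).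
Proof.
apply (is_Cderive_mult (fun w => 1 + w * (/ INR (S n))%R)
  (fun w => Cexp (- (w * ln (1 + / INR (S n)))))).
- apply is_Cderive_affine.
- apply is_Cderive_Cexp_lin.
Qed.

Fixpoint gamma_prod' (n : nat) (z : C) : C :=
  match n with
  | O => 0
  | S m => gamma_prod' m z * gamma_factor m z + gamma_prod m z * gamma_factor' m z
  end.

Lemma is_Cderive_gamma_prod (n : nat) (z : C) : is_Cderive (gamma_prod n) z (gamma_prod' n z).
Proof.
induction n as [|n IH]; [apply is_Cderive_const|].
apply (is_Cderive_mult (gamma_prod n) (gamma_factor n)); [exact IH | apply is_Cderive_gamma_factor].
Qed.

(** Weierstrass' theorem for the telescoping series of the products. *)
Lemma is_Cderive_gamma_recip (z : C) : exists l,
  is_Cderive gamma_recip z l /\ is_Clim_seq (fun n => gamma_prod' n z) l.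
Proof.
destruct (gamma_prod_increment (Cmod z + 1)) as [b [Hb H]]; [generalize (Cmod_ge_0 z); lra|].
destruct (Weierstrass_series (fun n w => gamma_prod (S n) w - gamma_prod n w)
  (fun n w => gamma_prod' (S n) w - gamma_prod' n w) (fun w => gamma_recip w - 1) z 1 b)
  as [l [Hl1 Hl2]].
- lra.
- intros n w; apply is_Cderive_minus; apply is_Cderive_gamma_prod.
- intros n w Hw; apply H.
  assert (Ht := Cmod_minus_triangle w z 0).
  replace (w - 0) with w in Ht by ring; replace (z - 0) with z in Ht by ring; lra.
- exact Hb.
- intros w _.
  apply (Cseries_telescope (fun n => gamma_prod n w)).
  replace (gamma_prod 0 w + (gamma_recip w - 1)) with (gamma_recip w) by (simpl; ring).
  apply gamma_prod_lim.
- exists l; split.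
  + apply (is_Cderive_ext (fun w => (gamma_recip w - 1) + 1)); [intros w; ring|].
    replace l with (l + 0) by ring; apply is_Cderive_plus; [exact Hl1 | apply is_Cderive_const].
  + apply (Cseries_telescope (fun n => gamma_prod' n z)) in Hl2.
    replace (gamma_prod' 0 z + l) with l in Hl2 by (simpl; ring); exact Hl2.
Qed.

Lemma entire_gamma_recip : entire gamma_recip.
Proof. intros z; destruct (is_Cderive_gamma_recip z) as [l [Hl _]]; exists l; exact Hl. Qed.

(** The logarithmic derivative of [gamma_prod (S n)] at [z]. *)
Definition gamma_logder (z : C) (n : nat) : C :=
  Csum (fun k => / (INR (S k) + z)) n - ln (INR (S (S n))).

Lemma ln_one_plus_inv (n : nat) : ln (1 + / INR (S n)) = (ln (INR (S (S n))) - ln (INR (S n)))%R.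
Proof.
assert (Hn : (0 < INR (S n))%R) by (apply lt_0_INR; lia).
rewrite <- ln_div; [|apply lt_0_INR; lia | exact Hn].
f_equal; rewrite (S_INR (S n)); field; lra.
Qed.

Lemma gamma_prod'_logder (z : C) (n : nat) : (forall k, z <> - RtoC (INR (S k))) ->
  gamma_prod' (S n) z = gamma_prod (S n) z * gamma_logder z n.
Proof.
intros Hz.
assert (Hf : forall m, gamma_factor' m z =
  gamma_factor m z * (/ (INR (S m) + z) - (ln (INR (S (S m))) - ln (INR (S m)))%R)).
{ intros m; unfold gamma_factor', gamma_factor.
  assert (Hm := RtoC_INR_S_neq_0 m).
  assert (Hmz : INR (S m) + z <> 0).
  { intros E; apply (Hz m); replace z with (INR (S m) + z - INR (S m)) by ring; rewrite E; ring. }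
  rewrite <- ln_one_plus_inv, RtoC_inv by (apply not_0_INR; discriminate).
  field; auto. }
induction n as [|n IH].
- cbn [gamma_prod gamma_prod']; rewrite Hf; unfold gamma_logder; rewrite Csum_O.
  replace (INR 1) with 1%R by reflexivity; rewrite ln_1, Rminus_0_r; ring.
- change (gamma_prod' (S n) z * gamma_factor (S n) z + gamma_prod (S n) z * gamma_factor' (S n) z
    = gamma_prod (S n) z * gamma_factor (S n) z * gamma_logder z (S n)).
  rewrite IH, Hf; unfold gamma_logder; rewrite Csum_S, RtoC_minus; ring.
Qed.

Lemma is_lim_seq_ln_step : is_lim_seq (fun n => ln (1 + / INR (S n))) 0%R.
Proof.
apply is_lim_seq_le_le with (fun _ => 0%R) (fun n => / INR (S n))%R.
- intros n; generalize (inv_INR_S_bounds n); intros H.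
  destruct (ln_one_plus_bounds (/ INR (S n))) as [H1 _]; lra.
- apply is_lim_seq_const.
- apply is_lim_seq_inv_INR_S.
Qed.

Lemma gamma_logder_lim (z : C) : (forall k, z <> - RtoC (INR (S k))) -> exists l,
  is_Cderive gamma_recip z (gamma_recip z * l) /\ is_Clim_seq (gamma_logder z) l.
Proof.
intros Hz; destruct (is_Cderive_gamma_recip z) as [l [Hl1 Hl2]].
assert (H0 := gamma_recip_neq_0 z Hz).
assert (Hp := fun n => gamma_prod_neq_0 z n Hz).
exists (l / gamma_recip z); split.
- replace (gamma_recip z * (l / gamma_recip z)) with l by (field; exact H0); exact Hl1.
- apply is_Clim_seq_ext with (fun n => gamma_prod' (n + 1)%nat z * / gamma_prod (n + 1)%nat z).
  { intros n; rewrite Nat.add_1_r, gamma_prod'_logder by exact Hz; field; apply Hp. }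
  apply is_Clim_seq_mult; [now apply (is_Clim_seq_incr_n (fun n => gamma_prod' n z) 1)|].
  apply (is_Clim_seq_incr_n (fun n => / gamma_prod n z) 1).
  apply (is_Clim_seq_continuous Cinv); [|apply gamma_prod_lim].
  exact (is_Cderive_continuous _ _ _ (is_Cderive_inv_id _ H0)).
Qed.

Lemma Csum_RtoC (u : nat -> R) (n : nat) : Csum (fun k => RtoC (u k)) n = RtoC (sum_n u n).
Proof.
induction n as [|n IH]; [now rewrite Csum_O, sum_O|].
rewrite Csum_S, sum_Sn, IH; unfold plus; simpl; now rewrite RtoC_plus.
Qed.

(** At the origin the logarithmic derivatives are the harmonic sums minus logarithms that
    define Euler's constant, up to the shift of the logarithm by one index. *)
Lemma is_Cderive_gamma_recip_0 : is_Cderive gamma_recip 0 euler_gamma.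
Proof.
assert (Hz : forall k, RtoC 0 <> - RtoC (INR (S k))).
{ intros k E; rewrite <- RtoC_opp in E; apply RtoC_inj in E.
  generalize (lt_0_INR (S k)); intros H; specialize (H (Nat.lt_0_succ k)); lra. }
destruct (gamma_logder_lim 0 Hz) as [l [Hl1 Hl2]].
rewrite gamma_recip_0, Cmult_1_l in Hl1.
replace (RtoC euler_gamma) with l; [exact Hl1|].
set (u := fun n => (sum_n (fun k => / INR (S k)) n - ln (INR (S n)))%R).
assert (Hu : is_Clim_seq (fun n => RtoC (u n)) l).
{ replace l with (l + 0%R) by ring.
  apply is_Clim_seq_ext with (fun n => gamma_logder 0 n + RtoC (ln (1 + / INR (S n)))).
  - intros n; unfold gamma_logder, u; rewrite ln_one_plus_inv, !RtoC_minus, <- Csum_RtoC.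
    replace (Csum (fun k => / (INR (S k) + 0)) n) with (Csum (fun k => (/ INR (S k))%R) n); [ring|].
    apply sum_n_ext; intros k; rewrite RtoC_inv by (apply not_0_INR; discriminate).
    f_equal; ring.
  - apply is_Clim_seq_plus; [exact Hl2 | apply is_Clim_seq_RtoC, is_lim_seq_ln_step]. }
assert (E := C_Lim_seq_unique _ _ Hu); unfold C_Lim_seq in E.
rewrite <- E; unfold euler_gamma, RtoC; simpl; f_equal.
rewrite Lim_seq_const; reflexivity.
Qed.

(** * Gamma and digamma *)

Lemma Clog_RtoC (x : R) : (0 < x)%R -> Clog x = ln x.
Proof.
intros Hx; unfold Clog, Carg, RtoC; simpl.
destruct (Rle_dec 0 0) as [_|H]; [|lra].
change (x, 0%R) with (RtoC x); rewrite Cmod_R, Rabs_pos_eq by lra.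
replace (x / x)%R with 1%R by (field; lra); now rewrite acos_1.
Qed.

Lemma Cpower_RtoC (x : R) (z : C) : (0 < x)%R -> Cpower x z = Cexp (z * ln x).
Proof. intros Hx; unfold Cpower; now rewrite Clog_RtoC. Qed.

(** Relates the product to the denominators of Gauss' limit. *)
Lemma gamma_prod_rising (n : nat) (z : C) :
  rising z (S (S n)) * Cexp (- (z * ln (INR (S (S n))))) =
  z * RtoC (INR (fact (S n))) * gamma_prod (S n) z.
Proof.
induction n as [|n IH].
- cbn [rising gamma_prod]; unfold gamma_factor; simpl INR.
  replace (1 + / 1)%R with (1 + 1)%R by field; rewrite Rinv_1; simpl; ring.
- assert (Hn := RtoC_INR_S_neq_0 (S n)).
  change (rising z (S (S (S n)))) with (rising z (S (S n)) * (z + RtoC (INR (S (S n))))).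
  change (gamma_prod (S (S n)) z) with (gamma_prod (S n) z * gamma_factor (S n) z).
  unfold gamma_factor; rewrite ln_one_plus_inv, RtoC_inv by (apply not_0_INR; discriminate).
  replace (Cexp (- (z * ln (INR (S (S (S n)))))))
    with (Cexp (- (z * ln (INR (S (S n)))))
          * Cexp (- (z * (ln (INR (S (S (S n)))) - ln (INR (S (S n))))%R))).
  2:{ rewrite <- Cexp_plus; f_equal; rewrite RtoC_minus; ring. }
  set (e := Cexp (- (z * (ln (INR (S (S (S n)))) - ln (INR (S (S n))))%R))).
  replace (rising z (S (S n)) * (z + INR (S (S n))) * (Cexp (- (z * ln (INR (S (S n))))) * e))
    with ((rising z (S (S n)) * Cexp (- (z * ln (INR (S (S n)))))) * ((z + INR (S (S n))) * e)) by ring.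
  rewrite IH.
  replace (INR (fact (S (S n)))) with (INR (S (S n)) * INR (fact (S n)))%R
    by (rewrite <- mult_INR; reflexivity).
  rewrite RtoC_mult; field; exact Hn.
Qed.

Lemma rising_0_ge (z : C) (k n : nat) : z = - RtoC (INR k) -> (k < n)%nat -> rising z n = 0.
Proof.
intros Hz Hn; induction Hn as [|n Hn IH].
- cbn [rising]; rewrite Hz; ring.
- cbn [rising]; rewrite IH; ring.
Qed.

Lemma Cinv_0 : / RtoC 0 = 0.
Proof. unfold Cinv, RtoC; simpl; f_equal; unfold Rdiv; ring. Qed.

Lemma Cinv_involutive (z : C) : / / z = z.
Proof.
destruct (Ceq_dec z 0) as [->|Hz]; [now rewrite !Cinv_0|].
field; exact Hz.
Qed.

Lemma not_nonpos_int_S (z : C) : ~ nonpos_int z -> forall n, z <> - RtoC (INR (S n)).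
Proof. intros Hz n E; apply Hz; now exists (S n). Qed.

Lemma not_nonpos_int_neq_0 (z : C) : ~ nonpos_int z -> z <> 0.
Proof. intros Hz E; apply Hz; exists O; rewrite E; simpl; ring. Qed.

(** Gauss' sequence has [n^z] where [gamma_prod] has [(n + 1)^z], and the ratio tends to 1.
    At the poles of Gamma both sides are 0, by the conventions on division by zero. *)
Lemma CGamma_recip (z : C) : CGamma z = / (z * gamma_recip z).
Proof.
unfold CGamma; apply C_Lim_seq_unique.
destruct (excluded_middle_informative (nonpos_int z)) as [[k Hk]|Hz].
- replace (z * gamma_recip z) with (RtoC 0).
  2:{ destruct k as [|k].
      - rewrite Hk; simpl; ring.
      - rewrite Hk, gamma_recip_neg_INR; ring. }
  rewrite Cinv_0.
  apply is_Clim_seq_ext_loc with (fun _ => RtoC 0); [|apply is_Clim_seq_const].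
  exists k; intros n Hn; rewrite (rising_0_ge z k) by (auto; lia).
  unfold Cdiv; rewrite Cinv_0; ring.
- assert (Hz0 := not_nonpos_int_neq_0 z Hz).
  assert (HzS := not_nonpos_int_S z Hz).
  assert (Hr := gamma_recip_neq_0 z HzS).
  assert (Hp := fun n => gamma_prod_neq_0 z n HzS).
  apply (is_Clim_seq_incr_n _ 1).
  apply is_Clim_seq_ext with
    (fun n => Cexp (- (z * ln (1 + / INR (S n)))) * / (z * gamma_prod (n + 1)%nat z)).
  { intros n; rewrite Nat.add_1_r, Cpower_RtoC by (apply lt_0_INR; lia).
    assert (E := gamma_prod_rising n z).
    assert (Hf : RtoC (INR (fact (S n))) <> 0)
      by (intros E'; apply RtoC_inj in E'; now apply (INR_fact_neq_0 (S n))).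
    set (g := gamma_prod (S n) z) in *.
    assert (Hg : g <> 0) by apply Hp.
    assert (He := Cexp_neq_0 (- (z * ln (INR (S (S n)))))).
    assert (Hris : rising z (S (S n)) <> 0).
    { intros E'; rewrite E' in E.
      apply (Cmult_neq_0 (z * RtoC (INR (fact (S n)))) g); auto using Cmult_neq_0.
      rewrite <- E; ring. }
    rewrite ln_one_plus_inv.
    replace (- (z * (ln (INR (S (S n))) - ln (INR (S n)))%R))
      with (- (z * ln (INR (S (S n)))) + z * ln (INR (S n))) by (rewrite RtoC_minus; ring).
    rewrite Cexp_plus.
    set (e := Cexp (- (z * ln (INR (S (S n)))))) in *; set (p := Cexp (z * ln (INR (S n)))).
    replace (e * p * / (z * g)) with (p * RtoC (INR (fact (S n))) * (e / (z * RtoC (INR (fact (S n))) * g)))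
      by (field; auto).
    rewrite <- E; field; auto. }
  replace (/ (z * gamma_recip z)) with (1 * / (z * gamma_recip z)) by ring.
  apply is_Clim_seq_mult.
  + rewrite <- Cexp_0; replace (Cexp 0) with (Cexp (- (z * 0%R))) by (f_equal; ring).
    apply (is_Clim_seq_continuous (fun x => Cexp (- (z * x))) (fun n => RtoC (ln (1 + / INR (S n))))).
    * apply (is_Cderive_continuous _ _ (- z * Cexp (- (0%R * z)))).
      apply (is_Cderive_ext (fun w => Cexp (- (w * z)))); [intros w; f_equal; ring|].
      apply is_Cderive_Cexp_lin.
    * apply is_Clim_seq_RtoC, is_lim_seq_ln_step.
  + apply (is_Clim_seq_continuous Cinv (fun n => z * gamma_prod (n + 1) z)).
    * eapply is_Cderive_continuous, is_Cderive_inv_id; now apply Cmult_neq_0.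
    * apply is_Clim_seq_mult; [apply is_Clim_seq_const|].
      apply (is_Clim_seq_incr_n (fun n => gamma_prod n z) 1), gamma_prod_lim.
Qed.

Lemma digamma_lim (q : C) : ~ nonpos_int q ->
  is_Clim_seq (fun n => - / q - gamma_logder q n) (digamma q).
Proof.
intros Hq.
assert (Hq0 := not_nonpos_int_neq_0 q Hq); assert (HqS := not_nonpos_int_S q Hq).
assert (Hr := gamma_recip_neq_0 q HqS).
destruct (gamma_logder_lim q HqS) as [l [Hl1 Hl2]].
replace (digamma q) with (- / q - l).
- apply is_Clim_seq_minus; [apply is_Clim_seq_const | exact Hl2].
- unfold digamma; rewrite CGamma_recip.
  rewrite (is_C_derive_unique CGamma q (- ((1 * gamma_recip q + q * (gamma_recip q * l))
    * (/ (q * gamma_recip q) * / (q * gamma_recip q))))).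
  + field; auto.
  + change (is_Cderive CGamma q (- ((1 * gamma_recip q + q * (gamma_recip q * l))
    * (/ (q * gamma_recip q) * / (q * gamma_recip q))))).
    apply (is_Cderive_ext (fun w => / (w * gamma_recip w))).
    { intros w; now rewrite CGamma_recip. }
    apply (is_Cderive_inv (fun w => w * gamma_recip w)); [now apply Cmult_neq_0|].
    apply (is_Cderive_mult (fun w => w) gamma_recip); [apply is_Cderive_id | exact Hl1].
Qed.

(** * Logarithms and powers on the right half-plane *)

Lemma Cmod_sqr (z : C) : (Cmod z * Cmod z = Re z * Re z + Im z * Im z)%R.
Proof. generalize (Cmod2_alt z); simpl; lra. Qed.

Lemma Re_div_Cmod_bounds (w : C) : w <> 0 -> (-1 <= Re w / Cmod w <= 1)%R.
Proof.
intros Hw; assert (Hm := proj1 (Cmod_gt_0 w) Hw).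
assert (H := re_le_Cmod w); apply Rabs_le_between in H.
split; [apply Rle_div_r | apply Rle_div_l]; lra.
Qed.

Lemma Cexp_Clog (w : C) : w <> 0 -> Cexp (Clog w) = w.
Proof.
intros Hw; assert (Hm := proj1 (Cmod_gt_0 w) Hw).
assert (Hb := Re_div_Cmod_bounds w Hw); assert (Hs := Cmod_sqr w).
assert (Hsin : (Cmod w * sin (acos (Re w / Cmod w)) = Rabs (Im w))%R).
{ rewrite sin_acos by exact Hb.
  rewrite <- (sqrt_Rsqr (Cmod w)) at 1 by lra.
  rewrite <- sqrt_mult_alt by apply Rle_0_sqr.
  rewrite <- sqrt_Rsqr_abs; f_equal; unfold Rsqr.
  replace (Im w * Im w)%R with (Cmod w * Cmod w - Re w * Re w)%R by lra; field; lra. }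
unfold Cexp, Clog, Carg; simpl; rewrite exp_ln by exact Hm.
assert (Hcos : (Cmod w * cos (acos (Re w / Cmod w)) = Re w)%R).
{ rewrite cos_acos by exact Hb; field; lra. }
destruct w as [x y]; unfold Cmult, RtoC, Re, Im in *; simpl in *.
destruct (Rle_dec 0 y) as [Hy|Hy]; f_equal.
- rewrite Hcos; ring.
- rewrite Hsin, Rabs_pos_eq by exact Hy; ring.
- rewrite cos_neg, Hcos; ring.
- rewrite sin_neg, Ropp_mult_distr_r_reverse, Hsin, Rabs_left by lra; ring.
Qed.

Lemma Carg_bound (w : C) : (Rabs (Carg w) <= PI)%R.
Proof.
assert (H := acos_bound (Re w / Cmod w)).
unfold Carg; destruct (Rle_dec 0 (Im w)); [|rewrite Rabs_Ropp]; rewrite Rabs_pos_eq; lra.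
Qed.

(** The arctangent form can be differentiated without splitting on the sign of the
    imaginary part. *)
Lemma Carg_right_half_plane (w : C) : (0 < Re w)%R -> Carg w = atan (Im w / Re w).
Proof.
intros Hw.
assert (Hm : (0 < Cmod w)%R) by (generalize (re_le_Cmod w) (Rle_abs (Re w)); lra).
assert (Hs := Cmod_sqr w).
assert (E : (acos (Re w / Cmod w) = atan (Rabs (Im w) / Re w))%R).
{ rewrite acos_atan by (now apply Rdiv_lt_0_compat).
  f_equal.
  replace (sqrt (1 - (Re w / Cmod w)²)) with (Rabs (Im w) / Cmod w)%R; [field; lra|].
  rewrite <- (Rabs_pos_eq (Cmod w)) at 1 by lra.
  rewrite <- Rabs_div by lra.
  rewrite <- sqrt_Rsqr_abs; f_equal; unfold Rsqr.
  replace (Im w / Cmod w * (Im w / Cmod w))%R with ((Im w * Im w) / (Cmod w * Cmod w))%R by (field; lra).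
  replace (Im w * Im w)%R with (Cmod w * Cmod w - Re w * Re w)%R by lra; field; lra. }
unfold Carg; rewrite E; destruct (Rle_dec 0 (Im w)) as [H|H].
- now rewrite Rabs_pos_eq.
- rewrite Rabs_left, <- atan_opp by lra; f_equal; field; lra.
Qed.

Lemma is_Rderive_RtoC (w : R -> R) (t c : R) :
  is_derive w t c -> is_Rderive (fun s => RtoC (w s)) t (RtoC c).
Proof.
intros [_ Hw]; apply is_Rderive_eps; intros eps Heps.
destruct (Hw t (fun P HP => HP) (mkposreal eps Heps)) as [d Hd].
exists d; split; [apply cond_pos|]; intros s Hs; specialize (Hd s Hs).
rewrite <- RtoC_mult, <- !RtoC_minus, Cmod_R; exact Hd.
Qed.

Lemma is_Rderive_pair (u v : R -> R) (t a b : R) :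
  is_derive u t a -> is_derive v t b -> is_Rderive (fun s => (u s, v s)) t (a, b).
Proof.
intros Hu Hv.
assert (H : is_Rderive (fun s => RtoC (u s) + Ci * RtoC (v s)) t (RtoC a + Ci * RtoC b)).
{ apply (is_derive_plus (V := C_R_NormedModule) (fun s => RtoC (u s)) (fun s => Ci * RtoC (v s))).
  - now apply is_Rderive_RtoC.
  - replace (Ci * RtoC b) with (RtoC b * Ci) by ring.
    apply (is_Rderive_comp (fun z => Ci * z) (fun s => RtoC (v s))); [|now apply is_Rderive_RtoC].
    eapply is_Cderive_eq; [apply is_Cderive_scal, is_Cderive_id | ring]. }
assert (E : forall x y : R, RtoC x + Ci * RtoC y = (x, y)).
{ intros x y; unfold RtoC, Ci, Cplus, Cmult; simpl; f_equal; ring. }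
rewrite E in H.
revert H; apply (is_derive_ext (V := C_R_NormedModule)); intros s; apply E.
Qed.

Lemma is_Rderive_Clog (x : C) (t : R) :
  (0 < Re x + t)%R -> is_Rderive (fun s => Clog (x + RtoC s)) t (/ (x + RtoC t)).
Proof.
intros Hx.
set (u := Re x); set (v := Im x) in *; fold u in Hx.
assert (Hpos : (0 < (u + t) * (u + t) + v * v)%R) by nra.
apply (is_derive_ext_loc (V := C_R_NormedModule)
  (fun s => (ln (sqrt ((u + s) * (u + s) + v * v)), atan (v / (u + s))))).
{ exists (mkposreal (u + t) Hx); intros s Hs.
  change (Rabs (s - t) < u + t)%R in Hs; apply Rabs_lt_between in Hs.
  assert (ERe : Re (x + RtoC s) = (u + s)%R) by reflexivity.
  assert (EIm : Im (x + RtoC s) = v) by (unfold v, Im; simpl; ring).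
  unfold Clog; rewrite Carg_right_half_plane by (rewrite ERe; lra).
  rewrite ERe, EIm; f_equal; f_equal.
  unfold Cmod; f_equal.
  change (fst (x + RtoC s)) with (Re (x + RtoC s)); change (snd (x + RtoC s)) with (Im (x + RtoC s)).
  rewrite ERe, EIm; ring. }
replace (/ (x + RtoC t)) with
  ((u + t) / ((u + t) * (u + t) + v * v), - v / ((u + t) * (u + t) + v * v))%R.
2:{ unfold Cinv; destruct x as [x y]; unfold u, v, Re, Im in *; simpl in *; f_equal; field; nra. }
apply is_Rderive_pair.
- auto_derive; [split; [lra | split; [apply sqrt_lt_R0; lra | exact I]]|].
  assert (Hsq : (0 < sqrt ((u + t) * (u + t) + v * v))%R) by (apply sqrt_lt_R0; lra).
  rewrite <- (sqrt_sqrt ((u + t) * (u + t) + v * v)) at 3 by lra.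
  field; lra.
- auto_derive; [lra|]; field; repeat split; nra.
Qed.

Lemma Cpower_plus (w s t : C) : Cpower w (s + t) = Cpower w s * Cpower w t.
Proof. unfold Cpower; rewrite <- Cexp_plus; f_equal; ring. Qed.

Lemma Cpower_0 (w : C) : Cpower w 0 = 1.
Proof. unfold Cpower; replace (0 * Clog w) with (RtoC 0) by ring; apply Cexp_0. Qed.

Lemma Cpower_m1 (w : C) : w <> 0 -> Cpower w (- (1)) = / w.
Proof.
intros Hw; unfold Cpower; replace (- (1) * Clog w) with (- Clog w) by ring.
rewrite Cexp_opp, Cexp_Clog; auto.
Qed.

Lemma Re_pos_neq_0 (w : C) : (0 < Re w)%R -> w <> 0.
Proof. intros H E; rewrite E in H; simpl in H; lra. Qed.

Lemma is_Rderive_Cpower (x a : C) (t : R) : (0 < Re x + t)%R ->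
  is_Rderive (fun s => Cpower (x + RtoC s) a) t (a * Cpower (x + RtoC t) (a - 1)).
Proof.
intros Hx.
assert (Hne : x + RtoC t <> 0) by (apply Re_pos_neq_0; exact Hx).
replace (a * Cpower (x + RtoC t) (a - 1)) with (/ (x + RtoC t) * (a * Cexp (a * Clog (x + RtoC t)))).
- apply (is_Rderive_comp (fun l => Cexp (a * l)) (fun s => Clog (x + RtoC s))); [|now apply is_Rderive_Clog].
  apply (is_Cderive_comp Cexp (fun l => a * l)); [apply is_Cderive_Cexp|].
  eapply is_Cderive_eq; [apply is_Cderive_scal, is_Cderive_id | ring].
- unfold Cminus; rewrite Cpower_plus, Cpower_m1 by exact Hne; unfold Cpower; ring.
Qed.

(** The argument is at most [PI], so powers are controlled by the modulus and the real part
    of the exponent, locally uniformly in the exponent. *)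
Lemma Cmod_Cpower_le (w s : C) : w <> 0 ->
  (Cmod (Cpower w s) <= exp (Re s * ln (Cmod w)) * exp (PI * Cmod s))%R.
Proof.
intros Hw; unfold Cpower; rewrite Cmod_Cexp, <- exp_plus.
assert (H : (Re (s * Clog w) <= Re s * ln (Cmod w) + PI * Cmod s)%R).
{ rewrite re_mult; unfold Clog; simpl.
  assert (H1 := Carg_bound w); assert (H2 := Im_le_Cmod s).
  assert (H3 : (Rabs (Im s * Carg w) <= Cmod s * PI)%R)
    by (rewrite Rabs_mult; apply Rmult_le_compat; auto using Rabs_pos).
  generalize (Rle_abs (- (Im s * Carg w))); rewrite Rabs_Ropp; lra. }
destruct H as [H|H]; [left; now apply exp_increasing | rewrite H; lra].
Qed.

(** The family [g] lists the successive derivatives. The remainder is not divided by a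
    factorial, as only its order of magnitude in the base point matters. *)
Lemma Taylor_remainder (n : nat) (M : R) : forall g : nat -> R -> C,
  (forall j t, (0 <= t <= 1)%R -> is_Rderive (g j) t (g (S j) t)) ->
  (forall t, (0 <= t <= 1)%R -> (Cmod (g (S n) t) <= M)%R) ->
  forall t, (0 <= t <= 1)%R ->
    (Cmod (g O t - Csum (fun j => (t ^ j / INR (fact j))%R * g j 0%R) n)%C <= M)%R.
Proof.
(* The remainder vanishes at 0, and its derivative is the remainder of the shifted family. *)
induction n as [|n IH]; intros g Hg HM t Ht.
- assert (HI : is_CInt (g 1%nat) 0 t (g O t - g O 0%R)).
  { apply (is_RInt_derive (V := C_R_CompleteNormedModule) (g O) (g 1%nat)); intros s Hs;
      rewrite Rmin_left, Rmax_right in Hs by lra; [apply Hg; lra|].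
    apply (is_Rderive_continuous _ _ (g 2%nat s)), Hg; lra. }
  rewrite Csum_O; simpl; replace (1 / 1)%R with 1%R by field; rewrite Cmult_1_l.
  apply Rle_trans with ((t - 0) * M)%R.
  + apply (is_CInt_norm_le (g 1%nat)); auto; [lra|]; intros s Hs; apply HM; lra.
  + assert (H0 : (0 <= M)%R) by (eapply Rle_trans; [apply Cmod_ge_0 | apply (HM 0%R); lra]).
    rewrite <- (Rmult_1_l M) at 2; apply Rmult_le_compat_r; lra.
- set (g1 := fun j => g (S j)).
  set (rem := fun s : R => g O s - Csum (fun j => (s ^ j / INR (fact j))%R * g j 0%R) (S n)).
  set (rem' := fun s : R => g1 O s - Csum (fun j => (s ^ j / INR (fact j))%R * g1 j 0%R) n).
  assert (Hd : forall (h : nat -> C) m s, is_Rderive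
    (fun s => Csum (fun j => (s ^ j / INR (fact j))%R * h j) (S m)) s
    (Csum (fun j => (s ^ j / INR (fact j))%R * h (S j)) m)).
  { intros h; assert (Hm : forall j s, is_Rderive (fun s => (s ^ S j / INR (fact (S j)))%R * h (S j)) s
      ((s ^ j / INR (fact j))%R * h (S j))).
    { intros j s.
      apply (is_Rderive_comp (fun z => z * h (S j)) (fun s => RtoC (s ^ S j / INR (fact (S j))))).
      - eapply is_Cderive_eq; [apply (is_Cderive_mult (fun z => z) (fun _ => h (S j)));
          [apply is_Cderive_id | apply is_Cderive_const] | ring].
      - apply is_Rderive_RtoC.
        replace (s ^ j / INR (fact j))%R with (/ INR (fact (S j)) * (INR (S j) * s ^ pred (S j)))%R.
        + apply (is_derive_ext (fun s => (/ INR (fact (S j)) * s ^ S j)%R)).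
          { intros s'; apply Rmult_comm. }
          apply is_derive_scal, is_derive_Reals, derivable_pt_lim_pow.
        + rewrite (fact_simpl j), mult_INR; simpl pred.
          field; split; [apply INR_fact_neq_0 | apply not_0_INR; discriminate]. }
    induction m as [|m IHm]; intros s.
    - rewrite Csum_O.
      apply (is_derive_ext (V := C_R_NormedModule)
        (fun s : R => h O + (s ^ 1 / INR (fact 1))%R * h 1%nat)).
      { intros s'; rewrite Csum_S, Csum_O; simpl; replace (1 / 1)%R with 1%R by field.
        now rewrite Cmult_1_l. }
      replace ((s ^ 0 / INR (fact 0))%R * h 1%nat) with (0 + (s ^ 0 / INR (fact 0))%R * h 1%nat) by ring.
      apply (is_derive_plus (V := C_R_NormedModule)); [|apply (Hm O)].
      apply (is_derive_const (V := C_R_NormedModule)).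
    - rewrite Csum_S.
      apply (is_derive_ext (V := C_R_NormedModule) (fun s : R =>
        Csum (fun j => (s ^ j / INR (fact j))%R * h j) (S m)
        + (s ^ S (S m) / INR (fact (S (S m))))%R * h (S (S m)))).
      { intros s'; now rewrite (Csum_S _ (S m)). }
      apply (is_derive_plus (V := C_R_NormedModule)); [apply IHm | apply Hm]. }
  assert (Hrem : forall s, (0 <= s <= 1)%R -> is_Rderive rem s (rem' s)).
  { intros s Hs; apply (is_derive_minus (V := C_R_NormedModule)); [now apply Hg | apply Hd]. }
  assert (Hrem'c : forall s, (0 <= s <= 1)%R -> Rcontinuous rem' s).
  { intros s Hs; apply (continuous_minus (K := R_AbsRing) (V := C_R_NormedModule)).
    - apply (is_Rderive_continuous _ _ (g 2%nat s)); now apply Hg.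
    - destruct n as [|m].
      + apply (continuous_ext (T := R_UniformSpace) (U := C_UniformSpace)
          (fun _ => (1 / 1)%R * g1 O 0%R)); [intros s'; now rewrite Csum_O | apply continuous_const_C].
      + eapply is_Rderive_continuous, (Hd (fun j => g1 j 0%R)). }
  assert (H0 : rem 0%R = 0).
  { unfold rem; clear; induction (S n) as [|m IHm].
    - rewrite Csum_O; simpl; replace (1 / 1)%R with 1%R by field; ring.
    - rewrite Csum_S; simpl pow; rewrite !Rmult_0_l; unfold Rdiv; rewrite Rmult_0_l.
      rewrite <- IHm at 2; unfold Rdiv; ring. }
  assert (HI : is_CInt rem' 0 t (rem t - rem 0%R)).
  { apply (is_RInt_derive (V := C_R_CompleteNormedModule) rem rem'); intros s Hs;
      rewrite Rmin_left, Rmax_right in Hs by lra; [apply Hrem | apply Hrem'c]; lra. }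
  rewrite H0 in HI; replace (rem t - 0) with (rem t) in HI by ring.
  fold (rem t).
  apply Rle_trans with ((t - 0) * M)%R.
  + apply (is_CInt_norm_le rem'); auto; [lra|]; intros s Hs.
    apply (IH g1); [intros j u Hu; now apply Hg | exact HM | lra].
  + assert (HM0 : (0 <= M)%R) by (eapply Rle_trans; [apply Cmod_ge_0 | apply (HM 0%R); lra]).
    rewrite <- (Rmult_1_l M) at 2; apply Rmult_le_compat_r; lra.
Qed.

(** * Binomial remainders *)

Lemma holomorphic_at_plus (f g : C -> C) (z : C) :
  holomorphic_at f z -> holomorphic_at g z -> holomorphic_at (fun w => f w + g w) z.
Proof. intros [a Ha] [b Hb]; exists (a + b); now apply is_Cderive_plus. Qed.

Lemma holomorphic_at_minus (f g : C -> C) (z : C) :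
  holomorphic_at f z -> holomorphic_at g z -> holomorphic_at (fun w => f w - g w) z.
Proof. intros [a Ha] [b Hb]; exists (a - b); now apply is_Cderive_minus. Qed.

Lemma holomorphic_at_mult (f g : C -> C) (z : C) :
  holomorphic_at f z -> holomorphic_at g z -> holomorphic_at (fun w => f w * g w) z.
Proof.
intros [a Ha] [b Hb]; exists (a * g z + f z * b); now apply is_Cderive_mult.
Qed.

Lemma holomorphic_at_const (c z : C) : holomorphic_at (fun _ => c) z.
Proof. exists (RtoC 0); apply is_Cderive_const. Qed.

Lemma holomorphic_at_id (z : C) : holomorphic_at (fun w => w) z.
Proof. exists (RtoC 1); apply is_Cderive_id. Qed.

Lemma holomorphic_at_comp (f g : C -> C) (z : C) :
  holomorphic_at f (g z) -> holomorphic_at g z -> holomorphic_at (fun w => f (g w)) z.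
Proof. intros [a Ha] [b Hb]; exists (b * a); now apply is_Cderive_comp. Qed.

Lemma holomorphic_at_ext_near (f g : C -> C) (z : C) (r : R) :
  (0 < r)%R -> (forall w, (Cmod (w - z) < r)%R -> f w = g w) ->
  holomorphic_at f z -> holomorphic_at g z.
Proof. intros Hr H [l Hl]; exists l; now apply is_Cderive_ext_near with f r. Qed.

Lemma is_Cderive_Cpower (x : C) (s : C) : is_Cderive (Cpower x) s (Clog x * Cpower x s).
Proof.
apply (is_Cderive_comp Cexp (fun w => w * Clog x)); [apply is_Cderive_Cexp|].
apply (is_Cderive_ext (fun w => 0 + w * Clog x)); [intros w; ring | apply is_Cderive_affine].
Qed.

Lemma entire_Cpower (x : C) : entire (Cpower x).
Proof. intros s; exists (Clog x * Cpower x s); apply is_Cderive_Cpower. Qed.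

Fixpoint falling (a : C) (n : nat) : C :=
  match n with O => 1 | S m => falling a m * (a - INR m) end.

Lemma Cmod_falling_le (a : C) (A : R) (n : nat) :
  (Cmod a <= A)%R -> (Cmod (falling a n) <= (A + INR n) ^ n)%R.
Proof.
intros Ha; assert (HA := Cmod_ge_0 a).
induction n as [|n IH]; [simpl; rewrite Cmod_1; lra|].
cbn [falling]; rewrite Cmod_mult.
assert (Hn := pos_INR n).
assert (H1 : (Cmod (a - INR n) <= A + INR (S n))%R).
{ eapply Rle_trans; [apply Cmod_triangle|].
  rewrite Cmod_opp, Cmod_R, Rabs_pos_eq, S_INR by lra; lra. }
rewrite <- tech_pow_Rmult, Rmult_comm.
apply Rmult_le_compat; auto using Cmod_ge_0.
eapply Rle_trans; [exact IH|]; apply pow_incr; rewrite S_INR; lra.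
Qed.

Lemma holomorphic_at_falling (f : C -> C) (n : nat) (z : C) :
  holomorphic_at f z -> holomorphic_at (fun w => falling (f w) n) z.
Proof.
intros Hf; induction n as [|n IH]; [exact (holomorphic_at_const 1 z)|].
apply (holomorphic_at_mult (fun w => falling (f w) n) (fun w => f w - INR n)); [exact IH|].
apply holomorphic_at_minus; [exact Hf | apply holomorphic_at_const].
Qed.

Lemma is_Cderive_Cpower_1_minus (x : C) : is_Cderive (fun s => Cpower x (1 - s)) 1 (- Clog x).
Proof.
replace (- Clog x) with ((0 - 1) * (Clog x * Cpower x (1 - 1))).
- apply (is_Cderive_comp (Cpower x) (fun s => 1 - s)); [apply is_Cderive_Cpower|].
  apply is_Cderive_minus; [apply is_Cderive_const | apply is_Cderive_id].
- replace (1 - 1) with (RtoC 0) by ring; rewrite Cpower_0; ring.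
Qed.

(** A term of the zeta series multiplied by [s - 1]; its derivative at 1 is the
    corresponding term of the series for digamma. *)
Lemma is_Cderive_pole_term (x : C) : x <> 0 ->
  is_Cderive (fun s => (s - 1) * Cpower x (- s)) 1 (/ x).
Proof.
intros Hx.
assert (H1 : is_Cderive (fun s => Cpower x (- s)) 1 (- (1) * (Clog x * Cpower x (- (1))))).
{ apply (is_Cderive_comp (Cpower x) (fun s => - s)); [apply is_Cderive_Cpower|].
  apply is_Cderive_opp, is_Cderive_id. }
eapply is_Cderive_eq.
- apply (is_Cderive_mult (fun s => s - 1) (fun s => Cpower x (- s))); [|exact H1].
  apply is_Cderive_minus; [apply is_Cderive_id | apply is_Cderive_const].
- simpl; rewrite Cpower_m1 by exact Hx; ring.
Qed.

Definition binom_coef (j : nat) (s : C) : C := falling (1 - s) j * (/ INR (fact j))%R.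

(** The remainder of the binomial expansion of [(x + 1)^(1 - s)] in powers of [x], after the
    terms of index at most [K]. The coefficient of [x^(1 - s - j)] is [binom_coef j s]. *)
Fixpoint binomial_rem (K : nat) (x s : C) : C :=
  match K with
  | O => Cpower (x + 1) (1 - s) - Cpower x (1 - s)
  | S k => binomial_rem k x s - binom_coef (S k) s * Cpower x (- (s + INR k))
  end.

Lemma binomial_rem_taylor (K : nat) (x s : C) :
  let g := fun j (t : R) => falling (1 - s) j * Cpower (x + t) (1 - s - INR j) in
  binomial_rem K x s = g O 1%R - Csum (fun j => (1 ^ j / INR (fact j))%R * g j 0%R) K.
Proof.
intros g; induction K as [|K IH].
- rewrite Csum_O; unfold g; simpl; replace (1 / 1)%R with 1%R by field.
  replace (1 - s - 0) with (1 - s) by ring; replace (x + 0) with x by ring; ring.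
- rewrite Csum_S; cbn [binomial_rem]; rewrite IH; unfold g, binom_coef; rewrite pow1, S_INR, RtoC_plus.
  replace (1 - s - (INR K + 1)) with (- (s + INR K)) by ring; replace (x + 0%R) with x by ring.
  unfold Rdiv; rewrite Rmult_1_l; ring.
Qed.

Lemma exp_le (a b : R) : (a <= b)%R -> (exp a <= exp b)%R.
Proof. intros [H | ->]; [left; now apply exp_increasing | lra]. Qed.

Lemma exp_neg_ln_le (m y a d : R) :
  (1 <= m)%R -> (m <= y)%R -> (a <= - (1 + d))%R -> (0 <= d)%R ->
  (exp (a * ln y) <= exp (- (1 + d) * ln m))%R.
Proof.
intros Hm Hy Ha Hd; apply exp_le.
assert (H1 : (0 <= ln m)%R) by (rewrite <- ln_1; apply ln_le; lra).
assert (H2 : (ln m <= ln y)%R) by (apply ln_le; lra).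
nra.
Qed.

Lemma Re_le_Cmod (w : C) : (Re w <= Cmod w)%R.
Proof. eapply Rle_trans; [apply Rle_abs | apply re_le_Cmod]. Qed.

(** The remainder is [O(x^(- s - K))], by Taylor's formula on the segment from [x] to
    [x + 1]; it is therefore summable over [x = q + n] as soon as [Re s > 1 - K]. *)
Lemma binomial_rem_bound (K : nat) (A : R) : (0 <= A)%R -> exists B, (0 <= B)%R /\
  forall (s x : C) (m d : R), (Cmod s <= A)%R -> (0 <= d)%R -> (1 + d <= Re s + INR K)%R ->
    (1 <= m <= Re x)%R -> (Cmod (binomial_rem K x s) <= B * exp (- (1 + d) * ln m))%R.
Proof.
intros HA.
set (B1 := ((1 + A + INR (S K)) ^ S K)%R); set (B2 := exp (PI * (1 + A + INR (S K)))).
assert (HK := pos_INR (S K)).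
assert (HB1 : (0 <= B1)%R) by (apply pow_le; lra).
assert (HB2 := exp_pos (PI * (1 + A + INR (S K)))); fold B2 in HB2.
exists (B1 * B2)%R; split; [apply Rmult_le_pos; lra|].
intros s x m d Hs Hd HsK Hm.
rewrite binomial_rem_taylor; cbv zeta.
set (g := fun j (t : R) => falling (1 - s) j * Cpower (x + t) (1 - s - INR j)).
apply (Taylor_remainder K (B1 * B2 * exp (- (1 + d) * ln m))%R g); [| |lra].
- intros j t Ht; unfold g; cbn [falling].
  replace (falling (1 - s) j * (1 - s - INR j) * Cpower (x + t) (1 - s - INR (S j)))
    with (((1 - s - INR j) * Cpower (x + t) (1 - s - INR j - 1)) * falling (1 - s) j).
  2:{ rewrite S_INR, RtoC_plus; replace (1 - s - (INR j + 1)) with (1 - s - INR j - 1) by ring; ring. }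
  apply (is_Rderive_comp (fun z => falling (1 - s) j * z) (fun t => Cpower (x + t) (1 - s - INR j))).
  + eapply is_Cderive_eq; [apply is_Cderive_scal, is_Cderive_id | ring].
  + apply is_Rderive_Cpower; lra.
- intros t Ht; unfold g; rewrite Cmod_mult, Rmult_assoc.
  assert (Ha : (Cmod (1 - s) <= 1 + A)%R)
    by (eapply Rle_trans; [apply Cmod_triangle|]; rewrite Cmod_1, Cmod_opp; lra).
  apply Rmult_le_compat; auto using Cmod_ge_0; [now apply Cmod_falling_le|].
  assert (Hre : Re (x + t) = (Re x + t)%R) by reflexivity.
  eapply Rle_trans; [apply Cmod_Cpower_le, Re_pos_neq_0; rewrite Hre; lra|].
  rewrite Rmult_comm; apply Rmult_le_compat; try (left; apply exp_pos).
  + apply exp_le, Rmult_le_compat_l; [left; apply PI_RGT_0|].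
    eapply Rle_trans; [apply Cmod_triangle|]; rewrite Cmod_opp, Cmod_R, Rabs_pos_eq by auto; lra.
  + apply exp_neg_ln_le; auto; [lra | |].
    * generalize (Re_le_Cmod (x + t)); rewrite Hre; lra.
    * replace (Re (1 - s - INR (S K))) with (- Re s - INR K)%R; [lra|].
      rewrite S_INR; simpl; unfold Re; ring.
Qed.

Lemma is_lim_seq_exp_ln_0 (d : R) : (0 < d)%R ->
  is_lim_seq (fun n => exp (- d * ln (INR (S n)))) 0%R.
Proof.
intros Hd.
apply is_lim_seq_ext with (fun n => / exp (d * ln (INR (S n))))%R.
  { intros n; rewrite <- exp_Ropp; f_equal; ring. }
  apply (is_lim_seq_inv _ p_infty); [|discriminate].
  apply is_lim_comp_seq with p_infty; [apply is_lim_exp_p | exists O; discriminate |].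
  replace p_infty with (Rbar_mult d p_infty).
  2:{ simpl; destruct (Rle_dec 0 d) as [H|H]; [|lra].
      destruct (Rle_lt_or_eq_dec 0 d H); [reflexivity | lra]. }
  apply (is_lim_seq_scal_l (fun n => ln (INR (S n))) d p_infty).
  apply is_lim_comp_seq with p_infty; [apply is_lim_ln_p | exists O; discriminate |].
  apply (is_lim_seq_incr_1 INR), is_lim_seq_INR.
Qed.

(** Comparison with the telescoping series of [n^(- d) / d]. *)
Lemma ex_series_power (d : R) : (0 < d)%R -> ex_series (fun n => exp (- (1 + d) * ln (INR (S n))))%R.
Proof.
intros Hd.
set (u := fun n => exp (- d * ln (INR (S n)))).
assert (Hu := is_lim_seq_exp_ln_0 d Hd : is_lim_seq u 0%R).
assert (Ht : ex_series (fun n => / d * (u n - u (S n)))%R).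
{ apply (ex_series_scal (V := R_NormedModule) (/ d)%R (fun n => u n - u (S n))%R).
  exists (u O).
  assert (E : forall n, (u O - u (S n))%R = sum_n (fun n => (u n - u (S n))%R) n).
  { induction n as [|n IH]; [now rewrite sum_O|].
    rewrite sum_Sn, <- IH; unfold plus.
    change (u O - u (S (S n)) = (u O - u (S n)) + (u (S n) - u (S (S n))))%R; ring. }
  change (is_lim_seq (sum_n (fun n => (u n - u (S n))%R)) (u O)).
  apply (is_lim_seq_ext _ _ _ E).
  replace (Finite (u O)) with (Finite (u O - 0)) by (f_equal; ring).
  apply is_lim_seq_minus'; [apply is_lim_seq_const|].
  now apply (is_lim_seq_incr_1 u). }
apply (ex_series_incr_1 (V := R_NormedModule)).
apply (ex_series_le (K := R_AbsRing) (V := R_CompleteNormedModule)) with (2 := Ht).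
intros n.
change (Rabs (exp (- (1 + d) * ln (INR (S (S n))))) <= / d * (u n - u (S n)))%R.
rewrite Rabs_pos_eq by (left; apply exp_pos).
(* [u n - u (n+1) = e^(-d y) (e^(d (y - x)) - 1)] with [x = ln (n+1)], [y = ln (n+2)],
   and [y - x >= 1 / (n+2)] *)
unfold u.
assert (Hn1 : (1 <= INR (S n))%R) by (rewrite S_INR; generalize (pos_INR n); lra).
assert (Hn2 : (INR (S (S n)) = INR (S n) + 1)%R) by apply S_INR.
set (x := ln (INR (S n))); set (y := ln (INR (S (S n)))).
assert (Hy : exp y = INR (S (S n))) by (apply exp_ln; lra).
assert (Hxy : (exp (- y) <= y - x)%R).
{ unfold x, y; rewrite <- ln_one_plus_inv, exp_Ropp; fold y; rewrite Hy.
  assert (H1 : (ln (/ (1 + / INR (S n))) <= / (1 + / INR (S n)) - 1)%R).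
  { apply ln_le_sub_one, Rinv_0_lt_compat; generalize (inv_INR_S_bounds n); lra. }
  rewrite ln_Rinv in H1 by (generalize (inv_INR_S_bounds n); lra).
  replace (/ INR (S (S n)))%R with (- (/ (1 + / INR (S n)) - 1))%R; [lra|].
  rewrite Hn2; field; lra. }
replace (- (1 + d) * y)%R with (- d * y + - y)%R by ring; rewrite exp_plus.
replace (- d * x)%R with (- d * y + d * (y - x))%R by ring; rewrite exp_plus.
assert (H2 := exp_ineq1_le (d * (y - x))).
assert (H3 := exp_pos (- d * y)).
apply Rmult_le_reg_l with d; [exact Hd|].
replace (d * (/ d * (exp (- d * y) * exp (d * (y - x)) - exp (- d * y))))%R
  with (exp (- d * y) * (exp (d * (y - x)) - 1))%R by (field; lra).
replace (d * (exp (- d * y) * exp (- y)))%R with (exp (- d * y) * (d * exp (- y)))%R by ring.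
apply Rmult_le_compat_l; [lra|].
assert (d * exp (- y) <= d * (y - x))%R by (apply Rmult_le_compat_l; lra); lra.
Qed.

(** * Continuation of the zeta series for Re q at least 1 *)

Definition Csum_value (a : nat -> C) : C := C_Lim_seq (Csum a).

Lemma Csum_value_correct (a : nat -> C) (l : C) : Cseries a l -> Csum_value a = l.
Proof. intros H; apply C_Lim_seq_unique; now apply Cseries_lim. Qed.

Lemma Re_shift (q : C) (n : nat) : Re (INR n + q) = (INR n + Re q)%R.
Proof. reflexivity. Qed.

Section RightHalfPlane.

Variable q : C.
Hypothesis Hq : (1 <= Re q)%R.

Lemma Re_shift_ge (n : nat) : (1 <= INR (S n) <= Re (INR n + q))%R.
Proof. rewrite Re_shift, S_INR; generalize (pos_INR n); lra. Qed.

Lemma shift_neq_0 (n : nat) : INR n + q <> 0.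
Proof. apply Re_pos_neq_0; generalize (Re_shift_ge n); lra. Qed.

Definition zeta_sum (s : C) : C := Csum_value (fun n => Cpower (INR n + q) (- s)).
Definition binomial_rem_sum (K : nat) (s : C) : C := Csum_value (fun n => binomial_rem K (INR n + q) s).

Lemma zeta_sum_correct (s : C) : (1 < Re s)%R ->
  Cseries (fun n => Cpower (INR n + q) (- s)) (zeta_sum s).
Proof.
intros Hs.
destruct (Cseries_le (fun n => Cpower (INR n + q) (- s))
  (fun n => exp (PI * Cmod s) * exp (- (1 + (Re s - 1)) * ln (INR (S n))))%R) as [l [Hl _]].
- intros n; eapply Rle_trans; [apply Cmod_Cpower_le, shift_neq_0|].
  rewrite Cmod_opp, Rmult_comm; apply Rmult_le_compat_l; [left; apply exp_pos|].
  assert (Hn := Re_shift_ge n).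
  apply exp_neg_ln_le; [lra | generalize (Re_le_Cmod (INR n + q)); lra | rewrite re_opp; lra | lra].
- apply (ex_series_scal (V := R_NormedModule)), ex_series_power; lra.
- unfold zeta_sum; now rewrite (Csum_value_correct _ _ Hl).
Qed.

(** With [Re q >= 1] the points [q + n] stay at distance at least [n + 1] from the origin,
    and the dominating series works for all [s] of a disc, as Weierstrass' theorem requires. *)
Lemma binomial_rem_disc_bound (K : nat) (a : C) : (1 - INR K < Re a)%R ->
  exists M : nat -> R, ex_series M /\ forall n (s : C),
    (Cmod (s - a) <= (Re a - 1 + INR K) / 2)%R -> (Cmod (binomial_rem K (INR n + q) s) <= M n)%R.
Proof.
intros Ha; set (r := ((Re a - 1 + INR K) / 2)%R).
destruct (binomial_rem_bound K (Cmod a + r)) as [B [HB H]]; [generalize (Cmod_ge_0 a); unfold r; lra|].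
exists (fun n => B * exp (- (1 + r) * ln (INR (S n))))%R; split.
- apply (ex_series_scal (V := R_NormedModule)), ex_series_power; unfold r; lra.
- intros n s Hs; apply H.
  + replace s with (a + (s - a)) by ring; eapply Rle_trans; [apply Cmod_triangle|]; lra.
  + unfold r; lra.
  + generalize (Re_gt_of_near s a); fold r in Hs; unfold r in *; lra.
  + apply Re_shift_ge.
Qed.

Lemma binomial_rem_sum_correct (K : nat) (s : C) : (1 - INR K < Re s)%R ->
  Cseries (fun n => binomial_rem K (INR n + q) s) (binomial_rem_sum K s).
Proof.
intros Hs; destruct (binomial_rem_disc_bound K s Hs) as [M [HM H]].
destruct (Cseries_le (fun n => binomial_rem K (INR n + q) s) M) as [l [Hl _]]; [|exact HM|].
- intros n; apply H; replace (s - s) with (RtoC 0) by ring; rewrite Cmod_0; lra.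
- unfold binomial_rem_sum; now rewrite (Csum_value_correct _ _ Hl).
Qed.

Lemma entire_binomial_rem (K : nat) (x : C) : entire (binomial_rem K x).
Proof.
intros s.
assert (H1 : holomorphic_at (fun s => 1 - s) s)
  by (apply holomorphic_at_minus; [apply holomorphic_at_const | apply holomorphic_at_id]).
induction K as [|K IH].
- apply (holomorphic_at_minus (fun s => Cpower (x + 1) (1 - s)) (fun s => Cpower x (1 - s)));
    apply (holomorphic_at_comp (Cpower _) (fun s => 1 - s)); auto; apply entire_Cpower.
- apply (holomorphic_at_minus (binomial_rem K x)
    (fun s => binom_coef (S K) s * Cpower x (- (s + INR K)))); [exact IH|].
  apply holomorphic_at_mult.
  + apply holomorphic_at_mult; [|apply holomorphic_at_const].
    now apply (holomorphic_at_falling (fun s => 1 - s)).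
  + apply (holomorphic_at_comp (Cpower x) (fun s => - (s + INR K))); [apply entire_Cpower|].
    apply (holomorphic_at_ext_near (fun s => (- INR K) - s) _ _ 1 Rlt_0_1); [intros w _; ring|].
    apply holomorphic_at_minus; [apply holomorphic_at_const | apply holomorphic_at_id].
Qed.

Lemma is_Cderive_binomial_rem_sum (K : nat) (a : C) : (1 - INR K < Re a)%R -> exists l,
  is_Cderive (binomial_rem_sum K) a l /\ Cseries (fun n => C_derive (binomial_rem K (INR n + q)) a) l.
Proof.
intros Ha; destruct (binomial_rem_disc_bound K a Ha) as [M [HM H]].
apply (Weierstrass_series (fun n => binomial_rem K (INR n + q)) (fun n => C_derive (binomial_rem K (INR n + q)))
  (binomial_rem_sum K) a ((Re a - 1 + INR K) / 2) M); auto; [lra | |].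
- intros n z; apply is_Cderive_C_derive, entire_binomial_rem.
- intros w Hw; apply binomial_rem_sum_correct.
  generalize (Re_gt_of_near w a); lra.
Qed.

(** Summing the binomial expansions at the points [q + n] and multiplying out gives, with
    [g s = (s - 1) zeta (s, q)], the relation
      [sum_(i < K) zeta_weight i s * g (s + i) = zeta_main K s],
    since [binom_coef (i + 1) s] contains the factor [s + i - 1] of [g (s + i)]. The right
    hand side is defined for [Re s > 1 - K], and [zeta_weight 0 s] is 1. *)
Definition zeta_weight (i : nat) (s : C) : C := falling (1 - s) i * (/ INR (fact (S i)))%R.
Definition zeta_reg0 (s : C) : C := (s - 1) * zeta_sum s.
Definition zeta_main (K : nat) (s : C) : C := Cpower q (1 - s) + binomial_rem_sum K s.

Lemma binom_coef_weight (K : nat) (s : C) :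
  binom_coef (S K) s = - (zeta_weight K s * (s + INR K - 1)).
Proof. unfold binom_coef, zeta_weight; cbn [falling]; ring. Qed.

Lemma zeta_main_S (K : nat) (s : C) : (1 - INR K < Re s)%R ->
  zeta_main (S K) s = zeta_main K s + zeta_weight K s * zeta_reg0 (s + INR K).
Proof.
intros Hs.
assert (H1 := binomial_rem_sum_correct K s Hs).
assert (H2 : Cseries (fun n => binomial_rem (S K) (INR n + q) s)
  (binomial_rem_sum K s - binom_coef (S K) s * zeta_sum (s + INR K))).
{ apply (Cseries_ext (fun n => binomial_rem K (INR n + q) s
    - binom_coef (S K) s * Cpower (INR n + q) (- (s + INR K)))); [reflexivity|].
  apply Cseries_minus; [exact H1 | apply Cseries_scal, zeta_sum_correct].
  rewrite re_plus, re_RtoC; lra. }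
apply Csum_value_correct in H2.
unfold zeta_main; change (binomial_rem_sum (S K) s) with (Csum_value (fun n => binomial_rem (S K) (INR n + q) s)).
rewrite H2, binom_coef_weight; unfold zeta_reg0; ring.
Qed.

(** For [K = 0] the sum telescopes to [- q^(1 - s)]. *)
Lemma zeta_main_0 (s : C) : (1 < Re s)%R -> zeta_main 0 s = 0.
Proof.
intros Hs.
set (u := fun n => Cpower (INR n + q) (1 - s)).
assert (Hu : is_Clim_seq u 0).
{ apply is_Clim_seq_le with (fun n => exp (PI * Cmod (1 - s)) * exp (- (Re s - 1) * ln (INR (S n))))%R.
  - exists O; intros n _; replace (u n - 0) with (u n) by ring.
    eapply Rle_trans; [apply Cmod_Cpower_le, shift_neq_0|].
    rewrite Rmult_comm; apply Rmult_le_compat_l; [left; apply exp_pos|].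
    assert (Hn := Re_shift_ge n).
    rewrite Re_minus, re_RtoC.
    apply exp_le.
    assert (H1 : (ln (INR (S n)) <= ln (Cmod (INR n + q)))%R)
      by (apply ln_le; [lra | generalize (Re_le_Cmod (INR n + q)); lra]).
    assert ((Re s - 1) * ln (INR (S n)) <= (Re s - 1) * ln (Cmod (INR n + q)))%R
      by (apply Rmult_le_compat_l; lra); lra.
  - replace (Finite 0) with (Finite (exp (PI * Cmod (1 - s)) * 0)) by (f_equal; ring).
    apply is_lim_seq_mult'; [apply is_lim_seq_const|].
    apply is_lim_seq_exp_ln_0; lra. }
assert (H : Cseries (fun n => u (S n) - u n) (- u O)).
{ apply Cseries_telescope; replace (u O + - u O) with (RtoC 0) by ring; exact Hu. }
unfold zeta_main, binomial_rem_sum.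
rewrite (Csum_value_correct _ (- u O)).
- unfold u; simpl; replace (0 + q) with q by ring; ring.
- revert H; apply Cseries_ext; intros n; unfold u; cbn [binomial_rem].
  replace (INR (S n) + q) with (INR n + q + 1) by (rewrite S_INR, RtoC_plus; ring); reflexivity.
Qed.

Fixpoint Csum_lt (f : nat -> C) (k : nat) : C :=
  match k with O => 0 | S m => Csum_lt f m + f m end.

(** The relation satisfied by [(s - 1) zeta (s, q)], solved for its term of index 0: the
    [m]-th function is meaningful for [Re s > 1 - m], and gains one unit on its predecessor
    because the latter is used at the points [s + 1], ..., [s + k] only. *)
Fixpoint zeta_reg_step (m : nat) (s : C) : C :=
  match m with
  | O => zeta_reg0 s
  | S k => zeta_main (S k) s
      - Csum_lt (fun i => zeta_weight (S i) s * zeta_reg_step k (s + INR (S i))) k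
  end.

Lemma Csum_lt_ext (f g : nat -> C) (k : nat) :
  (forall i, (i < k)%nat -> f i = g i) -> Csum_lt f k = Csum_lt g k.
Proof.
induction k as [|k IH]; intros H; [reflexivity|]; simpl; rewrite IH, H; auto.
Qed.

(** The two right hand sides differ by the term that [zeta_main_S] adds, which is evaluated
    at a point where the zeta series converges. Thus the continuations agree on the smaller
    half-plane, by algebra. *)
Lemma zeta_reg_step_S (m : nat) : forall s, (1 - INR m < Re s)%R ->
  zeta_reg_step (S m) s = zeta_reg_step m s.
Proof.
assert (Hbig : forall k, (forall j s, (j < k)%nat -> (1 - INR j < Re s)%R ->
    zeta_reg_step (S j) s = zeta_reg_step j s) ->
  forall s, (1 < Re s)%R -> zeta_reg_step k s = zeta_reg0 s).
{ induction k as [|k IH]; intros H s Hs; [reflexivity|].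
  rewrite H by (auto; generalize (pos_INR k); lra).
  apply IH; auto. }
induction m as [m IHm] using (well_founded_induction Nat.lt_wf_0); intros s Hs.
destruct m as [|k].
- cbn [zeta_reg_step Csum_lt]; rewrite zeta_main_S, zeta_main_0 by (simpl in Hs; simpl; lra).
  unfold zeta_weight; simpl; replace (s + 0) with s by ring; rewrite Rinv_1; ring.
- change (zeta_reg_step (S (S k)) s) with (zeta_main (S (S k)) s
    - (Csum_lt (fun i => zeta_weight (S i) s * zeta_reg_step (S k) (s + INR (S i))) k
       + zeta_weight (S k) s * zeta_reg_step (S k) (s + INR (S k)))).
  change (zeta_reg_step (S k) s) with (zeta_main (S k) s
    - Csum_lt (fun i => zeta_weight (S i) s * zeta_reg_step k (s + INR (S i))) k).
  rewrite zeta_main_S by exact Hs.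
  (* The last summand is the zeta series at [s + k + 1], and cancels. *)
  rewrite (Hbig (S k)).
  + rewrite (Csum_lt_ext (fun i => zeta_weight (S i) s * zeta_reg_step (S k) (s + INR (S i)))
      (fun i => zeta_weight (S i) s * zeta_reg_step k (s + INR (S i)))); [ring|].
    intros i Hi; f_equal; apply IHm; [lia|].
    rewrite re_plus, re_RtoC; rewrite S_INR in Hs; rewrite S_INR; generalize (pos_INR i); lra.
  + intros j s' Hj; apply IHm; exact Hj.
  + rewrite re_plus, re_RtoC; lra.
Qed.

Lemma zeta_reg_step_stable (m n : nat) (s : C) : (m <= n)%nat -> (1 - INR m < Re s)%R ->
  zeta_reg_step n s = zeta_reg_step m s.
Proof.
intros Hmn Hs; induction Hmn as [|n Hmn IH]; [reflexivity|].
rewrite zeta_reg_step_S; [exact IH|].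
apply le_INR in Hmn; lra.
Qed.

Lemma holomorphic_zeta_main (K : nat) (s : C) :
  (1 - INR K < Re s)%R -> holomorphic_at (zeta_main K) s.
Proof.
intros Hs; destruct (is_Cderive_binomial_rem_sum K s Hs) as [l [Hl _]].
apply (holomorphic_at_plus (fun s => Cpower q (1 - s)) (binomial_rem_sum K)); [|exists l; exact Hl].
apply (holomorphic_at_comp (Cpower q) (fun s => 1 - s)); [apply entire_Cpower|].
apply holomorphic_at_minus; [apply holomorphic_at_const | apply holomorphic_at_id].
Qed.

Lemma holomorphic_zeta_reg_step (m : nat) : forall s, (- INR m < Re s)%R ->
  holomorphic_at (zeta_reg_step (S m)) s.
Proof.
induction m as [|m IH]; intros s Hs.
- apply (holomorphic_at_minus (zeta_main 1) (fun _ => 0)); [|apply holomorphic_at_const].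
  apply holomorphic_zeta_main; simpl in *; lra.
- apply (holomorphic_at_minus (zeta_main (S (S m)))
    (fun s => Csum_lt (fun i => zeta_weight (S i) s * zeta_reg_step (S m) (s + INR (S i))) (S m))).
  { apply holomorphic_zeta_main; rewrite !S_INR; rewrite S_INR in Hs; lra. }
  generalize (S m) at 2; intros k; induction k as [|k IHk]; [exact (holomorphic_at_const 0 s)|].
  apply (holomorphic_at_plus
    (fun s => Csum_lt (fun i => zeta_weight (S i) s * zeta_reg_step (S m) (s + INR (S i))) k)
    (fun s => zeta_weight (S k) s * zeta_reg_step (S m) (s + INR (S k)))); [exact IHk|].
  apply (holomorphic_at_mult (zeta_weight (S k)) (fun s => zeta_reg_step (S m) (s + INR (S k)))).
  + apply holomorphic_at_mult; [|apply holomorphic_at_const].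
    apply (holomorphic_at_falling (fun s => 1 - s)).
    apply holomorphic_at_minus; [apply holomorphic_at_const | apply holomorphic_at_id].
  + apply (holomorphic_at_comp (zeta_reg_step (S m)) (fun s => s + INR (S k))).
    * apply IH; rewrite re_plus, re_RtoC; rewrite S_INR in Hs; rewrite S_INR.
      generalize (pos_INR k); lra.
    * apply holomorphic_at_plus; [apply holomorphic_at_id | apply holomorphic_at_const].
Qed.

(** The sequence is eventually constant at each point, and its limit is the common
    continuation. *)
Definition zeta_reg (s : C) : C := C_Lim_seq (fun m => zeta_reg_step m s).

Lemma zeta_reg_eq (m : nat) (s : C) : (1 - INR m < Re s)%R -> zeta_reg s = zeta_reg_step m s.
Proof.
intros Hs; apply C_Lim_seq_unique.
apply is_Clim_seq_ext_loc with (fun _ => zeta_reg_step m s); [|apply is_Clim_seq_const].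
exists m; intros n Hn; symmetry; now apply zeta_reg_step_stable.
Qed.

Lemma zeta_reg_series (s : C) : (1 < Re s)%R -> zeta_reg s = (s - 1) * zeta_sum s.
Proof. intros Hs; rewrite (zeta_reg_eq 0) by (simpl; lra); reflexivity. Qed.

Lemma entire_zeta_reg : entire zeta_reg.
Proof.
intros s.
destruct (nfloor_ex (Rabs (Re s)) (Rabs_pos _)) as [m [_ Hm]].
assert (Hs : (- INR (S m) < Re s)%R).
{ rewrite S_INR; generalize (Rle_abs (- Re s)); rewrite Rabs_Ropp; lra. }
apply (holomorphic_at_ext_near (zeta_reg_step (S (S m))) zeta_reg s (Re s + INR (S m))); [lra | |].
- intros w Hw; symmetry; apply zeta_reg_eq.
  generalize (Re_gt_of_near w s); rewrite (S_INR (S m)); lra.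
- now apply holomorphic_zeta_reg_step.
Qed.

(** At [s = 1] all the remainders vanish. *)
Lemma zeta_reg_1 : zeta_reg 1 = 1.
Proof.
rewrite (zeta_reg_eq 1) by (simpl; lra).
cbn [zeta_reg_step Csum_lt]; unfold zeta_main, binomial_rem_sum.
rewrite (Csum_value_correct _ 0).
- replace (1 - 1) with (RtoC 0) by ring; rewrite Cpower_0; ring.
- apply Cseries_lim, is_Clim_seq_ext with (fun _ => RtoC 0); [|apply is_Clim_seq_const].
  assert (E : forall n, binomial_rem 1 (INR n + q) 1 = 0).
  { intros n; cbn [binomial_rem]; unfold binom_coef; cbn [falling].
    replace (1 - 1) with (RtoC 0) by ring; rewrite !Cpower_0; simpl; ring. }
  intros n; induction n as [|n IH]; [now rewrite Csum_O, E | rewrite Csum_S, E, <- IH; ring].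
Qed.

Lemma is_Cderive_binomial_rem_1 (x : C) : x <> 0 ->
  is_Cderive (binomial_rem 1 x) 1 (Clog x - Clog (x + 1) + / x).
Proof.
intros Hx.
assert (Hl := is_Cderive_pole_term x Hx).
apply (is_Cderive_ext (fun s => (Cpower (x + 1) (1 - s) - Cpower x (1 - s)) + (s - 1) * Cpower x (- s))).
- intros s; cbn [binomial_rem]; unfold binom_coef; cbn [falling]; simpl INR.
  rewrite Rinv_1; replace (s + 0) with s by ring; ring.
- replace (Clog x - Clog (x + 1) + / x) with ((- Clog (x + 1) - - Clog x) + / x) by ring.
  apply is_Cderive_plus; [apply is_Cderive_minus; apply is_Cderive_Cpower_1_minus | exact Hl].
Qed.

(** Near 1 the function is [zeta_main 1], which is differentiated term by term. The
    logarithms telescope, leaving the sums that also define digamma. *)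
Lemma is_Cderive_zeta_reg_1 : exists l, is_Cderive zeta_reg 1 l /\
  is_Clim_seq (fun n => Csum (fun k => / (INR k + q)) n - Clog (INR (S n) + q)) l.
Proof.
destruct (is_Cderive_binomial_rem_sum 1 1) as [l [Hl1 Hl2]]; [simpl; lra|].
exists (- Clog q + l); split.
- apply (is_Cderive_ext_near (zeta_main 1) zeta_reg 1 _ 1 Rlt_0_1).
  + intros w Hw; rewrite (zeta_reg_eq 1); [cbn [zeta_reg_step Csum_lt]; ring|].
    generalize (Re_gt_of_near w 1); simpl; lra.
  + apply is_Cderive_plus; [|exact Hl1].
    apply is_Cderive_Cpower_1_minus.
- apply Cseries_lim in Hl2.
  apply is_Clim_seq_ext with (fun n => - Clog q + Csum (fun n => C_derive (binomial_rem 1 (INR n + q)) 1) n).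
  2:{ apply is_Clim_seq_plus; [apply is_Clim_seq_const | exact Hl2]. }
  assert (E : forall n, C_derive (binomial_rem 1 (INR n + q)) 1 =
    Clog (INR n + q) - Clog (INR (S n) + q) + / (INR n + q)).
  { intros n; apply is_C_derive_unique.
    replace (INR (S n) + q) with (INR n + q + 1) by (rewrite S_INR, RtoC_plus; ring).
    apply is_Cderive_binomial_rem_1, shift_neq_0. }
  induction n as [|n IH].
  + rewrite !Csum_O, E; simpl INR; replace (0 + q) with q by ring; ring.
  + rewrite !Csum_S, E, Cplus_assoc, IH; ring.
Qed.

End RightHalfPlane.

(** * The Hurwitz zeta function *)

(** [G] is [(s - 1) zeta (s, q)] continued to the plane, and [l] is the constant term of the
    Laurent expansion of zeta at 1. *)
Definition regularized_zeta (q : C) (G : C -> C) (l : C) : Prop :=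
  entire G /\ G 1 = 1 /\ is_Cderive G 1 l /\
  (forall s : C, (1 < Re s)%R ->
     Cseries (fun n => Cpower (INR n + q) (- s)) (G s / (s - 1))) /\
  is_Clim_seq (fun n => Csum (fun k => / (INR k + q)) n - Clog (INR (S n) + q)) l.

Lemma Re_gt_1_neq (s : C) : (1 < Re s)%R -> s - 1 <> 0.
Proof.
intros H; apply Re_pos_neq_0; rewrite Re_minus, re_RtoC; lra.
Qed.

Lemma regularized_zeta_right (q : C) : (1 <= Re q)%R -> exists G l, regularized_zeta q G l.
Proof.
intros Hq; destruct (is_Cderive_zeta_reg_1 q Hq) as [l [Hl1 Hl2]].
exists (zeta_reg q), l; split; [|split; [|split; [exact Hl1 | split; [|exact Hl2]]]].
- now apply entire_zeta_reg.
- now apply zeta_reg_1.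
- intros s Hs; rewrite zeta_reg_series by auto.
  replace ((s - 1) * zeta_sum q s / (s - 1)) with (zeta_sum q s) by (field; now apply Re_gt_1_neq).
  now apply zeta_sum_correct.
Qed.

Lemma Csum_shift (a : nat -> C) (n : nat) : Csum a (S n) = a O + Csum (fun k => a (S k)) n.
Proof.
induction n as [|n IH]; [now rewrite Csum_S, !Csum_O|].
rewrite (Csum_S a (S n)), IH, (Csum_S (fun k => a (S k)) n); ring.
Qed.

(** Splitting off the first term of the series lowers [q] by one, which reaches all
    parameters from the half-plane [Re q >= 1]. *)
Lemma regularized_zeta_shift (q : C) (G : C -> C) (l : C) : q <> 0 ->
  regularized_zeta (q + 1) G l ->
  regularized_zeta q (fun s => (s - 1) * Cpower q (- s) + G s) (/ q + l).
Proof.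
intros Hq [HG [HG1 [Hl [HS Hlim]]]].
assert (Hsh : forall n, INR (S n) + q = INR n + (q + 1))
  by (intros n; rewrite S_INR, RtoC_plus; ring).
split; [|split; [|split; [|split]]].
- intros s; apply (holomorphic_at_plus (fun s => (s - 1) * Cpower q (- s)) G); [|apply HG].
  apply (holomorphic_at_mult (fun s => s - 1) (fun s => Cpower q (- s))).
  + apply holomorphic_at_minus; [apply holomorphic_at_id | apply holomorphic_at_const].
  + apply (holomorphic_at_comp (Cpower q) (fun s => - s)); [apply entire_Cpower|].
    exists (- (1)); apply is_Cderive_opp, is_Cderive_id.
- rewrite HG1; ring.
- apply is_Cderive_plus; [|exact Hl].
  now apply is_Cderive_pole_term.
- intros s Hs.
  apply (is_series_decr_1 (K := C_AbsRing) (V := C_NormedModule)).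
  specialize (HS s Hs).
  change (Cseries (fun n => Cpower (INR (S n) + q) (- s))
    (((s - 1) * Cpower q (- s) + G s) / (s - 1) - Cpower (INR 0 + q) (- s))).
  replace (((s - 1) * Cpower q (- s) + G s) / (s - 1) - Cpower (INR 0 + q) (- s))
    with (G s / (s - 1)).
  + revert HS; apply Cseries_ext; intros n; now rewrite Hsh.
  + replace (INR 0 + q) with q by (simpl; ring); field; now apply Re_gt_1_neq.
- apply (is_Clim_seq_incr_n _ 1).
  apply is_Clim_seq_ext with
    (fun n => / q + (Csum (fun k => / (INR k + (q + 1))) n - Clog (INR (S n) + (q + 1)))).
  { intros n; rewrite Nat.add_1_r, Csum_shift, Hsh.
    replace (INR 0 + q) with q by (simpl; ring).
    replace (Csum (fun k => / (INR (S k) + q)) n) with (Csum (fun k => / (INR k + (q + 1))) n); [ring|].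
    apply sum_n_ext; intros k; now rewrite Hsh. }
  apply is_Clim_seq_plus; [apply is_Clim_seq_const | exact Hlim].
Qed.

Lemma regularized_zeta_exists (q : C) : ~ nonpos_int q -> exists G l, regularized_zeta q G l.
Proof.
intros Hq; destruct (nfloor_ex (Rabs (Re q)) (Rabs_pos _)) as [m [_ Hm]].
assert (HN : (1 <= Re q + INR (S (S m)))%R).
{ rewrite !S_INR; generalize (Rle_abs (- Re q)); rewrite Rabs_Ropp; lra. }
revert HN; generalize (S (S m)); clear m Hm; intros N; revert q Hq.
induction N as [|N IH]; intros q Hq HN.
- apply regularized_zeta_right; simpl in HN; lra.
- destruct (IH (q + 1)) as [G [l H]].
  + intros [n Hn]; apply Hq; exists (S n); rewrite S_INR, RtoC_plus.
    replace q with (q + 1 - 1) by ring; rewrite Hn; ring.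
  + replace (Re (q + 1)) with (Re q + 1)%R by reflexivity; rewrite S_INR in HN; lra.
  + eexists; eexists; apply regularized_zeta_shift; [now apply not_nonpos_int_neq_0 | exact H].
Qed.

Lemma hurwitz_zeta_spec (q : C) : ~ nonpos_int q -> is_hurwitz_zeta q (fun s => hurwitz_zeta s q).
Proof.
intros Hq; unfold hurwitz_zeta; apply epsilon_spec.
destruct (regularized_zeta_exists q Hq) as [G [l [HG [HG1 [_ [HS _]]]]]].
exists (fun s => G s / (s - 1)); split; [exact HS | split].
- intros s Hs; apply (holomorphic_at_mult G (fun s => / (s - 1))); [apply HG|].
  eexists; apply (is_Cderive_inv (fun s => s - 1)); [now apply Cminus_eq_contra|].
  apply is_Cderive_minus; [apply is_Cderive_id | apply is_Cderive_const].
- apply has_C_limit_eps; intros eps Heps.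
  destruct (proj1 (Ccontinuous_eps G 1) (entire_continuous G HG (RtoC 1)) eps Heps) as [d [Hd H]].
  exists d; split; auto; intros w Hw Hwd.
  replace ((w - 1) * (G w / (w - 1))) with (G w) by (field; now apply Cminus_eq_contra).
  rewrite <- HG1 at 1; now apply H.
Qed.

Lemma Rabs_atan_le (y : R) : (Rabs (atan y) <= Rabs y)%R.
Proof.
destruct (MVT_gen atan 0 y (fun t => / (1 + t ^ 2))%R) as [c [_ Hc]].
- intros t _; apply is_derive_Reals, derivable_pt_lim_atan.
- intros t _; apply derivable_continuous_pt, derivable_pt_atan.
- rewrite atan_0, !Rminus_0_r in Hc; rewrite Hc, Rabs_mult.
  assert (Hp := pow2_ge_0 c).
  rewrite <- (Rmult_1_l (Rabs y)) at 2; apply Rmult_le_compat_r; [apply Rabs_pos|].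
  rewrite Rabs_pos_eq by (left; apply Rinv_0_lt_compat; lra).
  rewrite <- Rinv_1; apply Rinv_le_contravar; lra.
Qed.

(** Compare [ln |x + q|] with [ln x], and bound the argument by its tangent. *)
Lemma Clog_shift_lim (q : C) : is_Clim_seq (fun n => Clog (INR (S n) + q) - ln (INR (S n))) 0.
Proof.
assert (Hinv : is_lim_seq (fun n => Cmod q * / INR (S n))%R 0%R).
{ replace (Finite 0) with (Finite (Cmod q * 0)) by (f_equal; ring).
  apply is_lim_seq_mult'; [apply is_lim_seq_const | apply is_lim_seq_inv_INR_S]. }
apply is_lim_seq_spec in Hinv; destruct (Hinv (mkposreal (/ 2) ltac:(lra))) as [N HN].
apply is_Clim_seq_le with (fun n => (4 * (Cmod q * / INR (S n)))%R).
2:{ apply is_lim_seq_spec in Hinv.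
    replace (Finite 0) with (Finite (4 * 0)) by (f_equal; ring).
    apply is_lim_seq_mult'; [apply is_lim_seq_const | exact Hinv]. }
exists N; intros n Hn; specialize (HN n Hn).
change (Rabs (Cmod q * / INR (S n) - 0) < / 2)%R in HN.
replace (Clog (INR (S n) + q) - ln (INR (S n)) - 0) with (Clog (INR (S n) + q) - ln (INR (S n))) by ring.
assert (Hx : (0 < INR (S n))%R) by (apply lt_0_INR; lia).
set (x := INR (S n)) in *.
assert (Hix : (0 < / x)%R) by (now apply Rinv_0_lt_compat).
assert (Hq0 := Cmod_ge_0 q).
rewrite Rminus_0_r, Rabs_pos_eq in HN by (apply Rmult_le_pos; lra).
set (e := (Cmod q * / x)%R) in *.
assert (Hqe : (Cmod q = e * x)%R) by (unfold e; field; lra).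
assert (He : (0 <= e)%R) by (apply Rmult_le_pos; lra).
assert (HRe := re_le_Cmod q); apply Rabs_le_between in HRe.
assert (HRx : (x / 2 <= Re (x + q))%R) by (replace (Re (x + q)) with (x + Re q)%R by reflexivity; nra).
assert (HRp : (0 < Re (x + q))%R) by lra.
assert (HCm : (0 < Cmod (x + q))%R) by (generalize (Re_le_Cmod (x + q)); lra).
eapply Rle_trans; [apply Cmod_le_Re_Im|].
replace (Re (Clog (x + q) - ln x)) with (ln (Cmod (x + q)) - ln x)%R by (unfold Clog, Re; simpl; ring).
replace (Im (Clog (x + q) - ln x)) with (Carg (x + q)) by (unfold Clog, Im; simpl; ring).
assert (H1 : (Rabs (ln (Cmod (x + q)) - ln x) <= 2 * e)%R).
{ assert (Hup : (Cmod (x + q) <= x + e * x)%R).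
  { eapply Rle_trans; [apply Cmod_triangle|]; rewrite Cmod_R, Rabs_pos_eq by lra; lra. }
  assert (Hlo : (x - e * x <= Cmod (x + q))%R).
  { assert (Ht := Cmod_triangle (x + q) (- q)); rewrite Cmod_opp in Ht.
    replace (x + q + - q) with (RtoC x) in Ht by ring; rewrite Cmod_R, Rabs_pos_eq in Ht by lra; lra. }
  rewrite <- ln_div by lra.
  apply Rabs_le; split.
  - rewrite <- (Ropp_involutive (ln (Cmod (x + q) / x))).
    rewrite <- ln_Rinv by (apply Rdiv_lt_0_compat; lra).
    apply Ropp_le_contravar.
    eapply Rle_trans; [apply ln_le_sub_one, Rinv_0_lt_compat, Rdiv_lt_0_compat; lra|].
    replace (/ (Cmod (x + q) / x))%R with (x / Cmod (x + q))%R by (field; lra).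
    assert (x / Cmod (x + q) <= 1 + 2 * e)%R; [|lra].
    apply Rle_div_l; [lra|]; nra.
  - eapply Rle_trans; [apply ln_le_sub_one, Rdiv_lt_0_compat; lra|].
    assert (Cmod (x + q) / x <= 1 + 2 * e)%R; [|lra].
    apply Rle_div_l; [lra|]; nra. }
assert (H2 : (Rabs (Carg (x + q)) <= 2 * e)%R).
{ rewrite Carg_right_half_plane by exact HRp.
  eapply Rle_trans; [apply Rabs_atan_le|].
  rewrite Rabs_div, (Rabs_pos_eq (Re (x + q))) by lra.
  apply Rle_div_l; [lra|].
  replace (Im (x + q)) with (Im q) by (unfold Im; simpl; ring).
  assert (HI := Im_le_Cmod q); nra. }
lra.
Qed.

Lemma regularized_zeta_digamma (q : C) (G : C -> C) (l : C) :
  ~ nonpos_int q -> regularized_zeta q G l -> l = - digamma q.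
Proof.
intros Hq [_ [_ [_ [_ Hl]]]].
apply (is_Clim_seq_incr_n _ 1) in Hl.
assert (H := Clog_shift_lim q); apply (is_Clim_seq_incr_n _ 1) in H.
assert (Hs := is_Clim_seq_opp _ _ (is_Clim_seq_plus _ _ _ _ Hl H)).
assert (E := is_Clim_seq_unique _ _ (digamma q) Hs).
rewrite <- E; [ring|].
apply is_Clim_seq_ext with (2 := digamma_lim q Hq); intros n.
unfold gamma_logder; rewrite Nat.add_1_r, Csum_shift.
replace (INR 0 + q) with q by (simpl; ring); ring.
Qed.

(** The values on a half-plane to the right of [z] determine the derivative at [z]. This
    transfers the derivative at 1 from the continuation constructed above to any other one. *)
Lemma is_Cderive_agree_right (f g : C -> C) (z a b : C) :
  is_Cderive f z a -> is_Cderive g z b -> f z = g z ->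
  (forall w, (Re z < Re w)%R -> f w = g w) -> a = b.
Proof.
intros Hf Hg Hz H.
assert (Hd : is_Cderive (fun w => f w - g w) z (a - b)) by (now apply is_Cderive_minus).
apply Ceq_minus, Cmod_eq_0, Rle_antisym; [|apply Cmod_ge_0].
apply le_epsilon; intros eps Heps; rewrite Rplus_0_l.
destruct (proj1 (is_Cderive_eps _ _ _) Hd eps Heps) as [d [Hd0 Hd1]].
assert (Hm : Cmod (d / 2)%R = (d / 2)%R) by (rewrite Cmod_R, Rabs_pos_eq; lra).
specialize (Hd1 (z + (d / 2)%R)).
replace (z + (d / 2)%R - z) with (RtoC (d / 2)) in Hd1 by ring.
rewrite (H (z + (d / 2)%R)), Hz, Hm in Hd1.
2:{ rewrite re_plus, re_RtoC; lra. }
specialize (Hd1 ltac:(lra)).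
replace (g (z + (d / 2)%R) - g (z + (d / 2)%R) - (g z - g z) - (d / 2)%R * (a - b))
  with (- ((d / 2)%R * (a - b))) in Hd1 by ring.
rewrite Cmod_opp, Cmod_mult, Hm in Hd1.
apply Rmult_le_reg_l with (d / 2)%R; lra.
Qed.

(** * The generalized polygamma function *)

Definition hurwitz_reg (q s : C) : C := if Ceq_dec s 1 then 1 else (s - 1) * hurwitz_zeta s q.

Lemma entire_hurwitz_reg (q : C) : ~ nonpos_int q -> entire (hurwitz_reg q).
Proof.
intros Hq; destruct (hurwitz_zeta_spec q Hq) as [_ [HZ Hlim]].
apply (entire_removable (hurwitz_reg q) 1).
- intros s Hs.
  assert (Hr : (0 < Cmod (s - 1))%R) by (apply Cmod_gt_0; now apply Cminus_eq_contra).
  apply (holomorphic_at_ext_near (fun s => (s - 1) * hurwitz_zeta s q) _ s (Cmod (s - 1)) Hr).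
  + intros w Hw; unfold hurwitz_reg; destruct (Ceq_dec w 1) as [->|]; [|reflexivity].
    rewrite Cmod_minus_sym in Hw; lra.
  + apply (holomorphic_at_mult (fun s => s - 1) (fun s => hurwitz_zeta s q)); [|now apply HZ].
    apply holomorphic_at_minus; [apply holomorphic_at_id | apply holomorphic_at_const].
- apply Ccontinuous_eps; intros eps Heps.
  destruct (proj1 (has_C_limit_eps _ _ _) Hlim eps Heps) as [d [Hd H]].
  exists d; split; auto; intros w Hw; unfold hurwitz_reg.
  destruct (Ceq_dec (RtoC 1) 1) as [_|]; [|congruence].
  destruct (Ceq_dec w 1) as [->|Hw1]; [|now apply H].
  replace (1 - 1) with (RtoC 0) by ring; now rewrite Cmod_0.
Qed.

(** Both [hurwitz_reg] and the constructed continuation are given by the zeta series for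
    [Re s > 1]. *)
Lemma is_Cderive_hurwitz_reg_1 (q : C) : ~ nonpos_int q ->
  is_Cderive (hurwitz_reg q) 1 (- digamma q).
Proof.
intros Hq; destruct (regularized_zeta_exists q Hq) as [G [l HG]].
assert (El := regularized_zeta_digamma q G l Hq HG).
destruct HG as [_ [HG1 [Hl [HS _]]]]; destruct (hurwitz_zeta_spec q Hq) as [HZ _].
assert (Hd := is_Cderive_C_derive _ _ (entire_hurwitz_reg q Hq 1)).
replace (- digamma q) with (C_derive (hurwitz_reg q) 1); [exact Hd|].
rewrite <- El; apply (is_Cderive_agree_right (hurwitz_reg q) G 1); auto.
- rewrite HG1; unfold hurwitz_reg; destruct (Ceq_dec (RtoC 1) 1); congruence.
- intros s Hs; simpl in Hs.
  assert (Hs1 := Re_gt_1_neq s Hs).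
  unfold hurwitz_reg; destruct (Ceq_dec s 1) as [->|_]; [exfalso; apply Hs1; ring|].
  rewrite (Cseries_unique _ _ _ (HZ s Hs) (HS s Hs)); field; exact Hs1.
Qed.

(** As [1 / Gamma (- w) = - w / Gamma (1 - w)], the zero of the reciprocal of Gamma at the
    origin absorbs the pole of zeta, and this entire function is the bracket elsewhere. *)
Definition bracket_reg (q w : C) : C :=
  - (Cexp (euler_gamma * w) * (hurwitz_reg q (w + 1) * gamma_recip (- w))).

Lemma polygamma_bracket_reg (q w : C) : w <> 0 -> polygamma_bracket q w = bracket_reg q w.
Proof.
intros Hw; unfold polygamma_bracket, bracket_reg, hurwitz_reg.
destruct (Ceq_dec (w + 1) 1) as [E|_].
- exfalso; apply Hw; replace w with (w + 1 - 1) by ring; rewrite E; ring.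
- rewrite CGamma_recip; unfold Cdiv; rewrite Cinv_involutive; ring.
Qed.

Lemma is_Cderive_Cexp_scal (c z : C) : is_Cderive (fun w => Cexp (c * w)) z (c * Cexp (c * z)).
Proof.
apply (is_Cderive_comp Cexp (fun w => c * w)); [apply is_Cderive_Cexp|].
apply (is_Cderive_ext (fun w => 0 + w * c)); [intros w; ring | apply is_Cderive_affine].
Qed.

Lemma is_Cderive_bracket_reg (q z : C) : ~ nonpos_int q -> is_Cderive (bracket_reg q) z
  (- (euler_gamma * Cexp (euler_gamma * z) * (hurwitz_reg q (z + 1) * gamma_recip (- z))
      + Cexp (euler_gamma * z) * (C_derive (hurwitz_reg q) (z + 1) * gamma_recip (- z)
        + hurwitz_reg q (z + 1) * - C_derive gamma_recip (- z)))).
Proof.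
intros Hq; apply is_Cderive_opp.
apply (is_Cderive_mult (fun w => Cexp (euler_gamma * w))
  (fun w => hurwitz_reg q (w + 1) * gamma_recip (- w))); [apply is_Cderive_Cexp_scal|].
apply (is_Cderive_mult (fun w => hurwitz_reg q (w + 1)) (fun w => gamma_recip (- w))).
- replace (C_derive (hurwitz_reg q) (z + 1)) with ((1 + 0) * C_derive (hurwitz_reg q) (z + 1)) by ring.
  apply (is_Cderive_comp (hurwitz_reg q) (fun w => w + 1)).
  + apply is_Cderive_C_derive; now apply entire_hurwitz_reg.
  + apply is_Cderive_plus; [apply is_Cderive_id | apply is_Cderive_const].
- replace (- C_derive gamma_recip (- z)) with (- (1) * C_derive gamma_recip (- z)) by ring.
  apply (is_Cderive_comp gamma_recip (fun w => - w)).
  + apply is_Cderive_C_derive, entire_gamma_recip.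
  + apply is_Cderive_opp, is_Cderive_id.
Qed.

Lemma entire_bracket_reg (q : C) : ~ nonpos_int q -> entire (bracket_reg q).
Proof. intros Hq z; eexists; now apply is_Cderive_bracket_reg. Qed.

Definition polygamma_entire (q z : C) : C :=
  Cexp (- euler_gamma * z) * C_derive (bracket_reg q) z.

Lemma entire_polygamma_entire (q : C) : ~ nonpos_int q -> entire (polygamma_entire q).
Proof.
intros Hq z.
apply (holomorphic_at_mult (fun z => Cexp (- euler_gamma * z)) (C_derive (bracket_reg q))).
- eexists; apply is_Cderive_Cexp_scal.
- apply (entire_derive (bracket_reg q)); intros w.
  apply is_Cderive_C_derive; now apply entire_bracket_reg.
Qed.

Lemma bracket_reg_near (q z w : C) : (Cmod (w - z) < Cmod z)%R -> bracket_reg q w = polygamma_bracket q w.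
Proof.
intros H; symmetry; apply polygamma_bracket_reg; intros E; rewrite E in H.
replace (0 - z) with (- z) in H by ring; rewrite Cmod_opp in H; lra.
Qed.

Lemma gen_polygamma_formula_eq (q z : C) : ~ nonpos_int q -> z <> 0 ->
  gen_polygamma_formula z q = polygamma_entire q z.
Proof.
intros Hq Hz; unfold gen_polygamma_formula, polygamma_entire; f_equal.
apply is_C_derive_unique.
apply (is_Cderive_ext_near (bracket_reg q) _ z _ (Cmod z)).
- now apply Cmod_gt_0.
- intros w Hw; now apply bracket_reg_near with z.
- apply is_Cderive_C_derive; now apply entire_bracket_reg.
Qed.

Lemma gen_polygamma_formula_limit (q z : C) : ~ nonpos_int q ->
  has_C_limit (fun w => gen_polygamma_formula w q) z (polygamma_entire q z).
Proof.
intros Hq; apply has_C_limit_eps; intros eps Heps.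
destruct (proj1 (Ccontinuous_eps _ _)
  (entire_continuous _ (entire_polygamma_entire q Hq) z) eps Heps) as [d [Hd H]].
destruct (Ceq_dec z 0) as [Hz|Hz].
- exists d; split; auto; intros w Hwz Hw.
  rewrite gen_polygamma_formula_eq; [now apply H | exact Hq | congruence].
- exists (Rmin d (Cmod z)); split; [apply Rmin_pos; [auto | now apply Cmod_gt_0]|].
  intros w _ Hw; rewrite gen_polygamma_formula_eq; [|exact Hq|].
  + apply H; eapply Rlt_le_trans; [exact Hw | apply Rmin_l].
  + intros E; assert (Hw' : (Cmod (w - z) < Cmod z)%R)
      by (eapply Rlt_le_trans; [exact Hw | apply Rmin_r]).
    rewrite E in Hw'; replace (0 - z) with (- z) in Hw' by ring; rewrite Cmod_opp in Hw'; lra.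
Qed.

Lemma not_nonneg_int_neq_0 (z : C) : ~ nonneg_int z -> z <> 0.
Proof. intros Hz E; apply Hz; exists O; rewrite E; reflexivity. Qed.

Lemma gen_polygamma_eq (q z : C) : ~ nonpos_int q -> gen_polygamma z q = polygamma_entire q z.
Proof.
intros Hq; unfold gen_polygamma.
destruct (excluded_middle_informative (nonneg_int z)) as [_|Hz].
- apply is_C_lim_unique; now apply gen_polygamma_formula_limit.
- apply gen_polygamma_formula_eq; auto using not_nonneg_int_neq_0.
Qed.

(** The contributions of the exponential and of the reciprocal of Gamma to the derivative of
    the bracket are [- gamma] and [gamma] and cancel; the one of zeta is [digamma q]. *)
Lemma polygamma_entire_0 (q : C) : ~ nonpos_int q -> polygamma_entire q 0 = digamma q.
Proof.
intros Hq; unfold polygamma_entire.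
rewrite (is_C_derive_unique _ _ _ (is_Cderive_bracket_reg q 0 Hq)).
replace (0 + 1) with (RtoC 1) by ring; replace (- (0)) with (RtoC 0) by ring.
replace (euler_gamma * 0) with (RtoC 0) by ring; replace (- euler_gamma * 0) with (RtoC 0) by ring.
rewrite Cexp_0, gamma_recip_0.
rewrite (is_C_derive_unique _ _ _ (is_Cderive_hurwitz_reg_1 q Hq)).
rewrite (is_C_derive_unique _ _ _ is_Cderive_gamma_recip_0).
unfold hurwitz_reg; destruct (Ceq_dec (RtoC 1) 1) as [_|]; [ring | congruence].
Qed.

Theorem theorem2p3 :
  forall q : C, ~ nonpos_int q ->
    (forall z : C, ~ nonneg_int z -> holomorphic_at (polygamma_bracket q) z) /\
    (forall n : nat, exists l : C,
       has_C_limit (fun z => gen_polygamma_formula z q) (RtoC (INR n)) l) /\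
    entire (fun z => gen_polygamma z q) /\
    gen_polygamma 0 q = digamma q.
Proof.
intros q Hq; split; [|split; [|split]].
- intros z Hz; apply (holomorphic_at_ext_near (bracket_reg q) _ z (Cmod z)).
  + apply Cmod_gt_0; now apply not_nonneg_int_neq_0.
  + intros w Hw; now apply bracket_reg_near with z.
  + now apply entire_bracket_reg.
- intros n; exists (polygamma_entire q (RtoC (INR n))); now apply gen_polygamma_formula_limit.
- intros z; apply (holomorphic_at_ext_near (polygamma_entire q) _ z 1 Rlt_0_1).
  + intros w _; symmetry; now apply gen_polygamma_eq.
  + now apply entire_polygamma_entire.
- rewrite gen_polygamma_eq by exact Hq; now apply polygamma_entire_0.
Qed.
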